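(* Let $\mathfrak{g}$ be a finite-dimensional Lie algebra over a field $\mathbb{K}$ of characteristic $0$, let $\Gamma$ be an m.c.r. Lie subalgebra of $e(\mathrm{ad}\,\mathfrak{g})$ and let $(\mathfrak{s},\mathfrak{k},\mathfrak{m})$ be the $\Gamma$-triple of $\mathfrak{g}$. Let $\mu:\mathfrak{k}\to\mathfrak{gl}(\mathfrak{m})$ be the representation $\mu(x)=\mathrm{ad}\,x|_{\mathfrak{m}}$, let $\hat{\mathfrak{n}}$ be the Lie subalgebra of $\mathfrak{g}$ generated by $\mathfrak{m}$, and let $\mathfrak{B}=(\mathrm{Der}\,\hat{\mathfrak{n}})^{\Gamma}|_{\mathfrak{m}}\subset\mathfrak{gl}(\mathfrak{m})$. Assume that $\mu$ is injective. Then: 1. The map $\Theta:\delta\mapsto\delta|_{\mathfrak{m}}$ defines an isomorphism of Lie algebras from $(\mathrm{Der}\,\mathfrak{g})^{\Gamma}$ onto the normalizer $\mathrm{N}_{\mathfrak{B}}(\mu(\mathfrak{k}))$ of $\mu(\mathfrak{k})$ in $\mathfrak{B}$. 2. The Lie algebra $\mathrm{Der}\,\mathfrak{g}$ may be identified with (is isomorphic to) the Lie algebra $\mathfrak{s}\oplus\mathrm{N}_{\mathfrak{B}}(\mu(\mathfrak{k}))\oplus\mathfrak{m}$ whose (bilinear, skew-symmetric) law $\Phi$ is defined from the bracket $[\,,]$ of $\mathfrak{g}$ as follows: for all $(x_1,y_1,z_1),(x_2,y_2,z_2)\in\mathfrak{s}\times\mathrm{N}_{\mathfrak{B}}(\mu(\mathfrak{k}))\times\mathfrak{m}$,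 $$\Phi(x_1,x_2+y_2+z_2)=[x_1,x_2]+[x_1,z_2],$$ $$\Phi(y_1,y_2+z_2)=y_1\cdot y_2-y_2\cdot y_1+y_1\cdot z_2,$$ $$\Phi(z_1,z_2)=\mu(k)+m,$$ where $k$ and $m$ are the projections of $[z_1,z_2]$ into $\mathfrak{k}$ and $\mathfrak{m}$, respectively. 3. In particular, $\mathfrak{g}$ is complete if and only if $\mu(\mathfrak{k})$ is equal to its normalizer in $\mathfrak{B}$.
   Context: A Lie algebra is complete if its center is trivial and all its derivations are inner. $e(\mathrm{ad}\,\mathfrak{g})$ is the smallest algebraic Lie subalgebra of $\mathfrak{gl}(\mathfrak{g})$ containing $\mathrm{ad}\,\mathfrak{g}$. A Lie subalgebra of $\mathfrak{gl}(\mathfrak{g})$ is completely reducible (c.r.) if its natural action on $\mathfrak{g}$ is semisimple; an m.c.r. subalgebra of $e(\mathrm{ad}\,\mathfrak{g})$ is one maximal among the c.r. subalgebras contained in $e(\mathrm{ad}\,\mathfrak{g})$. The $\Gamma$-triple of $\mathfrak{g}$ is the triple of subspaces $(\mathfrak{s},\mathfrak{k},\mathfrak{m})$ such that $\mathfrak{s}$ is a Levi subalgebra; $\mathfrak{k}$ is a nilpotent Lie subalgebra with $[\mathfrak{s},\mathfrak{k}]=0$; $\mathfrak{m}$ is a subspace of the radical $\mathfrak{r}$ with $\mathfrak{r}=\mathfrak{m}\oplus\mathfrak{k}$ and $[\mathfrak{s}\oplus\mathfrak{k},\mathfrak{m}]=\mathfrak{m}$; $\mathfrak{g}=\mathfrak{s}\oplus\mathfrak{k}\oplus\mathfrak{m}$;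 and $\Gamma=\mathrm{ad}\,\mathfrak{s}\oplus(\mathrm{ad}\,\mathfrak{k})|_{\mathrm S}$, where $(\mathrm{ad}\,\mathfrak{k})|_{\mathrm S}$ is the set of semisimple Jordan components of elements of $\mathrm{ad}\,\mathfrak{k}$. $(\mathrm{Der}\,\mathfrak{g})^{\Gamma}$ is the centralizer of $\Gamma$ in $\mathrm{Der}\,\mathfrak{g}$. The subalgebra $\hat{\mathfrak{n}}$ is a nilpotent ideal of $\mathfrak{g}$, stable under $\Gamma$; $(\mathrm{Der}\,\hat{\mathfrak{n}})^{\Gamma}$ is the set of derivations of $\hat{\mathfrak{n}}$ commuting with the restriction of $\Gamma$ to $\hat{\mathfrak{n}}$; these stabilize $\mathfrak{m}$, and $(\mathrm{Der}\,\hat{\mathfrak{n}})^{\Gamma}|_{\mathfrak{m}}$ is the Lie algebra of their restrictions to $\mathfrak{m}$. Elements of $(\mathrm{Der}\,\mathfrak{g})^{\Gamma}$ likewise stabilize $\mathfrak{m}$. *)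

(* Defs.v *)
(* A Lie algebra over K is a (finite-dimensional) vectType V
   over K together with a law br : V -> V -> V satisfying [lie_law br]. *)
From HB Require Import structures.
From mathcomp Require Export all_boot all_order all_algebra.
From mathcomp Require Export mpoly.
From Stdlib Require Import ClassicalEpsilon.
Export GRing.Theory.

Set Implicit Arguments.
Unset Strict Implicit.
Unset Printing Implicit Defensive.

Open Scope ring_scope.

Section Comprehension.
Variables (K : fieldType) (V : vectType K).
Implicit Types (P : V -> Prop) (Q : {vspace V} -> Prop) (U : {vspace V}).

(* The subspace of all v such that P v; meaningful only when P is closed under
   linear combinations, cf. [mem_vspace_of]. *)
Definition vspace_of P : {vspace V} :=
  epsilon (inhabits 0%VS) (fun U => forall v, v \in U <-> P v).

Definition submod_pred P :=
  P 0 /\ forall (a : K) u v, P u -> P v -> P (a *: u + v).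

Lemma mem_vspace_of P : submod_pred P -> forall v, v \in vspace_of P <-> P v.
Proof.
move=> [P0 PD]; apply: (epsilon_spec (inhabits 0%VS)
  (fun U => forall v, v \in U <-> P v)).
pose Q n := exists2 U : {vspace V}, \dim U = n & forall v, v \in U -> P v.
have Q0 : Q 0%N.
  by exists 0%VS; [exact: dimv0 | move=> v; rewrite memv0 => /eqP ->].
have bnd n : Q n -> (n <= \dim {:V})%N by move=> [U <- _]; exact/dimvS/subvf.
have [n [U dU PU] maxn] :
    exists2 n, Q n & forall m, Q m -> (m <= n)%N.
  have H j : forall n, Q n -> (\dim {:V} - n <= j)%N ->
      exists2 n, Q n & forall m, Q m -> (m <= n)%N.
    elim: j => [|j IH] n Qn le_j.
      exists n => // m /bnd le_m; apply: leq_trans le_m _.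
      by rewrite -subn_eq0 -leqn0.
    case: (classic (exists2 m, Q m & (n < m)%N)) => [[m Qm lt_nm]|noQ].
      apply: (IH m Qm); rewrite -ltnS; apply: leq_trans le_j.
      by apply: ltn_sub2l => //; exact: leq_trans lt_nm (bnd _ Qm).
    exists n => // m Qm; rewrite leqNgt; apply/negP=> lt_nm.
    by apply: noQ; exists m.
  exact: (H _ 0%N Q0 (leqnn _)).
exists U => v; split; first exact: PU.
move=> Pv; have QUv : Q (\dim (U + <[v]>)%VS).
  exists (U + <[v]>)%VS => // w /memv_addP[u Uu [x /vlineP[a ->] ->]].
  by rewrite addrC; apply: PD => //; exact: PU.
have := maxn _ QUv; rewrite -dU => le_d.
have /eqP-> : U == (U + <[v]>)%VS by rewrite eqEdim addvSl.
exact: (subvP (addvSr U <[v]>%VS) v (memv_line v)).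
Qed.

Definition is_smallest Q U := Q U /\ forall U', Q U' -> (U <= U')%VS.
Definition is_largest Q U := Q U /\ forall U', Q U' -> (U' <= U)%VS.
Definition is_maximal Q U := Q U /\ forall U', Q U' -> (U <= U')%VS -> U' = U.

End Comprehension.

Section LieLaw.
Variables (K : fieldType) (V : vectType K) (br : V -> V -> V).
Implicit Types (U W I s k m r : {vspace V}).

Definition lie_law : Prop :=
  [/\ forall x, linear (br x),
      forall y, linear (br^~ y),
      forall x, br x x = 0
    & forall x y z, br x (br y z) + br y (br z x) + br z (br x y) = 0].

(* [U, W], the span of all brackets of elements of U and W (cf. [prodv]) *)
Definition lie_prod U W : {vspace V} :=
  <<allpairs br (vbasis U) (vbasis W)>>%VS.

Definition subalgebra U := (lie_prod U U <= U)%VS.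
Definition ideal I := (lie_prod fullv I <= I)%VS.

Definition solvable_space U :=
  exists n, iter n (fun W => lie_prod W W) U = 0%VS.
Definition nilpotent_space U := exists n, iter n (lie_prod U) U = 0%VS.

Definition is_radical r :=
  is_largest (fun I => ideal I /\ solvable_space I) r.

Definition is_generated_subalgebra U W :=
  is_smallest (fun W' => subalgebra W' /\ (U <= W')%VS) W.

Definition is_derivation (d : 'End(V)) :=
  forall x y, d (br x y) = br (d x) y + br x (d y).

Definition ad (x : V) : 'End(V) := linfun (br x).
Definition ad_space U : {vspace 'End(V)} := (linfun ad @: U)%VS.

Definition is_complete :=
  (forall x, (forall y, br x y = 0) -> x = 0) /\
  (forall d, is_derivation d -> exists x, d = ad x).

End LieLaw.

(* The law induced on a subalgebra U; [vsproj U] is the identity on U, and is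
   used here only to view br x y, which belongs to U, as an element of U. *)
Definition sub_law (K : fieldType) (V : vectType K) (br : V -> V -> V)
    (U : {vspace V}) (x y : subvs_of U) : subvs_of U :=
  vsproj U (br (vsval x) (vsval y)).

Definition gl_law (K : fieldType) (V : vectType K) (f g : 'End(V)) : 'End(V) :=
  (f \o g)%VF - (g \o f)%VF.

Definition lie_isomorphism (K : fieldType) (V W : vectType K)
    (brV : V -> V -> V) (brW : W -> W -> W) (F : 'Hom(V, W)) :=
  bijective F /\ forall x y, F (brV x y) = brW (F x) (F y).

Section LinearLieAlgebras.
Variables (K : fieldType) (V : vectType K).
Implicit Types (f g : 'End(V)) (A B E : {vspace 'End(V)}) (U W : {vspace V}).
Implicit Types (G : 'End(V) -> Prop).

(* The restriction of f to U, as an endomorphism of U, for f stabilizing U. *)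
Definition restr U f : 'End(subvs_of U) :=
  (linfun (vsproj U) \o f \o linfun vsval)%VF.

Definition stable A U := forall f, f \in A -> (f @: U <= U)%VS.

(* The natural action on V of the linear maps in A is semisimple. *)
Definition semisimple_action A :=
  forall U, stable A U ->
    exists2 W, stable A W & (U + W)%VS = fullv /\ directv (U + W).

Definition is_semisimple f := semisimple_action <[f]>%VS.
Definition is_nilpotent f := exists n, forall v, iter n f v = 0.

(* s is the semisimple component of the (additive) Jordan decomposition of f;
   "semisimple" does not mean "diagonalizable", as K need not be closed. *)
Definition jordan_semisimple_part f s :=
  exists n, [/\ f = s + n, (s \o n = n \o s)%VF, is_semisimple s
              & is_nilpotent n].

Definition mx_coord f (i : 'I_(\dim {:'End(V)})) : K :=
  coord (vbasis {:'End(V)}) i f.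

(* Zariski-closed subgroups of GL(V), given by their K-points, and their Lie
   algebras: the tangent space at the identity, i.e. the common kernel of the
   differentials at \1 of the polynomials vanishing on the group.  Over an
   infinite perfect field the K-points of a connected linear algebraic group
   are dense in it, so in characteristic 0 this gives the Lie algebras of all
   the algebraic subgroups of GL(V) defined over K. *)
Definition algebraic_group G :=
  [/\ G \1%VF,
      forall f g, G f -> G g -> G (f \o g)%VF,
      forall f, G f -> G (f^-1)%VF
    & exists S : {mpoly K[\dim {:'End(V)}]} -> Prop,
        forall f, G f <-> lker f = 0%VS /\
                          forall p, S p -> p.@[mx_coord f] = 0].

Definition is_lie_algebra_of G A :=
  forall X, X \in A <->
    forall p : {mpoly K[\dim {:'End(V)}]},
      (forall g, G g -> p.@[mx_coord g] = 0) ->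
      \sum_i (p^`M(i)).@[mx_coord \1%VF] * mx_coord X i = 0.

Definition algebraic_subalgebra A :=
  subalgebra (@gl_law K V) A /\
  exists2 G, algebraic_group G & is_lie_algebra_of G A.

(* E is the smallest algebraic Lie subalgebra containing A; for A = ad g it is
   e(ad g). *)
Definition is_algebraic_hull A E :=
  is_smallest (fun B => algebraic_subalgebra B /\ (A <= B)%VS) E.

Definition cr_subalgebra A := subalgebra (@gl_law K V) A /\ semisimple_action A.

Definition is_mcr E A :=
  is_maximal (fun B => cr_subalgebra B /\ (B <= E)%VS) A.

Definition normalizer_in A B : {vspace 'End(V)} :=
  vspace_of (fun f => f \in A /\ forall g, g \in B -> gl_law f g \in B).

End LinearLieAlgebras.

Section GammaTriple.
Variables (K : fieldType) (V : vectType K) (br : V -> V -> V).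
Variable Gamma : {vspace 'End(V)}.
Implicit Types (s k m r n : {vspace V}).

(* a subalgebra supplementary to the radical r (hence semisimple) *)
Definition is_levi r s :=
  [/\ subalgebra br s, (s + r)%VS = fullv & directv (s + r)].

(* (ad k)|_S *)
Definition ad_semisimple_parts k (f : 'End(V)) :=
  exists2 x, x \in k & jordan_semisimple_part (ad br x) f.

Definition is_Gamma_triple s k m :=
  [/\ exists r, [/\ is_radical br r, is_levi r s, r = (m + k)%VS
                  & directv (m + k)],
      [/\ subalgebra br k, nilpotent_space br k & lie_prod br s k = 0%VS],
      lie_prod br (s + k) m = m,
      (s + k + m)%VS = fullv /\ directv (s + k + m)
    & exists T : {vspace 'End(V)},
        [/\ forall f, f \in T <-> ad_semisimple_parts k f,
            Gamma = (ad_space br s + T)%VS & directv (ad_space br s + T)]].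

Definition Der : {vspace 'End(V)} := vspace_of (is_derivation br).

Definition Der_centralizer : {vspace 'End(V)} :=
  vspace_of (fun d => is_derivation br d /\
                      forall g, g \in Gamma -> (d \o g = g \o d)%VF).

Definition mu k m : 'Hom(subvs_of k, 'End(subvs_of m)) :=
  linfun (fun x : subvs_of k => restr m (ad br (vsval x))).

(* (Der n)^Gamma |_ m, for a Gamma-stable subalgebra n containing m. *)
Definition Der_restr n m : {vspace 'End(subvs_of m)} :=
  vspace_of (fun b : 'End(subvs_of m) =>
    exists d : 'End(subvs_of n),
      [/\ is_derivation (@sub_law K V br n) d,
          forall g, g \in Gamma -> (d \o restr n g = restr n g \o d)%VF
        & forall z : subvs_of m, vsval (b z) = vsval (d (vsproj n (vsval z)))]).

End GammaTriple.

Section Law.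
Variables (K : fieldType) (V : vectType K) (br : V -> V -> V).
Variables (s k m : {vspace V}) (N : {vspace 'End(subvs_of m)}).
Let W : vectType K := (subvs_of s * subvs_of N * subvs_of m)%type.

(* s (+) N (+) m seen inside g (+) gl(m) (+) g *)
Definition components (w : W) : V * 'End(subvs_of m) * V :=
  (vsval w.1.1, vsval w.1.2, vsval w.2).

(* Bilinearity, skew-symmetry and the three formulas determine Phi; the
   projections refer to the decomposition g = s (+) k (+) m. *)
Definition is_Phi (Phi : W -> W -> W) :=
  [/\ (forall u, linear (Phi u)) /\ (forall u v, Phi u v = - Phi v u),
      forall x1 x2 y2 z2, components (Phi (x1, 0, 0) (x2, y2, z2)) =
        (br (vsval x1) (vsval x2), 0, br (vsval x1) (vsval z2)),
      forall y1 y2 z2, components (Phi (0, y1, 0) (0, y2, z2)) =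
        (0, (vsval y1 \o vsval y2)%VF - (vsval y2 \o vsval y1)%VF,
         vsval (vsval y1 z2))
    & forall z1 z2, components (Phi (0, 0, z1) (0, 0, z2)) =
        (0, mu br k m (vsproj k (daddv_pi k (s + m) (br (vsval z1) (vsval z2)))),
         daddv_pi m (s + k) (br (vsval z1) (vsval z2)))].

End Law.

Section Membership.
Variables (K : fieldType) (V : vectType K).

Lemma submod_commute (A : {vspace 'End(V)}) :
  submod_pred (fun d : 'End(V) => forall g, g \in A -> (d \o g = g \o d)%VF).
Proof.
split=> [g _|a u v Pu Pv g gA]; first by rewrite comp_lfun0l comp_lfun0r.
by rewrite comp_lfunDl comp_lfunDr -comp_lfunZl -comp_lfunZr Pu ?Pv.
Qed.

Lemma mem_normalizer_in (A B : {vspace 'End(V)}) f :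
  f \in normalizer_in A B <->
  f \in A /\ forall g, g \in B -> gl_law f g \in B.
Proof.
apply: mem_vspace_of; split.
  split=> [|g _]; first exact: mem0v.
  by rewrite /gl_law comp_lfun0l comp_lfun0r subrr mem0v.
move=> a u v [Au Bu] [Av Bv]; split=> [|g gB]; first by rewrite memvD ?memvZ.
have -> : gl_law (a *: u + v) g = a *: gl_law u g + gl_law v g.
  rewrite /gl_law comp_lfunDl comp_lfunDr -comp_lfunZl -comp_lfunZr.
  by rewrite scalerBr opprD addrACA.
by rewrite memvD ?memvZ ?Bu ?Bv.
Qed.

Variable br : V -> V -> V.
Hypothesis lieV : lie_law br.

Lemma submod_derivation : submod_pred (is_derivation br).
Proof.
case: lieV => linr linl _ _.
have r0 x : br x 0 = 0.
  by have := linr x (-1) 0 0; rewrite scaleN1r oppr0 addr0 scaleN1r addNr.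
have l0 y : br 0 y = 0.
  by have := linl y (-1) 0 0; rewrite /= scaleN1r oppr0 addr0 scaleN1r addNr.
split=> [x y|a u v du dv x y]; first by rewrite !zero_lfunE l0 r0 addr0.
rewrite !add_lfunE !scale_lfunE du dv linr.
have -> := linl y a (u x) (v x).
by rewrite scalerDr addrACA.
Qed.

Lemma adE x y : ad br x y = br x y.
Proof.
case: lieV => linr _ _ _.
pose B := GRing.isLinear.Build K V V *:%R (br x) (linr x).
pose f : {linear V -> V} := HB.pack (br x) B.
exact: (lfunE f).
Qed.

Lemma mem_ad_space (U : {vspace V}) f :
  f \in ad_space br U <-> exists2 x, x \in U & f = ad br x.
Proof.
case: lieV => _ linl _ _.
have lin_ad : linear (ad br : V -> 'End(V)).
  move=> a u v; apply/lfunP=> y; rewrite add_lfunE scale_lfunE !adE.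
  exact: (linl y).
pose B := GRing.isLinear.Build K V 'End(V) *:%R (ad br) lin_ad.
pose F : {linear V -> 'End(V)} := HB.pack (ad br) B.
have FE x : linfun (ad br) x = ad br x by exact: (lfunE F).
split=> [/memv_imgP[x xU ->]|[x xU ->]]; first by exists x; rewrite ?FE.
by rewrite -FE memv_img.
Qed.

Lemma mem_lie_prod (U W : {vspace V}) x y :
  x \in U -> y \in W -> br x y \in lie_prod br U W.
Proof.
case: lieV => linr linl _ _ xU yW.
have r0 u : br u 0 = 0.
  by have := linr u (-1) 0 0; rewrite scaleN1r oppr0 addr0 scaleN1r addNr.
have l0 u : br 0 u = 0.
  by have := linl u (-1) 0 0; rewrite /= scaleN1r oppr0 addr0 scaleN1r addNr.
have suml (I : Type) (t : seq I) (F : I -> V) (c : I -> K) z :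
    br (\sum_(i <- t) c i *: F i) z = \sum_(i <- t) c i *: br (F i) z.
  elim: t => [|i t IH]; first by rewrite !big_nil l0.
  by rewrite !big_cons -IH; exact: (linl z).
have sumr (I : Type) (t : seq I) (F : I -> V) (c : I -> K) z :
    br z (\sum_(i <- t) c i *: F i) = \sum_(i <- t) c i *: br z (F i).
  elim: t => [|i t IH]; first by rewrite !big_nil r0.
  by rewrite !big_cons -IH; exact: (linr z).
rewrite (coord_vbasis xU) (coord_vbasis yW) suml.
apply: memv_suml => i _; rewrite memvZ // sumr.
apply: memv_suml => j _; rewrite memvZ //; apply: memv_span.
by apply/allpairsP; exists ((vbasis U)`_i, (vbasis W)`_j);
  rewrite !mem_nth ?size_tuple.
Qed.

Lemma lie_prod_subP (U W X : {vspace V}) :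
  reflect (forall x y, x \in U -> y \in W -> br x y \in X)
          (lie_prod br U W <= X)%VS.
Proof.
apply: (iffP idP) => [sX x y xU yW|H]; first exact/(subvP sX)/mem_lie_prod.
apply/span_subvP => _ /allpairsP[[x y] /= [xU yW ->]].
by apply: H; exact: vbasis_mem.
Qed.

Lemma restrE (U : {vspace V}) (f : 'End(V)) (u : subvs_of U) :
  (f @: U <= U)%VS -> vsval (restr U f u) = f (vsval u).
Proof.
move=> fU; rewrite !comp_lfunE !lfunE /= vsprojK //.
by apply: (subvP fU); rewrite memv_img ?subvsP.
Qed.

Lemma muE (k m : {vspace V}) (x : subvs_of k) (z : subvs_of m) :
  (lie_prod br k m <= m)%VS ->
  vsval (mu br k m x z) = br (vsval x) (vsval z).
Proof.
move=> /lie_prod_subP km_m; case: (lieV) => _ linl _ _.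
pose G (x : subvs_of k) := restr m (ad br (vsval x)).
have lin_G : linear G.
  move=> a u v; apply/lfunP=> y; rewrite add_lfunE scale_lfunE /G /restr.
  rewrite !comp_lfunE !adE [vsval _]linearP -[RHS]linearP; congr (linfun _ _).
  exact: (linl _).
pose B := GRing.isLinear.Build K (subvs_of k) 'End(subvs_of m) *:%R G lin_G.
pose F : {linear subvs_of k -> 'End(subvs_of m)} := HB.pack G B.
have -> : mu br k m x = G x by exact: (lfunE F).
rewrite restrE ?adE //; apply/subvP => _ /memv_imgP[y ym ->].
by rewrite adE km_m ?subvsP.
Qed.

Lemma mem_Der d : d \in Der br <-> is_derivation br d.
Proof. exact: (mem_vspace_of submod_derivation). Qed.

Lemma mem_Der_centralizer (Gamma : {vspace 'End(V)}) d :
  d \in Der_centralizer br Gamma <->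
  is_derivation br d /\ forall g, g \in Gamma -> (d \o g = g \o d)%VF.
Proof.
have [D0 DD] := submod_derivation; have [C0 CD] := submod_commute Gamma.
apply: (mem_vspace_of (P := fun d => _ /\ _)); split=> //.
by move=> a u v [du cu] [dv cv]; split; [exact: DD | exact: CD].
Qed.

End Membership.

Lemma lie_law_sub (K : fieldType) (V : vectType K) (br : V -> V -> V)
  (U : {vspace V}) : lie_law br -> subalgebra br U -> lie_law (@sub_law K V br U).
Proof.
move=> lieV subU; case: (lieV) => linr linl alt jac.
have /(lie_prod_subP lieV) memU := subU.
have vE (x y : subvs_of U) : vsval (sub_law br x y) = br (vsval x) (vsval y).
  by rewrite vsprojK ?memU ?subvsP.
split=> [x a u v|y a u v|x|x y z]; apply: val_inj.
- by rewrite linearP /= !vE linearP; exact: linr.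
- by rewrite linearP /= !vE linearP; exact: linl.
- by rewrite /= vE alt.
- by rewrite !linearD /= !vE jac.
Qed.

Lemma mem_Der_restr (K : fieldType) (V : vectType K) (br : V -> V -> V)
  (Gamma : {vspace 'End(V)}) (n m : {vspace V}) (b : 'End(subvs_of m)) :
  lie_law br -> subalgebra br n ->
  b \in Der_restr br Gamma n m <->
  exists d : 'End(subvs_of n),
    [/\ is_derivation (@sub_law K V br n) d,
        forall g, g \in Gamma -> (d \o restr n g = restr n g \o d)%VF
      & forall z : subvs_of m, vsval (b z) = vsval (d (vsproj n (vsval z)))].
Proof.
move=> lieV subn.
have [D0 DD] := submod_derivation (lie_law_sub lieV subn).
apply: (mem_vspace_of (P := fun b => exists d, _)); split.
  exists 0; split=> // [g _|z]; first by rewrite comp_lfun0l comp_lfun0r.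
  by rewrite !zero_lfunE.
move=> a u v [d [dd dc dr]] [e [ed ec er]]; exists (a *: d + e); split.
- exact: DD.
- move=> g gG; rewrite comp_lfunDl comp_lfunDr -comp_lfunZl -comp_lfunZr.
  by rewrite dc ?ec.
- by move=> z; rewrite !add_lfunE !scale_lfunE !linearP /= dr er.
Qed.

(* Main.v *)
(* Write Der(g)^Gamma for the derivations commuting with Gamma.  The Levi factor
   s has no solvable ideal, so Cartan's criterion and Whitehead's first lemma
   make every derivation inner on s; after subtracting an inner derivation it
   kills s.  The semisimple part t of ad x, for x in k, is a polynomial without
   constant term in ad x, and [t, .] is the same polynomial in [ad x, .]; hence
   t is a derivation, [t, Der g] consists of inner derivations, and Fitting's
   decomposition for [t, .] makes the derivation commute with t.  Therefore
   Der g = ad g + Der(g)^Gamma.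

   Complete reducibility of Gamma and Engel's theorem for k acting on
   m / Gamma m give m = Gamma m and k = g^Gamma.  So d in Der(g)^Gamma kills s and
   stabilises k and m (for m one uses that the radical is characteristic), and
   since mu is injective d is determined by its restriction to m, which
   normalises mu(k) because [d, ad x] = ad (d x).  Conversely b in the normalizer
   extends by 0 on s and by mu^-1 [b, mu(.)] on k; on [m, m] this agrees with
   the derivation of n inducing b, again because mu is injective. *)
From HB Require Import structures.
Require Import Defs.
From mathcomp Require Import separable fieldext ring.
From Stdlib Require Import ClassicalEpsilon.

Set Implicit Arguments.
Unset Strict Implicit.
Unset Printing Implicit Defensive.
Local Open Scope ring_scope.

(** * Polynomials in an endomorphism *)

(** The field need not be algebraically closed, so semisimple maps need not be diagonalizable.
    Semisimplicity is therefore handled as annihilation by a separable polynomial ([ssep]). In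
    characteristic 0 this property passes to sums of commuting maps and to commutator maps, and it
    gives [D v = 0] as soon as [D (D v) = 0], which is what the Fitting decomposition needs.
    Eigenvalues enter only in Cartan's criterion, where scalars are extended to a splitting field
    and nilpotency descends. The algebra s + N + m has no summand k because ad k already lies in
    Der(g)^Gamma, where Theta identifies it with mu(k) inside N; since the center is trivial, ad k
    is the whole intersection of ad g with Der(g)^Gamma. The law Phi is the commutator of Der g
    transported through (x, b, z) -> ad x + Theta^-1 b + ad z, so the Jacobi identity is inherited
    and only the displayed formulas have to be checked. *)

Lemma coprimep_bezout (K : fieldType) (p q : {poly K}) :
  coprimep p q -> exists u v, u * p + v * q = 1.
Proof.
case/Bezout_coprimepP => -[u v] /=.
rewrite -size_poly_eq1 => /size_poly1P[c c0 E].
exists (c^-1 *: u), (c^-1 *: v).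
by rewrite -!scalerAl -scalerDr E -mul_polyC -polyCM mulVf.
Qed.

(* The library makes 'End(V) a ring only when V is known to be nonzero. *)
Section EndRing.
Variables (K : fieldType) (V : vectType K).
Implicit Types (f g : 'End(V)) (p q : {poly K}).

Fact end_mulA : associative (@comp_lfun K V V V).
Proof. by move=> f g h; rewrite comp_lfunA. Qed.
Fact end_mul1l : left_id \1%VF (@comp_lfun K V V V).
Proof. by move=> f; rewrite comp_lfun1l. Qed.
Fact end_mul1r : right_id \1%VF (@comp_lfun K V V V).
Proof. by move=> f; rewrite comp_lfun1r. Qed.
Fact end_mulDl : left_distributive (@comp_lfun K V V V) +%R.
Proof. by move=> f g h; rewrite comp_lfunDl. Qed.
Fact end_mulDr : right_distributive (@comp_lfun K V V V) +%R.
Proof. by move=> f g h; rewrite comp_lfunDr. Qed.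

HB.instance Definition _ := GRing.Zmodule_isPzRing.Build 'End(V)
  end_mulA end_mul1l end_mul1r end_mulDl end_mulDr.

Lemma endM (f g : 'End(V)) v : (f * g) v = f (g v).
Proof. exact: comp_lfunE. Qed.
Lemma end1 v : (1 : 'End(V)) v = v.
Proof. exact: id_lfunE. Qed.
Lemma endZl a (f g : 'End(V)) : (a *: f) * g = a *: (f * g).
Proof. by rewrite /GRing.mul /= comp_lfunZl. Qed.
Lemma endZr a (f g : 'End(V)) : f * (a *: g) = a *: (f * g).
Proof. by rewrite /GRing.mul /= comp_lfunZr. Qed.
Lemma endX (f : 'End(V)) n v : (f ^+ n) v = iter n f v.
Proof. by elim: n => [|n IH]; rewrite ?expr0 ?end1 // exprS endM IH. Qed.

Lemma linfunE (W : vectType K) (f : V -> W) (lf : linear f) v :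
  (linfun f : 'Hom(V, W)) v = f v.
Proof.
pose B := GRing.isLinear.Build K V W *:%R f lf.
pose F : {linear V -> W} := HB.pack f B.
exact: (lfunE F).
Qed.

Definition peval (f : 'End(V)) (p : {poly K}) : 'End(V) :=
  \sum_(i < size p) p`_i *: f ^+ i.

Lemma peval_wide f p n : (size p <= n)%N ->
  peval f p = \sum_(i < n) p`_i *: f ^+ i.
Proof.
move=> le_pn; rewrite /peval (big_ord_widen n (fun i => p`_i *: f ^+ i) le_pn).
rewrite [RHS](bigID (fun i : 'I_n => (i < size p)%N)) /= [X in _ + X]big1 ?addr0 //.
by move=> i; rewrite -leqNgt => le_pi; rewrite nth_default ?scale0r.
Qed.

Lemma pevalD f p q : peval f (p + q) = peval f p + peval f q.
Proof.
have le := leq_maxl; have le' := leq_maxr.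
rewrite (peval_wide f (size_polyD p q)) (peval_wide f (le (size p) (size q))).
rewrite (peval_wide f (le' (size p) (size q))) -big_split /=.
by apply: eq_bigr => i _; rewrite coefD scalerDl.
Qed.

Lemma pevalZ f a p : peval f (a *: p) = a *: peval f p.
Proof.
rewrite (peval_wide f (size_scale_leq a p)) scaler_sumr.
by apply: eq_bigr => i _; rewrite coefZ scalerA.
Qed.

Lemma pevalN f p : peval f (- p) = - peval f p.
Proof. by rewrite -scaleN1r pevalZ scaleN1r. Qed.
Lemma pevalB f p q : peval f (p - q) = peval f p - peval f q.
Proof. by rewrite pevalD pevalN. Qed.
Lemma peval0 f : peval f 0 = 0.
Proof. by rewrite /peval size_poly0 big_ord0. Qed.
Lemma pevalC f (c : K) : peval f c%:P = c *: (1 : 'End(V)).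
Proof.
by rewrite (peval_wide f (size_polyC_leq1 c)) big_ord1 coefC /= expr0.
Qed.
Lemma peval1 f : peval f 1 = 1.
Proof. by rewrite pevalC scale1r. Qed.

Lemma pevalMX f p : peval f (p * 'X) = peval f p * f.
Proof.
have le : (size (p * 'X)%R <= (size p).+1)%N.
  by apply: leq_trans (size_polyMleq _ _) _; rewrite size_polyX addn2.
rewrite (peval_wide f le) big_ord_recl coefMX eqxx scale0r add0r mulr_suml.
by apply: eq_bigr => i _; rewrite coefMX /= /bump /= endZl exprSr.
Qed.

Lemma pevalX f : peval f 'X = f.
Proof. by rewrite -['X]mul1r pevalMX peval1 mul1r. Qed.

Lemma comm_peval f g p : f * g = g * f -> peval f p * g = g * peval f p.
Proof.
move=> fg; elim/poly_ind: p => [|p c IH]; first by rewrite peval0 mul0r mulr0.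
by rewrite pevalD pevalMX pevalC mulrDl mulrDr endZl endZr mul1r mulr1 mulrA
  -IH -!mulrA fg.
Qed.

Lemma pevalM f p q : peval f (p * q) = peval f p * peval f q.
Proof.
elim/poly_ind: q => [|q c IH]; first by rewrite mulr0 peval0 mulr0.
rewrite mulrDr pevalD mulrA pevalMX IH pevalD pevalMX pevalC mulrDr mulrA.
by rewrite endZr mulr1 [p * _]mulrC mul_polyC pevalZ.
Qed.

Lemma pevalXn f p n : peval f (p ^+ n) = peval f p ^+ n.
Proof. by elim: n => [|n IH]; rewrite ?peval1 // !exprS pevalM IH. Qed.

Lemma peval_comp f p q : peval f (p \Po q) = peval (peval f q) p.
Proof.
elim/poly_ind: p => [|p c IH]; first by rewrite comp_poly0 !peval0.
by rewrite comp_polyD comp_polyM comp_polyX comp_polyC !pevalD !pevalM pevalX IH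
  !pevalC.
Qed.

Lemma peval_dvd f p q : p %| q -> peval f p = 0 -> peval f q = 0.
Proof. by move=> /dvdpP[r ->] p0; rewrite pevalM p0 mulr0. Qed.

Lemma peval_stable f (U : {vspace V}) p :
  (forall u, u \in U -> f u \in U) -> forall u, u \in U -> peval f p u \in U.
Proof.
move=> fU; elim/poly_ind: p => [|p c IH] u uU.
  by rewrite peval0 zero_lfunE mem0v.
by rewrite pevalD pevalMX pevalC add_lfunE scale_lfunE endM end1 memvD ?memvZ
  ?IH ?fU.
Qed.

(** [\dim {:'End(V)} + 1] powers of [f] must be linearly dependent. *)
Lemma peval_annih f : exists2 p, p != 0 & peval f p = 0.
Proof.
pose n := \dim {:'End(V)}; pose X := [tuple f ^+ i | i < n.+1].
have XE (j : 'I_n.+1) : X`_j = f ^+ j by rewrite -tnth_nth tnth_mktuple.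
have [[k [j kj s0]]|no] := classic (exists k : 'I_n.+1 -> K,
    exists2 j, k j != 0 & \sum_j k j *: X`_j = 0).
  exists (\poly_(i < n.+1) k (inord i)).
    apply: contra_neq kj => p0; have := coef0 K j; rewrite -p0 coef_poly ltn_ord.
    by rewrite inord_val.
  rewrite (peval_wide f (size_poly _ _)) -[RHS]s0; apply: eq_bigr => j' _.
  by rewrite coef_poly ltn_ord inord_val XE.
have : free X.
  apply/freeP => k k0 j; apply/eqP/negPn/negP => kj.
  by apply: no; exists k; exists j.
rewrite /free => /eqP; rewrite size_tuple => d.
by have := dimvS (subvf <<X>>%VS); rewrite d ltnn.
Qed.

(** In characteristic 0 this is equivalent to [is_semisimple] ([semisimple_ssep],
    [ssep_semisimple]); being an equation, it transfers more easily to maps built from [f]. *)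
Definition ssep f := exists2 p, separable_poly p & peval f p = 0.

(** On a kernel vector of [f] a polynomial acts as its constant term. Applied to [f v] and then to
    [v], the equation [p(f) = 0] forces [f v = 0] unless the two lowest coefficients of [p] vanish;
    then ['X^2] divides [p], against separability. *)
Lemma ssep_ker2 f v : ssep f -> f (f v) = 0 -> f v = 0.
Proof.
case=> p sp pf0 ffv.
have ev q w : f w = 0 -> peval f q w = q`_0 *: w.
  move=> fw; elim/poly_ind: q => [|q c IH].
    by rewrite peval0 zero_lfunE coef0 scale0r.
  by rewrite pevalD pevalMX pevalC add_lfunE endM fw linear0 add0r
    scale_lfunE end1 coefD coefMX coefC add0r.
have [q [c Ep]] : exists q, exists c, p = q * 'X + c%:P.
  by elim/poly_ind: p {sp pf0} => [|q c _]; [exists 0, 0; rewrite mul0r add0r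
    | exists q, c].
have [q' [a Eq]] : exists q', exists a, q = q' * 'X + a%:P.
  by elim/poly_ind: q {Ep} => [|q' a _]; [exists 0, 0; rewrite mul0r add0r
    | exists q', a].
have p0 : p`_0 = c by rewrite Ep coefD coefMX coefC add0r.
have q0 : q`_0 = a by rewrite Eq coefD coefMX coefC add0r.
have := ev p _ ffv; rewrite pf0 zero_lfunE p0 => /esym/eqP.
rewrite scaler_eq0 => /orP[/eqP c0|/eqP//].
have : peval f p v = 0 by rewrite pf0 zero_lfunE.
rewrite Ep c0 addr0 pevalMX endM ev // q0 => /eqP.
rewrite scaler_eq0 => /orP[/eqP a0|/eqP//].
move: (@separable_nosquare _ _ 'X 2 sp isT); rewrite size_polyX => /(_ isT)/negP[].
by rewrite Ep Eq c0 a0 !addr0 -mulrA dvdp_mulIr.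
Qed.

Lemma ssep_nilp f v n : ssep f -> iter n f v = 0 -> f v = 0.
Proof.
move=> sf; elim: n => [|n IH] /=; first by move->; rewrite linear0.
case: n IH => [|n] IH //= e; apply: IH => /=; exact: ssep_ker2.
Qed.

(** If [h = [f, g]] commutes with [f], then [[q(f), g] = q'(f) h] for every [q]. With [q = p] this
    gives [p'(f) h = 0], and [p'(f)] is invertible because [p] is coprime to its derivative. *)
Lemma ssep_comm f g : ssep f ->
  f * (f * g - g * f) = (f * g - g * f) * f -> f * g = g * f.
Proof.
case=> p sp pf0; set h := f * g - g * f => fh.
have D q : peval f q * g - g * peval f q = peval f q^`() * h.
  elim/poly_ind: q => [|q c IH]; first by rewrite deriv0 peval0 !mul0r mulr0 subr0.
  rewrite derivMXaddC !pevalD pevalC !pevalMX [LHS](_ : _ =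
    peval f q * f * g - g * (peval f q * f)); last first.
    rewrite mulrDl mulrDr endZl endZr mul1r mulr1 opprD addrACA.
    by rewrite subrr addr0.
  rewrite mulrDl -[_ * f * h]mulrA fh [_ * (h * f)]mulrA -IH mulrBl /h mulrBr !mulrA addrA.
  by rewrite subrK.
have := D p; rewrite pf0 mul0r mulr0 subr0 => /esym p'h.
have cp : coprimep p p^`() by move: sp; rewrite unlock.
have [u [w uw]] := coprimep_bezout cp.
apply/subr0_eq; rewrite -[LHS]mul1r -(peval1 f) -uw pevalD !pevalM pf0 mulr0.
by rewrite add0r -mulrA p'h mulr0.
Qed.

(** The kernel of [D] in [X] meets [D(X)] trivially by the first hypothesis; rank and nullity then
    show that the two together fill [X]. *)
Lemma fitting (D : 'End(V)) (X : {vspace V}) :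
    (forall v, D (D v) = 0 -> D v = 0) -> (forall v, v \in X -> D v \in X) ->
  forall v, v \in X ->
    exists v0 v1, [/\ v0 \in X, v1 \in X, D v0 = 0 & v = v0 + D v1].
Proof.
move=> D2 DX v vX.
have I0 : ((X :&: lker D) :&: (D @: X) = 0)%VS.
  apply/eqP; rewrite -subv0; apply/subvP => w /memv_capP[/memv_capP[_ wk]].
  case/memv_imgP=> w' w'X E; rewrite memv0 E; apply/eqP/D2.
  by move: wk; rewrite memv_ker E => /eqP.
have sX : ((X :&: lker D) + (D @: X) <= X)%VS.
  rewrite subv_add capvSl /=; apply/subvP => _ /memv_imgP[w wX ->]; exact: DX.
have : v \in ((X :&: lker D) + (D @: X))%VS.
  suff -> : ((X :&: lker D) + (D @: X))%VS = X by [].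
  by apply/eqP; rewrite eqEdim sX /= (dimv_disjoint_sum I0) limg_ker_dim.
case/memv_addP=> v0 /memv_capP[v0X]; rewrite memv_ker => /eqP Dv0.
by case=> _ /memv_imgP[v1 v1X ->] E; exists v0, v1.
Qed.

End EndRing.

(** * Commutators, semisimplicity and Jordan decomposition *)

Section Commutator.
Variables (K : fieldType) (V : vectType K).
Implicit Types (f g h : 'End(V)) (p q : {poly K}).

Definition lmul f : 'End('End(V)) := linfun (fun g : 'End(V) => f * g).
Definition rmul f : 'End('End(V)) := linfun (fun g : 'End(V) => g * f).
(** As a difference of two commuting maps, each satisfying the polynomial equations of [f], the
    commutator map inherits separability and nilpotency from [f]. *)
Definition bracket_by f : 'End('End(V)) := lmul f - rmul f.

Lemma lmulE f g : lmul f g = f * g.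
Proof. by apply: linfunE => a u v; rewrite mulrDr endZr. Qed.
Lemma rmulE f g : rmul f g = g * f.
Proof. by apply: linfunE => a u v; rewrite mulrDl endZl. Qed.
Lemma bracket_byE f g : bracket_by f g = f * g - g * f.
Proof. by rewrite add_lfunE opp_lfunE lmulE rmulE. Qed.

Lemma bracket_byD f g : bracket_by (f + g) = bracket_by f + bracket_by g.
Proof.
apply/lfunP => h; rewrite add_lfunE !bracket_byE mulrDl mulrDr.
by rewrite opprD addrACA.
Qed.

Lemma lmul_rmul_comm f g : lmul f * rmul g = rmul g * lmul f.
Proof. by apply/lfunP => h; rewrite !endM !(lmulE, rmulE) mulrA. Qed.

Lemma peval_lmul f p : peval (lmul f) p = lmul (peval f p).
Proof.
elim/poly_ind: p => [|p c IH]; apply/lfunP => g.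
  by rewrite !peval0 lmulE mul0r zero_lfunE.
by rewrite !pevalD !pevalMX !pevalC add_lfunE endM IH scale_lfunE end1 !lmulE
  mulrDl endZl mul1r mulrA.
Qed.

Lemma peval_rmul f p : peval (rmul f) p = rmul (peval f p).
Proof.
elim/poly_ind: p => [|p c IH]; apply/lfunP => g.
  by rewrite !peval0 rmulE mulr0 zero_lfunE.
rewrite !pevalD !pevalMX !pevalC add_lfunE endM IH scale_lfunE end1 !rmulE.
by rewrite mulrDr endZr mulr1 -mulrA -[f * _](comm_peval p (erefl (f * f))).
Qed.

Lemma peval_intertwine (W : vectType K) f (g : 'End(W)) (h : 'Hom(V, W)) p :
  (forall v, h (f v) = g (h v)) -> forall v, h (peval f p v) = peval g p (h v).
Proof.
move=> hfg; elim/poly_ind: p => [|p c IH] v.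
  by rewrite !peval0 !zero_lfunE linear0.
by rewrite !pevalD !pevalMX !pevalC !add_lfunE !endM !scale_lfunE !end1 linearD
  linearZ /= IH hfg.
Qed.

End Commutator.

(** * Separable polynomials and semisimple endomorphisms *)

Section Separable.
Variables (K : fieldType) (charK : [pchar K] =i pred0).
Implicit Types (p q r : {poly K}).

(** Characteristic 0 keeps the derivative of a nonconstant factor nonzero, so only a repeated factor
    can spoil separability. *)
Lemma nonsep_square p : p != 0 -> ~~ separable_poly p ->
  exists u q : {poly K}, (1 < size u)%N /\ p = u * u * q.
Proof.
move=> p0 nsp; have [//|no] := classic (exists u q : {poly K}, (1 < size u)%N /\ p = u * u * q).
case/negP: nsp; apply/separable_polyP; split=> [|u up u1].
  apply/poly_square_freeP => u u1; apply/negP => /dvdpP[q E]; case: no.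
  exists u, q; split; last by rewrite E mulrC expr2.
  rewrite ltnNge leq_eqVlt (negPf u1) /= ltnS leqn0 size_poly_eq0.
  by apply: contra_neqN p0 => /eqP u0; rewrite E u0 expr0n mulr0.
apply/eqP => u'0; have := congr1 (fun r : {poly K} => r`_(size u).-2) u'0.
rewrite coef_deriv coef0 prednK; last by rewrite -subn1 subn_gt0.
rewrite -/(lead_coef u) => /eqP; rewrite -mulr_natr mulf_eq0 lead_coef_eq0.
have u0 : u != 0 by rewrite -size_poly_gt0 (ltn_trans _ u1).
rewrite (negPf u0) /=; move/(pcharf0P K): (charK) => ->.
by case: (size u) u1 => [|[|k]].
Qed.

Variable (V : vectType K).
Implicit Types (f g t : 'End(V)).

(** Reducedness of K[f] suffices: were the minimal polynomial of the form [u * u * q] with [u]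
    nonconstant, [(u * q)(f)] would square to zero, hence vanish, against minimality. *)
Lemma ssepP f :
  (forall p, peval f p * peval f p = 0 -> peval f p = 0) -> ssep f.
Proof.
move=> red.
have [m [m0 mf] mmin] : exists2 m : {poly K}, m != 0 /\ peval f m = 0 &
    forall r, r != 0 -> peval f r = 0 -> (size m <= size r)%N.
  have [p p0 pf] := peval_annih f.
  elim: {p}(size p) {-2}p (leqnn (size p)) p0 pf => [|n IH] p le p0 pf.
    by move: le; rewrite leqn0 size_poly_eq0 (negPf p0).
  have [[q [q0 qf lt]]|no] := classic (exists q, [/\ q != 0, peval f q = 0 &
      (size q < size p)%N]).
    by apply: (IH q) => //; rewrite -ltnS (leq_trans lt).
  exists p => // r r0 rf; rewrite leqNgt; apply/negP => lt.
  by apply: no; exists r.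
exists m => //; apply/negPn/negP => nsm.
have [u [q [u1 E]]] := nonsep_square m0 nsm.
have uq0 : u * q != 0.
  by apply: contra_neq m0 => uq; rewrite E -mulrA uq mulr0.
have uqf : peval f (u * q) = 0.
  by apply: red; rewrite -pevalM; apply: peval_dvd mf; rewrite mulrACA mulrA -E
    dvdp_mulIl.
have := mmin _ uq0 uqf; rewrite E -mulrA size_mul //; last first.
  by apply: contra_neq uq0 => ->; rewrite mul0r.
have u0 : (0 < size (u * q)%R)%N by rewrite size_poly_gt0.
by case: (size u) u1 => [|[|k]] //= _; rewrite !addSn /= leqNgt ltnS leq_addl.
Qed.

(** If [N = p(f)] has square zero, an [f]-stable complement [W] of its kernel is sent by [N] into
    the intersection of [W] with that kernel, which is zero. *)
Lemma semisimple_ssep f : is_semisimple f -> ssep f.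
Proof.
move=> sf; apply: ssepP => p; set N := peval f p => NN.
have Nf : N * f = f * N by exact: comm_peval.
have st (U : {vspace V}) : (forall u, u \in U -> f u \in U) -> stable <[f]>%VS U.
  move=> fU _ /vlineP[a ->]; apply/subvP => _ /memv_imgP[u uU ->].
  by rewrite scale_lfunE memvZ ?fU.
have [|W stW [sumW /directv_addP capW]] := sf (lker N).
  apply: st => u; rewrite !memv_ker => /eqP Nu.
  by rewrite -endM Nf endM Nu linear0.
have NW w : w \in W -> N w \in W.
  apply: peval_stable => u uW; apply: (subvP (stW f (memv_line _))).
  exact: memv_img.
apply/lfunP => v; rewrite zero_lfunE.
have : v \in (lker N + W)%VS by rewrite sumW memvf.
case/memv_addP => u uN [w wW ->]; move: uN; rewrite memv_ker => /eqP uN.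
rewrite linearD /= uN add0r; apply/eqP; rewrite -memv0 -capW memv_cap NW //.
by rewrite memv_ker -endM NN zero_lfunE eqxx.
Qed.

(** Here [g] is a generalised inverse of [N]. Its Fitting component [g0] for [[f, .]] commutes with
    [f], and the error [N - N g0 N] is both a value of [[f, .]] and killed by it, hence zero.
    Keeping [g0] in [X] allows a second use for another map. *)
Lemma ssep_average f (X : {vspace 'End(V)}) N : ssep f ->
    (forall g, g \in X -> f * g - g * f \in X) -> f * N = N * f ->
  forall g, g \in X -> N * g * N = N ->
    exists g', [/\ g' \in X, f * g' = g' * f & N * g' * N = N].
Proof.
move=> sf fX fN g gX NgN.
have D2 h : bracket_by f (bracket_by f h) = 0 -> bracket_by f h = 0.
  rewrite !bracket_byE => /subr0_eq/(ssep_comm sf) ->; exact: subrr.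
have DX h : h \in X -> bracket_by f h \in X by rewrite bracket_byE; exact: fX.
have [g0 [g1 [g0X _ Dg0 E]]] := fitting D2 DX gX.
have fg0 : f * g0 = g0 * f by apply/subr0_eq; rewrite -bracket_byE.
have DN h : bracket_by f (N * h * N) = N * bracket_by f h * N.
  by rewrite !bracket_byE mulrBr mulrBl !mulrA fN -!mulrA fN.
exists g0; split=> //; apply/esym/subr0_eq.
have E1 : N - N * g0 * N = bracket_by f (N * g1 * N).
  by rewrite -{1}NgN E mulrDr mulrDl addrC addKr DN.
rewrite E1; apply: D2; rewrite -E1 linearB /= DN Dg0 mulr0 mul0r subr0.
by rewrite bracket_byE fN subrr.
Qed.

(** A square-zero [N] in K[f + g] has a generalised inverse commuting with [f], and then, within the
    commutant of [f], one commuting with [g] as well. The latter commutes with [N], so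
    [N = N g1 N = g1 N N = 0]. *)
Lemma ssep_add f g : f * g = g * f -> ssep f -> ssep g -> ssep (f + g).
Proof.
move=> fg sf sg; apply: ssepP => p; set N := peval (f + g) p => NN.
have fN : f * N = N * f.
  by apply/esym/comm_peval; rewrite mulrDl mulrDr fg.
have gN : g * N = N * g.
  by apply/esym/comm_peval; rewrite mulrDl mulrDr fg.
have NVN : N * (N^-1)%VF * N = N by exact: inv_lfun_def.
have [|g0 [_ fg0 Ng0]] :=
  ssep_average (X := fullv) sf _ fN (memvf _) NVN; first by move=> *; exact: memvf.
have g0X : g0 \in lker (bracket_by f) by rewrite memv_ker bracket_byE fg0 subrr.
have [|g1 [g1X gg1 Ng1]] := ssep_average (N := N) sg _ gN g0X Ng0.
  move=> h; rewrite !memv_ker !bracket_byE => /eqP/subr0_eq fh.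
  rewrite mulrBl mulrBr subr_eq0; apply/eqP; congr (_ - _).
    by rewrite mulrA fg -mulrA fh mulrA.
  by rewrite mulrA fh -mulrA fg mulrA.
have fg1 : f * g1 = g1 * f.
  by apply/subr0_eq; rewrite -bracket_byE; apply/eqP; rewrite -memv_ker.
have Ng : N * g1 = g1 * N by apply: comm_peval; rewrite mulrDl mulrDr fg1 gg1.
by rewrite -Ng1 Ng -mulrA NN mulr0.
Qed.

Lemma ssep_opp f : ssep f -> ssep (- f).
Proof.
move=> sf; apply: ssepP => p.
set N := peval _ p => NN.
have fN : f * N = N * f.
  by apply/esym/comm_peval; rewrite mulrN mulNr.
have NVN : N * (N^-1)%VF * N = N by exact: inv_lfun_def.
have [|g [_ fg Ng]] :=
  ssep_average (X := fullv) sf _ fN (memvf _) NVN; first by move=> *; exact: memvf.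
have Nf : N * g = g * N by apply: comm_peval; rewrite mulrN mulNr fg.
by rewrite -Ng Nf -mulrA NN mulr0.
Qed.

End Separable.

Section Jordan.
Variables (K : fieldType) (charK : [pchar K] =i pred0).
Implicit Types (p q r S : {poly K}).

Lemma ssep_bracket_by (V : vectType K) (f : 'End(V)) :
  ssep f -> ssep (bracket_by f).
Proof.
case=> p sp pf; apply: (ssep_add charK).
- by rewrite mulrN mulNr lmul_rmul_comm.
- by exists p => //; rewrite peval_lmul pf; apply/lfunP => g;
    rewrite lmulE mul0r zero_lfunE.
- apply: (ssep_opp charK); exists p => //; rewrite peval_rmul pf.
  by apply/lfunP => g; rewrite rmulE mulr0 zero_lfunE.
Qed.

Lemma bracket_by_comm (V : vectType K) (f g : 'End(V)) : f * g = g * f ->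
  bracket_by f * bracket_by g = bracket_by g * bracket_by f.
Proof.
move=> fg; have ll : GRing.comm (lmul f) (lmul g).
  by apply/lfunP => h; rewrite !endM !lmulE !mulrA fg.
have rr : GRing.comm (rmul f) (rmul g).
  by apply/lfunP => h; rewrite !endM !rmulE -!mulrA fg.
by apply: commrB; apply: commr_sym; apply: commrB; apply: commr_sym => //;
  rewrite /GRing.comm lmul_rmul_comm.
Qed.

Lemma comp_polyB_taylor p S h :
  exists r, p \Po (S - h) = p \Po S - h * (p^`() \Po S) + h * h * r.
Proof.
elim/poly_ind: p => [|p c [r IH]].
  by exists 0; rewrite deriv0 !comp_poly0 mulr0 mulr0 subrr addr0.
exists (r * (S - h) + (p^`() \Po S)).
rewrite derivMXaddC !comp_polyD !comp_polyM !comp_polyC !comp_polyX IH.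
by move: (p \Po S) (p^`() \Po S) => a b; ring.
Qed.

(* Newton iteration for the equation p(S) = 0 modulo powers of p. *)
Lemma newton_poly p n : separable_poly p ->
  exists S, p %| S - 'X /\ p ^+ n.+1 %| p \Po S.
Proof.
move=> sp; elim: n => [|n [S [pS pnS]]].
  by exists 'X; rewrite subrr dvdp0 comp_polyXr expr1.
have cp : coprimep p p^`() by move: sp; rewrite unlock.
have [e [c ec]] := coprimep_bezout cp.
(* This is Newton's correction p(S)/p'(S): by the Bezout identity, [c] inverts the derivative of [p]
   modulo [p]. *)
pose h := (p \Po S) * (c \Po S); exists (S - h); split.
  rewrite addrAC dvdp_addr // dvdpNr dvdp_mulr //.
  by apply: dvdp_trans pnS; rewrite exprS dvdp_mulr.
have [r ->] := comp_polyB_taylor p S h.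
have : (e \Po S) * (p \Po S) + (c \Po S) * (p^`() \Po S) = 1.
  by rewrite -!comp_polyM -comp_polyD ec -[1]/(1%:P) comp_polyC.
rewrite /h; move: pnS; set a := p \Po S; set b := p^`() \Po S.
set e' := e \Po S; set c' := c \Po S => pa E.
have -> : a - a * c' * b + a * c' * (a * c') * r = a * a * (e' + c' * c' * r).
  have -> : a - a * c' * b = a * (e' * a) by rewrite -[X in X - _]mulr1 -E; ring.
  by ring.
apply: dvdp_mulr; apply: dvdp_trans (dvdp_mul pa pa).
by rewrite -exprD dvdp_exp2l // addSn addnS !ltnS leq_addr.
Qed.

Variable (V : vectType K).
Implicit Types (f g t n : 'End(V)).

Lemma nilp_comm_add (R : pzRingType) (f g : R) (a b : nat) : f * g = g * f -> f ^+ a = 0 -> g ^+ b = 0 ->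
  (f + g) ^+ (a + b) = 0.
Proof.
move=> fg fa gb; rewrite exprDn_comm //; apply: big1 => i _.
have [le|lt] := leqP b i.
  by rewrite -(subnK le) [g ^+ _]exprD gb !mulr0 mul0rn.
have /subnK <- : (a <= a + b - i)%N by rewrite -addnBA ?leq_addr // ltnW.
by rewrite exprD fa mulr0 mul0r mul0rn.
Qed.

Lemma lmulX f (m : nat) : lmul f ^+ m = lmul (f ^+ m).
Proof. by have := peval_lmul f ('X^m); rewrite !pevalXn !pevalX. Qed.

Lemma rmulX f (m : nat) : rmul f ^+ m = rmul (f ^+ m).
Proof. by have := peval_rmul f ('X^m); rewrite !pevalXn !pevalX. Qed.

Lemma bracket_by_nilp f (m : nat) : f ^+ m = 0 -> bracket_by f ^+ (m + m) = 0.
Proof.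
move=> fm; have l0 : lmul f ^+ m = 0.
  by rewrite lmulX fm; apply/lfunP => g; rewrite lmulE mul0r zero_lfunE.
have r0 : (- rmul f) ^+ m = 0.
  rewrite exprNn rmulX fm -[RHS](mulr0 ((-1) ^+ m)); congr (_ * _).
  by apply/lfunP => g; rewrite rmulE mulr0 zero_lfunE.
by apply: nilp_comm_add => //; rewrite mulrN mulNr lmul_rmul_comm.
Qed.

Lemma ssep_nilp0 f (n : nat) : ssep f -> f ^+ n = 0 -> f = 0.
Proof.
move=> sf fn; apply/lfunP => v; rewrite zero_lfunE.
by apply: (@ssep_nilp _ _ f v n) => //; rewrite -endX fn zero_lfunE.
Qed.

Lemma peval_add_mul t n p : t * n = n * t ->
  exists w, w * n = n * w /\ peval (t + n) p = peval t p + n * w.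
Proof.
move=> tn; elim/poly_ind: p => [|p c [w [wn IH]]].
  by exists 0; rewrite mul0r mulr0 !peval0 addr0.
exists (w * (t + n) + peval t p); split.
  by rewrite mulrDl mulrDr mulrDr mulrDl (comm_peval _ tn) mulrDr !mulrA -wn
    -!mulrA tn.
have pn := comm_peval p tn.
rewrite !pevalD !pevalMX !pevalC IH mulrDl [peval t p * (t + n)]mulrDr pn.
rewrite [n * (_ + _)]mulrDr mulrA.
by rewrite [LHS](ACl (1 * 4 * (3 * 2))).
Qed.

(* The semisimple part t of f = t + n is a polynomial in f: S(f) is a root of
   p for a suitable S, and differs from t by a nilpotent semisimple map. *)
Lemma jordan_polyE f t n (m : nat) p S : f = t + n -> t * n = n * t ->
    n ^+ m = 0 -> separable_poly p -> peval t p = 0 ->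
    p %| S - 'X -> p ^+ m.+1 %| p \Po S ->
  t = peval f S.
Proof.
move=> E tn nm sp pt pS pmS.
have tf : t * f = f * t by rewrite E mulrDl mulrDr tn.
have [w [wn pf]] := peval_add_mul p tn.
have pfm : peval f (p ^+ m.+1) = 0.
  rewrite pevalXn E pf pt add0r exprMn_comm; last by rewrite /GRing.comm wn.
  by rewrite exprSr nm !mul0r.
apply/subr0_eq.
have ps : peval (peval f S) p = 0.
  by rewrite -peval_comp; apply: peval_dvd pmS pfm.
have tS : t * peval f S = peval f S * t by rewrite (comm_peval _ (esym tf)).
have sts : ssep (t - peval f S).
  apply: (ssep_add charK); first by rewrite mulrN mulNr tS.
    by exists p.
  by apply: (ssep_opp charK); exists p.
have /dvdpP[r Er] := pS.
have Sm : (peval f (S - 'X)) ^+ m.+1 = 0.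
  rewrite -pevalXn Er exprMn; apply: peval_dvd pfm.
  exact: dvdp_mulIr.
have n1 : (- n) ^+ m = 0 by rewrite exprNn nm mulr0.
have n2 : (peval f 'X - peval f S) ^+ m.+1 = 0.
  by rewrite -opprB -pevalB exprNn Sm mulr0.
have c : (- n) * (peval f 'X - peval f S) = (peval f 'X - peval f S) * (- n).
  rewrite -pevalB; apply/esym/comm_peval; rewrite mulrN mulNr.
  by rewrite E mulrDl mulrDr tn.
have := nilp_comm_add c n1 n2.
have -> : - n + (peval f 'X - peval f S) = t - peval f S.
  by rewrite pevalX addrA E [t + n]addrC addKr.
exact: ssep_nilp0.
Qed.

(** Replacing [u * u * q] by [u * q] lowers the degree and keeps the irreducible factors; this stops
    at a separable polynomial. *)
Lemma separable_radical p : p != 0 ->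
  exists q, exists2 n : nat, separable_poly q & p %| q ^+ n.
Proof.
move: {2}(size p) (leqnn (size p)) => l; elim: l p => [|l IH] p le p0.
  by move: le; rewrite leqn0 size_poly_eq0 (negPf p0).
have [sp|nsp] := boolP (separable_poly p); first by exists p, 1%N.
have [u [q [u1 E]]] := nonsep_square charK p0 nsp.
have uq0 : u * q != 0 by apply: contra_neq p0 => uq; rewrite E -mulrA uq mulr0.
have [|q' [n sq' dq']] := IH (u * q) _ uq0.
  rewrite -ltnS; apply: leq_trans le; rewrite E -mulrA [in X in (_ < X)%N]size_mul //.
    have : (0 < size (u * q)%R)%N by rewrite size_poly_gt0.
    by case: (size u) u1 => [|[|c]] //= _ _; rewrite !addSn /= ltnS leq_addl.
  by apply: contra_neq uq0 => ->; rewrite mul0r.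
exists q', (n + n)%N => //; rewrite exprD; apply: dvdp_trans (dvdp_mul dq' dq').
by rewrite E mulrACA mulrA dvdp_mulIl.
Qed.

Lemma separable_lcm p q : separable_poly p -> separable_poly q ->
  exists r, [/\ separable_poly r, p %| r & q %| r].
Proof.
move=> sp sq; pose g := gcdp p q; pose u := q %/ g.
have Eq : q = u * g by rewrite divpK // dvdp_gcdr.
exists (p * u); split; first 1 last.
- exact: dvdp_mulIl.
- by rewrite Eq mulrC dvdp_mul // dvdp_gcdl.
rewrite separable_mul sp (dvdp_separable _ sq) /=; last by rewrite Eq dvdp_mulIl.
have ug : coprimep u g by apply: separable_coprime sq _; rewrite -Eq.
apply/coprimepP => d dp du; move/coprimepP: ug; apply=> //.
by rewrite dvdp_gcd dp (dvdp_trans du) // Eq dvdp_mulIl.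
Qed.

(** A stable complement comes from a projection commuting with [t]. In the space [X] of maps into
    [U] that are scalar on [U], the Fitting decomposition for [[t, .]] changes [projv U] by a
    bracket that vanishes on [U]; the commuting part is thus still the identity on [U], and its
    kernel is the complement. *)
Lemma ssep_semisimple t : ssep t -> is_semisimple t.
Proof.
move=> st U /(_ t (memv_line t))/subvP tU0.
have tU u : u \in U -> t u \in U by move=> uU; rewrite tU0 ?memv_img.
pose X := vspace_of (fun g : 'End(V) => (forall v, g v \in U) /\
  exists c : K, forall u, u \in U -> g u = c *: u).
have XP g : g \in X <-> (forall v, g v \in U) /\
    exists c : K, forall u, u \in U -> g u = c *: u.
  apply: (mem_vspace_of (P := fun g : 'End(V) => _ /\ _)); split.
    split=> [v|]; first by rewrite zero_lfunE mem0v.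
    by exists 0 => u _; rewrite zero_lfunE scale0r.
  move=> a h l [fU [c fc]] [gU [c' gc]]; split=> [v|].
    by rewrite add_lfunE scale_lfunE memvD ?memvZ.
  exists (a * c + c') => u uU.
  by rewrite add_lfunE scale_lfunE fc // gc // scalerA scalerDl.
have D2 g : bracket_by t (bracket_by t g) = 0 -> bracket_by t g = 0.
  by move=> h; exact: ssep_ker2 (ssep_bracket_by st) h.
have DXU g : g \in X -> (forall v, bracket_by t g v \in U) /\
    (forall u, u \in U -> bracket_by t g u = 0).
  move=> /XP[gU [c gc]]; split=> [v|u uU];
    rewrite bracket_byE add_lfunE opp_lfunE !endM.
    by rewrite memvB ?tU.
  by rewrite (gc (t u)) ?tU // gc // linearZ subrr.
have DX g : g \in X -> bracket_by t g \in X.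
  move=> /DXU[gU g0]; apply/XP; split=> //.
  by exists 0 => u uU; rewrite g0 // scale0r.
have PX : projv U \in X.
  apply/XP; split=> [v|]; first exact: memv_proj.
  by exists 1 => u uU; rewrite projv_id // scale1r.
have [p [h [pX hX Dp E]]] := fitting D2 DX PX.
have [/XP[pU _] [_ h0]] := (pX, DXU _ hX).
have pid u : u \in U -> p u = u.
  by move=> uU; rewrite -{2}(projv_id uU) E add_lfunE h0 // addr0.
have tp v : t (p v) = p (t v).
  by move: Dp; rewrite bracket_byE => /subr0_eq tp; rewrite -!endM tp.
exists (lker p); first last.
  split; last first.
    apply/directv_addP/eqP; rewrite -subv0; apply/subvP => v /memv_capP[vU].
    by rewrite memv_ker memv0 pid.
  apply/vspaceP => v; rewrite memvf -[v](subrK (p v)) addrC memv_add ?pU //.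
  by rewrite memv_ker linearB /= (pid _ (pU v)) subrr.
move=> _ /vlineP[c ->]; apply/subvP => _ /memv_imgP[v + ->].
by rewrite !memv_ker scale_lfunE linearZ /= -tp => /eqP ->; rewrite linear0 scaler0.
Qed.

Lemma jordan_exists f : exists t, jordan_semisimple_part f t.
Proof.
have [c c0 cf] := peval_annih f.
have [p [N sp cp]] := separable_radical c0.
have [S [pS pNS]] := newton_poly N sp.
have pN : peval f (p ^+ N.+1) = 0.
  by apply: peval_dvd cf; rewrite exprS dvdp_mull.
exists (peval f S), (f - peval f S); split.
- by rewrite addrC subrK.
- have cS := comm_peval S (erefl (f * f)).
  suff : peval f S * (f - peval f S) = (f - peval f S) * peval f S by [].
  by rewrite mulrBr mulrBl cS.
- apply: ssep_semisimple; exists p => //.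
  by rewrite -peval_comp; apply: peval_dvd pNS pN.
exists N.+1 => v; rewrite -endX.
have /dvdpP[r Er] := pS.
have -> : (f - peval f S) ^+ N.+1 = 0; last exact: zero_lfunE.
rewrite -{1}(pevalX f) -pevalB -pevalXn -opprB Er -mulNr exprMn.
by apply: peval_dvd pN; rewrite dvdp_mull.
Qed.

End Jordan.

(** * Traces *)

Import Num.Theory passmx.

Section MatrixTrace.
Variable K : fieldType.

Lemma mxtrace_idempotent n (A : 'M[K]_n) : A *m A = A -> \tr A = (\rank A)%:R.
Proof.
move=> AA; have BA : row_base A *m col_base A = 1%:M.
  apply: (row_full_inj (col_base_full A)); apply: (row_free_inj (row_base_free A)).
  by rewrite mulmx1 mulmx_base mulmxA mulmx_base -mulmxA mulmx_base.
by rewrite -{1}(mulmx_base A) mxtrace_mulC BA mxtrace1.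
Qed.

Lemma iter_mulmxC n r (B : 'M[K]_(r, n)) (C : 'M[K]_(n, r)) k :
  iter k.+1 (mulmx (B *m C)) 1%:M = B *m iter k (mulmx (C *m B)) 1%:M *m C.
Proof.
elim: k => [|k E]; first by rewrite /= !mulmx1.
by rewrite iterS E iterS !mulmxA.
Qed.

(** A rank factorisation [A = C B] replaces the trace of [A] by that of the smaller matrix [B C],
    which is again nilpotent. *)
Lemma mxtrace_nilpotent n (A : 'M[K]_n) k :
  iter k (mulmx A) 1%:M = 0 -> \tr A = 0.
Proof.
elim/ltn_ind: n A k => n IH A k Ak.
have [lt|ge] := ltnP (\rank A) n; last first.
  have uA : A \in unitmx by rewrite -row_free_unit -row_leq_rank.
  have inj m (B : 'M_n) : iter m (mulmx A) B = 0 -> B = 0.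
    elim: m => [|m E] //= /(congr1 (mulmx (invmx A))).
    by rewrite mulKmx // mulmx0.
  by have := congr1 (mulmx A) (inj _ _ Ak); rewrite mulmx1 mulmx0 => ->;
    rewrite mxtrace0.
rewrite -(mulmx_base A) mxtrace_mulC; apply: (IH _ lt _ k.+1).
by rewrite iter_mulmxC mulmx_base Ak mulmx0 mul0mx.
Qed.

End MatrixTrace.

Section Trace.
Variables (K : fieldType) (V : vectType K).
Implicit Types (f g : 'End(V)).

Definition endmx f := mxof (vbasis {:V}) (vbasis {:V}) f.

Lemma endmxM f g : endmx (f * g) = endmx g *m endmx f.
Proof. by apply: mxof_comp; exact: vbasisP. Qed.
Lemma endmx1 : endmx 1 = 1%:M.
Proof. exact/mxof1/basis_free/vbasisP. Qed.
Lemma endmxD f g : endmx (f + g) = endmx f + endmx g.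
Proof. by have := mxof_linear (vbasis {:V}) (vbasis {:V}) 1 f g; rewrite !scale1r. Qed.
Lemma endmx0 : endmx 0 = 0.
Proof. by apply: (addrI (endmx 0)); rewrite -endmxD !addr0. Qed.
Lemma endmxZ a f : endmx (a *: f) = a *: endmx f.
Proof.
by have := mxof_linear (vbasis {:V}) (vbasis {:V}) a f 0; rewrite addr0 -/(endmx 0)
  endmx0 addr0.
Qed.
Lemma endmx_inj : injective endmx.
Proof. exact: (can_inj (mxofK (vbasisP _) (vbasisP _))). Qed.

Definition etrace f := \tr (endmx f).

Lemma etraceD f g : etrace (f + g) = etrace f + etrace g.
Proof. by rewrite /etrace endmxD mxtraceD. Qed.
Lemma etraceZ a f : etrace (a *: f) = a * etrace f.
Proof. by rewrite /etrace endmxZ mxtraceZ. Qed.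
Lemma etrace0 : etrace 0 = 0.
Proof. by rewrite /etrace endmx0 mxtrace0. Qed.
Lemma etraceN f : etrace (- f) = - etrace f.
Proof. by rewrite -scaleN1r etraceZ mulN1r. Qed.
Lemma etraceB f g : etrace (f - g) = etrace f - etrace g.
Proof. by rewrite etraceD etraceN. Qed.
Lemma etrace_sum (I : Type) (r : seq I) (P : pred I) (F : I -> 'End(V)) :
  etrace (\sum_(i <- r | P i) F i) = \sum_(i <- r | P i) etrace (F i).
Proof. exact: (big_morph etrace etraceD etrace0). Qed.
Lemma etraceC f g : etrace (f * g) = etrace (g * f).
Proof. by rewrite /etrace !endmxM mxtrace_mulC. Qed.

Lemma etrace_bracket f g h :
  etrace ((f * g - g * f) * h) = etrace (f * (g * h - h * g)).
Proof.
rewrite mulrBl mulrBr !etraceB; congr (_ - _); first by rewrite mulrA.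
by rewrite -mulrA etraceC mulrA.
Qed.

Lemma etrace_idempotent f : f * f = f ->
  exists r : nat, etrace f = r%:R /\ (r = 0%N -> f = 0).
Proof.
move=> ff; exists (\rank (endmx f)); split.
  by apply: mxtrace_idempotent; rewrite -endmxM ff.
by move=> /eqP; rewrite mxrank_eq0 => /eqP f0; apply: endmx_inj; rewrite f0 endmx0.
Qed.

Lemma etrace_nilpotent f k : f ^+ k = 0 -> etrace f = 0.
Proof.
move=> fk; apply: (@mxtrace_nilpotent _ _ _ k).
rewrite -endmx0 -fk; elim: k {fk} => [|k IH] /=; first by rewrite expr0 endmx1.
by rewrite exprSr endmxM -IH.
Qed.

End Trace.

(** * Rational functionals on a finite set of eigenvalues *)

Section RationalWeights.
Variables (F : fieldType) (charF : [pchar F] =i pred0).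

Lemma int_eq0_char0 (z : int) : (z%:~R == 0 :> F) = (z == 0).
Proof.
move/(pcharf0P F): (charF) => char0.
by case: z => m; rewrite ?NegzE ?mulrNz ?oppr_eq0 -pmulrn char0.
Qed.

(** In characteristic 0 any fraction equal to [x] computes [ratr x]; additivity and multiplicativity
    follow. *)
Lemma ratr_frac (x : rat) (a b : int) : b != 0 -> x * b%:~R = a%:~R ->
  ratr x = a%:~R / b%:~R :> F.
Proof.
move=> b0 E; have d0 := denq_neq0 x.
have : numq x * b = a * denq x.
  apply: (@intr_inj rat); rewrite !rmorphM /= -E -{1}[x in RHS]divq_num_den.
  by rewrite mulrAC divfK // intr_eq0.
move/(congr1 (fun z : int => z%:~R : F)); rewrite !rmorphM /= => E'.
apply/eqP; rewrite /ratr eqr_div ?int_eq0_char0 //; exact/eqP.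
Qed.

Lemma ratrDF x y : ratr (x + y) = ratr x + ratr y :> F.
Proof.
have d0 := denq_neq0 x; have e0 := denq_neq0 y.
rewrite (@ratr_frac _ (numq x * denq y + numq y * denq x) (denq x * denq y)).
- rewrite rmorphD !rmorphM /= /ratr addf_div ?int_eq0_char0 //.
- by rewrite mulf_neq0.
- rewrite rmorphD !rmorphM /= !numqE; ring.
Qed.

Lemma ratrMF x y : ratr (x * y) = ratr x * ratr y :> F.
Proof.
have d0 := denq_neq0 x; have e0 := denq_neq0 y.
rewrite (@ratr_frac _ (numq x * numq y) (denq x * denq y)).
- by rewrite !rmorphM /= /ratr mulf_div.
- by rewrite mulf_neq0.
- by rewrite !rmorphM /= !numqE; ring.
Qed.

Lemma ratr_natF n : ratr n%:R = n%:R :> F.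
Proof. exact: ratr_nat. Qed.
Lemma ratr0F : ratr 0 = 0 :> F.
Proof. exact: (ratr_nat F 0). Qed.
Lemma ratrNF x : ratr (- x) = - ratr x :> F.
Proof. by apply: (addrI (ratr x)); rewrite -ratrDF !subrr ratr0F. Qed.

(** Vectors [w] orthogonal to the space [R] of rational relations among the elements [x_i] of [L]
    are the rational functionals [q] on their span. The hypothesis for [q] says that the vector of
    the [w_i r_i] is itself a relation, so pairing it with [w] gives [\sum_i r_i w_i^2 = 0]. Since
    the [r_i] are natural numbers, [w_i = 0] whenever [r_i != 0]; by biorthogonality the i-th unit
    vector is then a relation, which means [x_i = 0]. *)
Lemma rational_weights (L : seq F) (r : F -> nat) : uniq L ->
    (forall q : F -> rat,
      (forall a b c d, a \in L -> b \in L -> c \in L -> d \in L ->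
         a - b = c - d -> q a - q b = q c - q d) ->
      \sum_(l <- L) ratr (q l) * l * (r l)%:R = 0) ->
  forall l, l \in L -> r l != 0%N -> l = 0.
Proof.
move=> uL H; pose d := size L; pose x (i : 'I_d) := L`_i.
pose phi (c : 'rV[rat]_d) := \sum_i ratr (c 0 i) * x i.
have phiD u v : phi (u + v) = phi u + phi v.
  rewrite -big_split; apply: eq_bigr => i _.
  by rewrite mxE ratrDF mulrDl.
have phiZ a u : phi (a *: u) = ratr a * phi u.
  rewrite mulr_sumr; apply: eq_bigr => i _.
  by rewrite mxE ratrMF mulrA.
have phiB u v : phi (u - v) = phi u - phi v.
  by rewrite phiD -scaleN1r phiZ ratrNF (ratr_natF 1) mulN1r.
have phi_delta i : phi (delta_mx 0 i) = x i.
  rewrite /phi (bigD1 i) //= big1 ?addr0 => [|k kc].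
    by rewrite mxE !eqxx (ratr_natF 1) mul1r.
  by rewrite mxE (negPf kc) andbF ratr0F mul0r.
pose R := vspace_of (fun c => phi c = 0).
have memR c : c \in R <-> phi c = 0.
  apply: (mem_vspace_of (P := fun c => phi c = 0)); split.
    by rewrite -(scale0r 0) phiZ ratr0F mul0r.
  by move=> a u v ru rv; rewrite phiD phiZ ru rv mulr0 addr0.
pose M : 'M[rat]_(\dim R, d) := \matrix_i (vbasis R)`_i.
have MR c : (c <= M)%MS -> phi c = 0.
  move=> cM; apply/memR; case/submxP: cM => D ->; rewrite mulmx_sum_row.
  apply: memv_suml => i _.
  by rewrite memvZ // rowK; apply/vbasis_mem/mem_nth; rewrite size_tuple.
have RM c : phi c = 0 -> (c <= M)%MS.
  move/memR => cR; rewrite (coord_vbasis cR); apply: summx_sub => i _.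
  by rewrite scalemx_sub // -(rowK (fun i => (vbasis R)`_i)) row_sub.
have orth (w : 'cV[rat]_d) : M *m w = 0 -> forall i, r (x i) != 0%N -> w i 0 = 0.
  move=> Mw; pose q l := if insub (index l L) is Some i then w i 0 else 0.
  have qx i : q (x i) = w i 0.
    by rewrite /q index_uniq ?ltn_ord // valK.
  have Lx l : l \in L -> exists i, l = x i.
    move=> lL; have li : (index l L < d)%N by rewrite index_mem.
    by exists (Ordinal li); rewrite /x nth_index.
  have Rw c : phi c = 0 -> c *m w = 0.
    by move/RM/submxP => [D ->]; rewrite -mulmxA Mw mulmx0.
  have dw i : (delta_mx 0 i : 'rV_d) *m w = (w i 0)%:M.
    by rewrite -rowE; apply/rowP => j; rewrite !ord1 !mxE.
  have : \sum_(l <- L) ratr (q l) * l * (r l)%:R = 0.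
    apply: H => a b c e /Lx[i ->] /Lx[j ->] /Lx[i' ->] /Lx[j' ->] E.
    have /Rw : phi (delta_mx 0 i - delta_mx 0 j - (delta_mx 0 i' - delta_mx 0 j')) = 0.
      by rewrite !phiB !phi_delta E subrr.
    rewrite !mulmxBl !dw !qx => /subr0_eq/rowP/(_ 0).
    by rewrite !mxE !eqxx.
  rewrite (big_nth 0) big_mkord -/d => S0.
  have /Rw : phi (\row_i (w i 0 * (r (x i))%:R)) = 0.
    rewrite -[RHS]S0; apply: eq_bigr => i _.
    by rewrite mxE ratrMF ratr_natF -/(x i) qx mulrAC.
  move/rowP/(_ 0); rewrite !mxE => /eqP; rewrite psumr_eq0 => [/allP w0 i ri|i _].
    have := w0 i; rewrite mem_index_enum mxE => /(_ isT) /=.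
    by rewrite mulrAC !mulf_eq0 pnatr_eq0 (negPf ri) orbF orbb => /eqP.
  by rewrite mxE mulrAC mulr_ge0 ?ler0n // -expr2 sqr_ge0.
move=> l lL rl; have li : (index l L < d)%N by rewrite index_mem.
have xl : x (Ordinal li) = l by rewrite /x nth_index.
(* The columns of [cokermx M] are orthogonal to all relations, and together they detect the row
   space of [M]. *)
rewrite -xl -phi_delta; apply: MR; rewrite submxE; apply/eqP/rowP => j.
rewrite -rowE [LHS]mxE [RHS]mxE; have := orth (col j (cokermx M)).
have -> : M *m col j (cokermx M) = 0 by rewrite colE mulmxA mulmx_coker mul0mx.
by move=> /(_ erefl (Ordinal li)); rewrite xl mxE; apply.
Qed.

End RationalWeights.

(** * Cartan's criterion *)

Lemma interpolation (F : fieldType) (L : seq F) (phi : F -> F) : uniq L ->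
  exists P : {poly F}, forall l, l \in L -> P.[l] = phi l.
Proof.
elim: L => [|a L IH] /=; first by exists 0.
case/andP=> aL /IH[P0 P0E].
pose q : {poly F} := \prod_(l <- L) ('X - l%:P).
have qa : q.[a] != 0 by rewrite -/(root q a) root_prod_XsubC.
exists (P0 + ((phi a - P0.[a]) / q.[a]) *: q) => l; rewrite inE !hornerE.
case/predU1P => [->|lL]; first by rewrite divfK // addrC subrK.
have /eqP -> : root q l by rewrite root_prod_XsubC.
by rewrite mulr0 addr0 P0E.
Qed.

Section Spectral.
Variables (F : fieldType) (V : vectType F).
Implicit Types (f g : 'End(V)) (P Q : {poly F}).

Lemma peval_sum f (I : Type) (r : seq I) (G : I -> {poly F}) :
  peval f (\sum_(i <- r) G i) = \sum_(i <- r) peval f (G i).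
Proof. exact: (big_morph (peval f) (pevalD f) (peval0 f)). Qed.

Lemma peval_eigen f v (c : F) P : f v = c *: v -> peval f P v = P.[c] *: v.
Proof.
move=> fv; elim/poly_ind: P => [|P a IH].
  by rewrite peval0 zero_lfunE horner0 scale0r.
by rewrite pevalD pevalMX pevalC add_lfunE endM fv linearZ /= IH scale_lfunE
  end1 scalerA -scalerDl hornerMXaddC mulrC.
Qed.

Variables (L : seq F) (f : 'End(V)).
Hypothesis uL : uniq L.
Hypothesis fL : peval f (\prod_(l <- L) ('X - l%:P)) = 0.

Lemma peval_eq_on P Q : (forall l, l \in L -> P.[l] = Q.[l]) ->
  peval f P = peval f Q.
Proof.
move=> PQ; apply/subr0_eq; rewrite -pevalB; apply: peval_dvd fL.
apply: uniq_roots_dvdp; last by rewrite uniq_rootsE.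
by apply/allP => l lL; rewrite /root !hornerE PQ // subrr.
Qed.

(** These are the Lagrange polynomials of [L] evaluated at [f]; identities between polynomials in
    [f] need only be checked at the points of [L]. *)
Lemma spectral_idempotents : exists e : F -> 'End(V),
  [/\ forall l, l \in L -> e l * e l = e l,
      forall l, l \in L -> f * e l = l *: e l,
      forall l, l \in L -> e l * f = l *: e l
    & forall P, peval f P = \sum_(l <- L) P.[l] *: e l].
Proof.
pose lag l := epsilon (inhabits (0 : {poly F}))
  (fun P => forall l', l' \in L -> P.[l'] = (l' == l)%:R).
have lagE l l' : l' \in L -> (lag l).[l'] = (l' == l)%:R.
  apply: (epsilon_spec (inhabits (0 : {poly F}))
    (fun P => forall l', l' \in L -> P.[l'] = (l' == l)%:R)).
  exact: (interpolation (fun l' => (l' == l)%:R) uL).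
have fe l : l \in L -> f * peval f (lag l) = l *: peval f (lag l).
  move=> lL; rewrite -pevalZ -{1}(pevalX f) -pevalM; apply: peval_eq_on => l' l'L.
  rewrite !hornerE lagE //; have [->//|] := eqVneq l' l.
  by rewrite !mulr0.
exists (fun l => peval f (lag l)); split=> //.
- move=> l lL; rewrite -pevalM; apply: peval_eq_on => l' l'L.
  by rewrite hornerM lagE // -natrM mulnb andbb.
- by move=> l lL; rewrite (comm_peval _ (erefl (f * f))) fe.
move=> P; under eq_bigr => l _ do rewrite -pevalZ.
rewrite -peval_sum; apply: peval_eq_on => l lL.
rewrite horner_sum (bigD1_seq l) //= big1 ?addr0.
  by rewrite hornerZ lagE // eqxx mulr1.
by move=> l' l'l; rewrite hornerZ lagE // eq_sym (negPf l'l) mulr0.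
Qed.

End Spectral.

Section CartanSplit.
Variables (F : fieldType) (charF : [pchar F] =i pred0) (V : vectType F).
Implicit Types (f g x y : 'End(V)).

(* If x is split with semisimple part \sum_l l e_l, then y = \sum_l q(l) e_l
   normalizes whatever subspace x does when q is additive on the spectrum, so
   tr(y x) = 0; letting q range over the rational functionals gives x
   nilpotent. *)
Lemma cartan_split (A : {vspace 'End(V)}) x (rs : seq F) :
    peval x (\prod_(l <- rs) ('X - l%:P)) = 0 ->
    (forall g, g \in A -> x * g - g * x \in A) ->
    (forall g h, g \in A -> h \in A -> etrace (g * h) = 0) ->
    (exists r : seq ('End(V) * 'End(V)),
       (forall c, c \in r -> c.1 \in A /\ c.2 \in A) /\
       x = \sum_(c <- r) (c.1 * c.2 - c.2 * c.1)) ->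
  exists k, x ^+ k = 0.
Proof.
move=> xrs xA trA [r [rA xr]].
pose L := undup rs; have uL : uniq L := undup_uniq rs.
pose p : {poly F} := \prod_(l <- L) ('X - l%:P).
have sp : separable_poly p by rewrite separable_prod_XsubC.
pose N := size rs.
(* No root is repeated more than [size rs] times, so this power of [p] is a multiple of the product
   over [rs]. *)
have pN : peval x (p ^+ N.+1) = 0.
  apply: peval_dvd xrs; rewrite exprS; apply: dvdp_mull.
  have: {subset rs <= L} by move=> l; rewrite mem_undup.
  rewrite {}/N; elim: (rs) => [|l s IH] sL /=; first by rewrite big_nil dvd1p.
  rewrite big_cons exprS; apply: dvdp_mul.
    by rewrite dvdp_XsubCl root_prod_XsubC sL ?mem_head.
  by apply: IH => l' l's; rewrite sL // inE l's orbT.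
have [S [pS pNS]] := newton_poly N sp.
pose xs := peval x S; pose xn := x - xs.
have xsL : peval xs p = 0 by rewrite -peval_comp; apply: peval_dvd pNS pN.
have xxs : x * xs = xs * x by apply/esym/comm_peval.
have xnN : xn ^+ N.+1 = 0.
  have /dvdpP[S' ES] := pS.
  rewrite /xn -{1}(pevalX x) -pevalB -pevalXn -opprB ES -mulNr exprMn.
  by apply: peval_dvd pN; rewrite dvdp_mull.
have [e [ee xse exs pe]] := spectral_idempotents uL xsL.
have e1 : \sum_(l <- L) e l = 1.
  by rewrite -(peval1 xs) pe; apply: eq_bigr => l _; rewrite hornerC scale1r.
have gE g : g = \sum_(l <- L) \sum_(l' <- L) e l * g * e l'.
  rewrite -{1}[g]mul1r -{1}[1 * g]mulr1 -{2}e1 mulr_sumr exchange_big.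
  by apply: eq_bigr => l _; rewrite -!mulr_suml e1.
(* The block [e l * g * e l'] is an eigenvector of [[xs, .]] for the eigenvalue [l - l']. *)
have DxsE Q g : peval (bracket_by xs) Q g =
    \sum_(l <- L) \sum_(l' <- L) Q.[l - l'] *: (e l * g * e l').
  rewrite {1}(gE g) linear_sum; apply: eq_big_seq => l lL.
  rewrite linear_sum; apply: eq_big_seq => l' l'L; apply: peval_eigen.
  by rewrite bracket_byE !mulrA xse // -!mulrA exs // endZl !endZr scalerBl.
have DxsA Q g : g \in A -> peval (bracket_by xs) Q g \in A.
  pose M := undup [seq l - l' | l <- L, l' <- L].
  pose pM : {poly F} := \prod_(l <- M) ('X - l%:P).
  have spM : separable_poly pM by rewrite separable_prod_XsubC undup_uniq.
  have [Q' [Q'1 Q'2]] := newton_poly (N.+1 + N.+1) spM.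
  (* The bracket with [xs] is the semisimple part of the bracket with [x], hence a polynomial in it,
     and so preserves [A] even when [xs] is not in [A]. The doubled exponent is the one that kills
     the bracket with [xn]. *)
  have -> : bracket_by xs = peval (bracket_by x) Q'.
    apply: (@jordan_polyE F charF _ (bracket_by x) (bracket_by xs)
      (bracket_by xn) (N.+1 + N.+1) pM) => //.
    - by rewrite -bracket_byD addrC subrK.
    - have xsn : xs * xn = xn * xs by rewrite /xn mulrBl mulrBr xxs.
      exact: bracket_by_comm.
    - exact: bracket_by_nilp.
    - apply/lfunP => h; rewrite DxsE zero_lfunE big_seq big1 // => l lL.
      rewrite big_seq big1 // => l' l'L.
      have /eqP -> : root pM (l - l').
        by rewrite root_prod_XsubC mem_undup; apply/allpairsP; exists (l, l').
      by rewrite scale0r.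
  move=> gA; rewrite -peval_comp; apply: peval_stable gA => h hA.
  by rewrite bracket_byE xA.
have [rk rkP] : exists rk : F -> nat, forall l, l \in L ->
    etrace (e l) = (rk l)%:R /\ (rk l = 0%N -> e l = 0).
  exists (fun l => epsilon (inhabits 0%N)
    (fun k => etrace (e l) = k%:R /\ (k = 0%N -> e l = 0))) => l lL.
  apply: (epsilon_spec (inhabits 0%N)
    (fun k => etrace (e l) = k%:R /\ (k = 0%N -> e l = 0))).
  by apply: etrace_idempotent; exact: ee.
have l0 : forall l, l \in L -> rk l != 0%N -> l = 0.
  apply: (rational_weights charF uL) => q qadd.
  have [Y YE] := interpolation (fun l => ratr (q l)) uL.
  pose y := peval xs Y.
  have yE : y = \sum_(l <- L) ratr (q l) *: e l.
    by rewrite /y pe; apply: eq_big_seq => l lL; rewrite YE.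
  have yA g : g \in A -> y * g - g * y \in A.
    (* [[y, .]] multiplies a block by [ratr (q l) - ratr (q l')], which depends only on [l - l'] by
       the condition on [q]. Interpolating this function makes [[y, .]] a polynomial in
       [[xs, .]]. *)
    have [phi phiP] : exists phi : F -> F, forall l l', l \in L -> l' \in L ->
        phi (l - l') = ratr (q l) - ratr (q l').
      exists (fun d => epsilon (inhabits 0) (fun c => exists l l',
        [/\ l \in L, l' \in L, d = l - l' & c = ratr (q l) - ratr (q l')])).
      move=> l l' lL l'L.
      have ex : exists c : F, exists a b, [/\ a \in L, b \in L, l - l' = a - b &
          c = ratr (q a) - ratr (q b)] by exists (ratr (q l) - ratr (q l')), l, l'.
      have [a [b [aL bL E ->]]] := epsilon_spec (inhabits 0) _ ex.
      by rewrite -!(ratrNF charF) -!(ratrDF charF) (qadd _ _ _ _ lL l'L aL bL E).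
    have [Q QE] := interpolation phi
      (undup_uniq [seq l - l' | l <- L, l' <- L]).
    move=> gA; have -> : y * g - g * y = peval (bracket_by xs) Q g; last exact: DxsA.
    rewrite DxsE; transitivity (\sum_(l <- L) \sum_(l' <- L)
        (ratr (q l) - ratr (q l')) *: (e l * g * e l')); last first.
      apply: eq_big_seq => l lL; apply: eq_big_seq => l' l'L.
      rewrite QE ?phiP // mem_undup; apply/allpairsP; by exists (l, l').
    under eq_bigr => l _ do under eq_bigr => l' _ do rewrite scalerBl.
    under eq_bigr => l _ do rewrite sumrB.
    rewrite sumrB; congr (_ - _).
      rewrite yE mulr_suml; apply: eq_bigr => l _.
      by rewrite -scaler_sumr -mulr_sumr e1 mulr1 endZl.
    rewrite exchange_big yE mulr_sumr; apply: eq_bigr => l _.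
    by rewrite -scaler_sumr -!mulr_suml e1 mul1r endZr.
  (* [x] is a sum of brackets [[a, b]], and [tr(y [a, b]) = tr([y, a] b)] vanishes because [[y, a]]
     lies in [A]. *)
  have yx : etrace (y * x) = 0.
    rewrite xr mulr_sumr etrace_sum big_seq big1 // => c /rA[c1 c2].
    by rewrite -etrace_bracket trA ?yA.
  have yxn : etrace (y * xn) = 0.
    apply: (@etrace_nilpotent _ _ _ N.+1).
    rewrite exprMn_comm ?xnN ?mulr0 //; apply: comm_peval.
    by rewrite /xn mulrBl mulrBr xxs.
  have xE : x = xn + xs by rewrite subrK.
  (* Since [y * xn] is traceless, [tr(y x) = tr(y xs)] is the sum of the [ratr (q l) * l] weighted
     by the multiplicities [rk l]. *)
  move: yx; rewrite xE mulrDr etraceD yxn add0r -pevalMX pe etrace_sum => yx.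
  rewrite -[RHS]yx; apply: eq_big_seq => l lL.
  by have [E _] := rkP l lL; rewrite etraceZ hornerMX YE // E.
exists N.+1; suff xs0 : xs = 0 by rewrite -[RHS]xnN /xn xs0 subr0.
rewrite -(pevalX xs) pe big_seq big1 // => l lL; rewrite hornerX.
have [_] := rkP l lL; have [->->//|/(l0 l lL)-> _] := eqVneq (rk l) 0%N.
  by rewrite scaler0.
by rewrite scale0r.
Qed.

End CartanSplit.

(** * Extension of scalars to a splitting field *)

Lemma irreducible_factor (K : fieldType) (p : {poly K}) : (1 < size p)%N ->
  exists2 q, irreducible_poly q & q %| p.
Proof.
elim: {p}(size p) {-2}p (leqnn (size p)) => [|n IH] p le p1.
  by move: p1; rewrite ltnNge (leq_trans le).
have [[q [q1 qp nqp]]|no] := classic (exists q : {poly K}, [/\ size q != 1%N, q %| p & ~~ (q %= p)]).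
  have p0 : p != 0 by rewrite -size_poly_gt0 (ltn_trans _ p1).
  have q0 : q != 0 by apply: contra_neq p0 => q0; move: qp; rewrite q0 dvd0p => /eqP.
  have lt : (size q < size p)%N.
    by rewrite ltn_neqAle dvdp_leq // andbT dvdp_size_eqp.
  have [|r irr rq] := IH q (leq_trans lt le).
    by rewrite ltn_neqAle eq_sym q1 size_poly_gt0.
  by exists r => //; exact: dvdp_trans qp.
exists p => //; split=> // q q1 qp; apply/negPn/negP => nqp.
by apply: no; exists q.
Qed.

(** A root of an irreducible factor is adjoined and its linear factor divided out. The ground field
    grows each time, so the induction on the degree runs over all fields. *)
Lemma splitting_extension (K : fieldType) (p : {poly K}) : p != 0 ->
  exists (F : fieldType) (iota : {rmorphism K -> F}) (rs : seq F),
    map_poly iota p %= \prod_(l <- rs) ('X - l%:P).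
Proof.
move: {2}(size p) (leqnn (size p)) => n; elim: n K p => [|n IH] K p.
  by rewrite leqn0 size_poly_eq0 => /eqP -> /eqP.
move=> le p0; have [p1|p1] := leqP (size p) 1.
  exists K, idfun, [::]; rewrite big_nil map_poly_id // -size_poly_eq1 eqn_leq p1.
  by rewrite size_poly_gt0.
have [q irr qp] := irreducible_factor p1.
have [L _ [z qz _]] := irredp_FAdjoin irr.
pose i0 : {rmorphism K -> L} := in_alg L.
have /factor_theorem[p' E] : root (map_poly i0 p) z.
  by case/dvdpP: qp => r ->; rewrite rmorphM rootM /i0 qz orbT.
have pp0 : map_poly i0 p != 0 by rewrite map_poly_eq0.
have p'0 : p' != 0 by apply: contra_neq pp0 => p'0; rewrite E p'0 mul0r.
have sz : (size p' <= n)%N.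
  rewrite -ltnS; apply: leq_trans le; rewrite -(size_map_poly i0) E.
  by rewrite size_Mmonic ?monicXsubC // size_XsubC addn2.
have [F [i1 [rs H]]] := IH L p' sz p'0.
exists F, (i1 \o i0 : {rmorphism K -> F}), (i1 z :: rs).
rewrite big_cons map_poly_comp -/i0 E rmorphM /= map_polyXsubC mulrC.
exact: eqp_mull.
Qed.

Section BaseChange.
Variables (K F : fieldType) (iota : {rmorphism K -> F}) (V : vectType K).
Local Notation d := (\dim {:V}).
Implicit Types (f g : 'End(V)).

Definition rowmul n (M : 'M[F]_n) : 'End('rV[F]_n) := linfun (fun u => u *m M).

Lemma rowmulE n (M : 'M[F]_n) u : rowmul M u = u *m M.
Proof. by apply: linfunE => a v w; rewrite mulmxDl scalemxAl. Qed.

Lemma etrace_rowmul n (M : 'M[F]_n) : etrace (rowmul M) = \tr M.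
Proof.
pose e := vbasis {:'rV[F]_n}; have eP : basis_of fullv e := vbasisP _.
pose P := lin1_mx (rVof e); pose Q := lin1_mx (vecof e).
have PQ : P *m Q = 1%:M.
  apply/row_matrixP => i; rewrite !rowE mulmxA mulmx1 mul_rV_lin1 /=.
  by rewrite mul_rV_lin1 /= rVofK.
have -> : etrace (rowmul M) = \tr (Q *m M *m P).
  congr (\tr _); apply/row_matrixP => i; rewrite !rowE mul_mxof rowmulE.
  by rewrite !mulmxA mul_rV_lin1 /= mul_rV_lin1.
by rewrite -mulmxA mxtrace_mulC -mulmxA PQ mulmx1.
Qed.

(** The scalar extension of [f] in coordinates. Matrices act on row vectors from the right, which
    undoes the order reversal of [endmxM]. *)
Definition base_change f : 'End('rV[F]_d) := rowmul (map_mx iota (endmx f)).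

Lemma base_changeE f u : base_change f u = u *m map_mx iota (endmx f).
Proof. exact: rowmulE. Qed.

Lemma base_changeM f g : base_change (f * g) = base_change f * base_change g.
Proof.
by apply/lfunP => u; rewrite endM !base_changeE endmxM map_mxM mulmxA.
Qed.
Lemma base_change1 : base_change 1 = 1.
Proof. by apply/lfunP => u; rewrite end1 base_changeE endmx1 map_mx1 mulmx1. Qed.
Lemma base_changeD f g : base_change (f + g) = base_change f + base_change g.
Proof.
by apply/lfunP => u; rewrite add_lfunE !base_changeE endmxD map_mxD mulmxDr.
Qed.
Lemma base_changeZ a f : base_change (a *: f) = iota a *: base_change f.
Proof.
by apply/lfunP => u; rewrite scale_lfunE !base_changeE endmxZ map_mxZ scalemxAr.
Qed.
Lemma base_change0 : base_change 0 = 0.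
Proof. by rewrite -(scale0r 0) base_changeZ rmorph0 scale0r. Qed.
Lemma base_changeB f g : base_change (f - g) = base_change f - base_change g.
Proof. by rewrite -scaleN1r base_changeD base_changeZ rmorphN1 scaleN1r. Qed.
Lemma base_change_sum (I : Type) (r : seq I) (G : I -> 'End(V)) :
  base_change (\sum_(i <- r) G i) = \sum_(i <- r) base_change (G i).
Proof. exact: (big_morph base_change base_changeD base_change0). Qed.
Lemma base_changeX f k : base_change (f ^+ k) = base_change f ^+ k.
Proof.
by elim: k => [|k IH]; rewrite ?expr0 ?base_change1 // !exprS base_changeM IH.
Qed.

Lemma base_change_inj f : base_change f = 0 -> f = 0.
Proof.
move=> f0; apply: endmx_inj; rewrite endmx0.
apply: (map_mx_inj (f := iota)); rewrite map_mx0; apply/row_matrixP => i.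
by rewrite !rowE -base_changeE f0 zero_lfunE mulmx0.
Qed.

Lemma etrace_base_change f : etrace (base_change f) = iota (etrace f).
Proof. by rewrite etrace_rowmul trace_map_mx. Qed.

Lemma peval_base_change f p :
  peval (base_change f) (map_poly iota p) = base_change (peval f p).
Proof.
elim/poly_ind: p => [|p c IH]; first by rewrite rmorph0 !peval0 base_change0.
rewrite rmorphD rmorphM /= map_polyX map_polyC !pevalD !pevalMX IH !pevalC.
by rewrite base_changeD base_changeM base_changeZ base_change1.
Qed.

End BaseChange.

Section Cartan.
Variables (K : fieldType) (charK : [pchar K] =i pred0) (V : vectType K).
Implicit Types (f g x y : 'End(V)).

(** The closure and trace hypotheses are bilinear, so they pass to the [F]-span [AF] of the image of
    [A], where [F] splits an annihilating polynomial of [x]. There [cartan_split] applies, and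
    nilpotency descends because base change is injective. *)
Lemma cartan_nilpotent (A : {vspace 'End(V)}) x :
    (forall g h, g \in A -> h \in A -> g * h - h * g \in A) ->
    (forall g h, g \in A -> h \in A -> etrace (g * h) = 0) ->
    x \in lie_prod (@gl_law K V) A A ->
  exists k, x ^+ k = 0.
Proof.
move=> brA trA xAA.
have [p p0 px] := peval_annih x.
have [F [iota [rs prs]]] := splitting_extension p0.
have charF : [pchar F] =i pred0 by move=> q; rewrite (fmorph_pchar iota).
have [r [rA xr]] : exists r : seq ('End(V) * 'End(V)),
    (forall c, c \in r -> c.1 \in A /\ c.2 \in A) /\
    x = \sum_(c <- r) (c.1 * c.2 - c.2 * c.1).
  pose pr := allpairs pair (vbasis A) (vbasis A).
  have : x \in <<in_tuple (map (fun c => gl_law c.1 c.2) pr)>>%VS.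
    rewrite /= map_allpairs; exact: xAA.
  move/coord_span => E.
  pose co i := coord (in_tuple (map (fun c => gl_law c.1 c.2) pr)) i x.
  exists [seq (co i *: (nth 0 pr i).1, (nth 0 pr i).2) | i : 'I_(size (map (fun c => gl_law c.1 c.2) pr))].
  have ltpr i : (i < size (map (fun c => gl_law c.1 c.2) pr))%N -> (i < size pr)%N.
    by rewrite size_map.
  have prA i : (i < size pr)%N -> (nth 0 pr i).1 \in A /\ (nth 0 pr i).2 \in A.
    move=> /(mem_nth 0); case/allpairsP => -[a b] /= [aA bA ->].
    by split; exact: vbasis_mem.
  split=> [c /mapP[i _ ->] /=|].
    by have [a b] := prA i (ltpr _ (ltn_ord i)); rewrite memvZ.
  rewrite {1}E big_map enumT; apply: eq_bigr => i _ /=.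
  rewrite (nth_map 0) /gl_law; last exact/ltpr/ltn_ord.
  by rewrite endZl endZr scalerBr.
have xA : x \in A.
  by rewrite xr big_seq; apply: memv_suml => c /rA[c1 c2]; exact: brA.
pose bc := base_change iota (V := V).
pose X := map_tuple bc (vbasis A); pose AF := <<X>>%VS.
have XE i : X`_i = bc (vbasis A)`_i.
  have [lt|ge] := ltnP i (size (vbasis A)); first by rewrite (nth_map 0).
  by rewrite !nth_default ?size_map // /bc base_change0.
have bcA g : g \in A -> bc g \in AF.
  move=> gA; rewrite (coord_vbasis gA) /bc base_change_sum.
  apply: memv_suml => i _; rewrite base_changeZ memvZ //; apply: memv_span.
  by apply: map_f; apply: mem_nth; rewrite size_tuple.
have XA i : exists2 g, g \in A & X`_i = bc g.
  exists (vbasis A)`_i; last exact: XE.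
  have [lt|ge] := ltnP i (size (vbasis A)).
    by apply/vbasis_mem/mem_nth.
  by rewrite nth_default ?mem0v.
have [||||k xk] := @cartan_split F charF _ AF (bc x) rs.
- apply: (@peval_dvd _ _ _ (map_poly iota p)); first by rewrite (eqp_dvdl _ prs).
  by rewrite peval_base_change px base_change0.
- move=> g /coord_span ->; rewrite mulr_sumr mulr_suml -sumrB.
  apply: memv_suml => i _; rewrite endZr endZl -scalerBr memvZ //.
  have [h hA ->] := XA i.
  by rewrite /bc -!base_changeM -base_changeB; apply/bcA/brA.
- move=> g h /coord_span -> /coord_span ->; rewrite mulr_suml etrace_sum big1 // => i _.
  rewrite mulr_sumr etrace_sum big1 // => j _.
  have [a aA ->] := XA i; have [b bA ->] := XA j.
  by rewrite endZl endZr !etraceZ /bc -base_changeM etrace_base_change trA ?rmorph0 ?mulr0.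
- exists [seq (bc c.1, bc c.2) | c <- r]; split.
    by move=> _ /mapP[c /rA[c1 c2] ->] /=; split; exact: bcA.
  rewrite {1}xr /bc base_change_sum big_map; apply: eq_bigr => c _ /=.
  by rewrite base_changeB !base_changeM.
by exists k; apply: (@base_change_inj _ _ iota); rewrite base_changeX.
Qed.

End Cartan.

(** * Engel's theorem *)

Lemma vspace_max (K : fieldType) (V : vectType K) (P : {vspace V} -> Prop) U0 :
  P U0 -> exists2 U, P U & forall U', P U' -> (\dim U' <= \dim U)%N.
Proof.
move=> P0; have [n le] : exists n, (\dim {:V} - \dim U0 <= n)%N by exists (\dim {:V} - \dim U0)%N.
elim: n U0 P0 le => [|n IH] U0 P0 le.
  exists U0 => // U' _; apply: leq_trans (dimvS (subvf U')) _.
  by rewrite -subn_eq0 -leqn0.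
have [[U [PU lt]]|no] := classic (exists U, P U /\ (\dim U0 < \dim U)%N).
  apply: (IH U PU); rewrite -ltnS; apply: leq_trans le; apply: ltn_sub2l => //.
  exact: leq_trans lt (dimvS (subvf U)).
by exists U0 => // U PU; rewrite leqNgt; apply/negP => lt; apply: no; exists U.
Qed.

Section LieBasics.
Variables (K : fieldType) (V : vectType K) (br : V -> V -> V).
Hypothesis lieV : lie_law br.
Implicit Types (U W A I s : {vspace V}).

Lemma brDl x y z : br (x + y) z = br x z + br y z.
Proof. by case: lieV => _ l _ _; have := l z 1 x y; rewrite !scale1r. Qed.
Lemma brDr x y z : br x (y + z) = br x y + br x z.
Proof. by case: lieV => r _ _ _; have := r x 1 y z; rewrite !scale1r. Qed.
Lemma br0l x : br 0 x = 0.
Proof. by apply: (addrI (br 0 x)); rewrite -brDl !addr0. Qed.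
Lemma br0r x : br x 0 = 0.
Proof. by apply: (addrI (br x 0)); rewrite -brDr !addr0. Qed.
Lemma brZl a x y : br (a *: x) y = a *: br x y.
Proof. by case: lieV => _ l _ _; have := l y a x 0; rewrite !addr0 br0l addr0. Qed.
Lemma brZr a x y : br x (a *: y) = a *: br x y.
Proof. by case: lieV => r _ _ _; have := r x a y 0; rewrite !addr0 br0r addr0. Qed.
Lemma brNl x y : br (- x) y = - br x y.
Proof. by rewrite -scaleN1r brZl scaleN1r. Qed.
Lemma brNr x y : br x (- y) = - br x y.
Proof. by rewrite -scaleN1r brZr scaleN1r. Qed.
Lemma brBl x y z : br (x - y) z = br x z - br y z.
Proof. by rewrite brDl brNl. Qed.
Lemma brBr x y z : br x (y - z) = br x y - br x z.
Proof. by rewrite brDr brNr. Qed.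
Lemma brxx x : br x x = 0.
Proof. by case: lieV. Qed.
Lemma brC x y : br x y = - br y x.
Proof.
apply/eqP; rewrite -addr_eq0; apply/eqP; have := brxx (x + y).
by rewrite brDl !brDr !brxx addr0 add0r.
Qed.
Lemma br_jacobi x y z : br x (br y z) = br (br x y) z + br y (br x z).
Proof.
case: lieV => _ _ _ J; have := J x y z; rewrite (brC z (br x y)) (brC z x) brNr.
by move/eqP; rewrite subr_eq0 subr_eq => /eqP.
Qed.
Lemma adM x y : ad br (br x y) = ad br x * ad br y - ad br y * ad br x.
Proof.
apply/lfunP => z; rewrite add_lfunE opp_lfunE !endM !adE //.
by rewrite br_jacobi addrK.
Qed.
Lemma linear_ad : linear (ad br : V -> 'End(V)).
Proof.
by move=> a x y; apply/lfunP => z; rewrite add_lfunE scale_lfunE !adE // brDl brZl.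
Qed.

Definition derived n A : {vspace V} := iter n (fun W => lie_prod br W W) A.

Lemma lie_prodS U U' W W' : (U <= U')%VS -> (W <= W')%VS ->
  (lie_prod br U W <= lie_prod br U' W')%VS.
Proof.
move=> /subvP sU /subvP sW; apply/(lie_prod_subP lieV) => x y xU yW.
by apply: mem_lie_prod => //; [exact: sU | exact: sW].
Qed.

Lemma derived_sub n A : subalgebra br A -> (derived n A <= A)%VS.
Proof.
move=> sA; elim: n => [|n IH] /=; first exact: subvv.
exact: subv_trans (lie_prodS IH IH) sA.
Qed.

Lemma derivedS n A B : (A <= B)%VS -> (derived n A <= derived n B)%VS.
Proof. by move=> AB; elim: n => //= n IH; exact: lie_prodS. Qed.

Lemma derivedD n m A : derived (n + m) A = derived n (derived m A).
Proof. exact: iterD. Qed.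

End LieBasics.

Lemma jacobi_cancel (Z : zmodType) (a b c d e i : Z) :
  a - b + (c - d) + (d - e + (b - i)) + (i - c + (e - a)) = 0.
Proof.
rewrite [_ + (d - e + _)]addrA -[_ + (c - d) + _]addrA subrKA addrAC subrKA.
by rewrite addrACA !subrKA subrr.
Qed.

Lemma gl_lawE (K : fieldType) (V : vectType K) (f g : 'End(V)) :
  gl_law f g = f * g - g * f.
Proof. by []. Qed.

Lemma lie_gl (K : fieldType) (V : vectType K) : lie_law (@gl_law K V).
Proof.
split=> [f a g h|g a f h|f|f g h]; rewrite !gl_lawE ?subrr //.
- by rewrite mulrDr mulrDl endZr endZl scalerBr opprD addrACA.
- by rewrite mulrDr mulrDl endZr endZl scalerBr opprD addrACA.
rewrite !mulrBr !mulrBl !mulrA !opprB; exact: jacobi_cancel.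
Qed.

Section Engel.
Variables (K : fieldType) (E : vectType K) (br : E -> E -> E).
Hypothesis lieE : lie_law br.
Implicit Types (L B : {vspace E}).

Definition lad : 'Hom(E, 'End(E)) := linfun (ad br).
Lemma lad_ad x : lad x = ad br x.
Proof. by rewrite /lad linfunE //; exact: linear_ad. Qed.
Lemma ladE x y : lad x y = br x y.
Proof. by rewrite lad_ad adE. Qed.

(* Engel's theorem for the module U / U'.  The induction produces an ideal B
   of codimension one in L by applying the statement itself to the B-module
   L / B; this is why it is relative to a submodule U' and why W varies. *)
Lemma engel L : (forall x y, x \in L -> y \in L -> br x y \in L) ->
    (forall x y, x \in L -> y \in L -> exists i, iter i (br x) y = 0) ->
  forall (W : vectType K) (act : 'Hom(E, 'End(W))) (U' U : {vspace W}),
    (forall x y, x \in L -> y \in L ->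
       act (br x y) = act x * act y - act y * act x) ->
    (U' <= U)%VS -> U' <> U ->
    (forall x u, x \in L -> u \in U -> act x u \in U) ->
    (forall x u, x \in L -> u \in U' -> act x u \in U') ->
    (forall x u, x \in L -> u \in U -> exists i, iter i (act x) u \in U') ->
  exists v, [/\ v \in U, v \notin U' & forall x, x \in L -> act x v \in U'].
Proof.
move: {2}(\dim L) (leqnn (\dim L)) => n; elim: n L => [|n IH] L le brL nilL
  W act U' U hom sU nU LU LU' nil.
  move: le; rewrite leqn0 dimv_eq0 => /eqP L0.
  have /subvPn[v vU vU'] : ~~ (U <= U')%VS.
    by apply/negP => UU'; apply: nU; apply/eqP; rewrite eqEsubv sU.
  exists v; split=> // x; rewrite L0 memv0 => /eqP ->.
  by rewrite linear0 zero_lfunE mem0v.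
have [Leq0|L0] := eqVneq L 0%VS.
  by apply: (IH L) => //; rewrite Leq0 dimv0.
have [|B [sB ltB brB] maxB] := @vspace_max K E (fun B => [/\ (B <= L)%VS,
    (\dim B < \dim L)%N & forall x y, x \in B -> y \in B -> br x y \in B]) 0%VS.
  split; rewrite ?sub0v ?dimv0 ?lt0n ?dimv_eq0 // => x y.
  by rewrite memv0 => /eqP -> _; rewrite br0l // mem0v.
have leB : (\dim B <= n)%N by rewrite -ltnS (leq_trans ltB).
have BL x : x \in B -> x \in L by exact: (subvP sB).
have nBL : B <> L by move=> BeL; move: ltB; rewrite BeL ltnn.
have nilB x y : x \in B -> y \in B -> exists i, iter i (br x) y = 0.
  by move=> xB yB; exact: nilL (BL _ xB) (BL _ yB).
(* [a] represents a nonzero vector of [L / B] killed by [B]: it normalises [B], so maximality of [B]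
   makes [B + <[a]>] all of [L]. *)
have [||||||a [aL aB brBa]] := IH B leB brB nilB E lad B L.
- by move=> x y xB yB; rewrite !lad_ad adM.
- exact: sB.
- exact: nBL.
- by move=> x u xB uL; rewrite ladE; exact: brL (BL _ xB) uL.
- by move=> x u xB uB; rewrite ladE brB.
- move=> x u xB uL; have [i ix] := nilL _ _ (BL _ xB) uL; exists i.
  by rewrite (eq_iter (ladE x)) ix mem0v.
have brBa' b : b \in B -> br b a \in B by move/brBa; rewrite ladE.
have LE : (B + <[a]>)%VS = L.
  have sBa : (B + <[a]> <= L)%VS by rewrite subv_add sB -memvE aL.
  apply/eqP; rewrite eqEdim sBa /= leqNgt; apply/negP => lt.
  have le' : (\dim (B + <[a]>) <= \dim B)%N.
    apply: maxB; split=> // x y /memv_addP[b bB [_ /vlineP[c ->] ->]].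
    case/memv_addP=> b' b'B [_ /vlineP[c' ->] ->].
    rewrite (brDl lieE) !(brDr lieE) !(brZl lieE) !(brZr lieE) (brxx lieE) !scaler0 addr0.
    apply: (subvP (addvSl _ _)); rewrite (brC lieE a b') scalerN.
    apply: memvB; last by rewrite memvZ ?brBa'.
    by apply: memvD; [exact: brB | rewrite memvZ ?brBa'].
  case/negP: aB; have /eqP -> : B == (B + <[a]>)%VS by rewrite eqEdim addvSl.
  exact: (subvP (addvSr _ _) _ (memv_line a)).
have [||||||v0 [v0U v0U' Bv0]] := IH B leB brB nilB W act U' U.
- by move=> x y xB yB; exact: hom (BL _ xB) (BL _ yB).
- exact: sU.
- exact: nU.
- by move=> x u xB; apply: LU; exact: BL.
- by move=> x u xB; apply: LU'; exact: BL.
- by move=> x u xB; apply: nil; exact: BL.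
have itU i : iter i (act a) v0 \in U by elim: i => //= i; exact: LU.
(* Since [[B, a]] lies in [B], every iterate of [a] on [v0] is killed by [B] modulo [U']; the last
   iterate outside [U'] is then killed by [a] as well. *)
have Bit i b : b \in B -> act b (iter i (act a) v0) \in U'.
  elim: i b => [|i IHi] b bB //=; first exact: Bv0.
  have -> : act b (act a (iter i (act a) v0)) =
      act (br b a) (iter i (act a) v0) + act a (act b (iter i (act a) v0)).
    by rewrite (hom _ _ (BL _ bB) aL) add_lfunE opp_lfunE !endM subrK.
  by apply: memvD; [apply: IHi; exact: brBa' | apply: LU'; rewrite ?IHi].
have [i] := nil _ _ aL v0U; elim: i => [|i IHi] /=; first by rewrite (negPf v0U').
move=> ai; have [|niU] := boolP (iter i (act a) v0 \in U'); first exact: IHi.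
exists (iter i (act a) v0); split=> // x; rewrite -LE.
case/memv_addP=> b bB [_ /vlineP[c ->] ->].
rewrite linearD linearZ /= add_lfunE scale_lfunE; apply: memvD; first exact: Bit.
exact: memvZ.
Qed.

(** A dual form of Engel's theorem: the action on [U / U'] is not onto. For [X] a maximal proper
    submodule above [U'], the vector of [U / X] given by [engel] spans this quotient, so all of [U]
    is sent into [X]. *)
Lemma engel_proper L : (forall x y, x \in L -> y \in L -> br x y \in L) ->
    (forall x y, x \in L -> y \in L -> exists i, iter i (br x) y = 0) ->
  forall (W : vectType K) (act : 'Hom(E, 'End(W))) (U' U : {vspace W}),
    (forall x y, x \in L -> y \in L ->
       act (br x y) = act x * act y - act y * act x) ->
    (U' <= U)%VS -> U' <> U ->
    (forall x u, x \in L -> u \in U -> act x u \in U) ->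
    (forall x u, x \in L -> u \in U' -> act x u \in U') ->
    (forall x u, x \in L -> u \in U -> exists i, iter i (act x) u \in U') ->
  exists X, [/\ (U' <= X)%VS, (X <= U)%VS, X <> U &
    forall x u, x \in L -> u \in U -> act x u \in X].
Proof.
move=> brL nilL W act U' U hom sU nU LU LU' nil.
have [X [U'X XU nXU LX] maxX] := @vspace_max K W (fun X => [/\ (U' <= X)%VS,
  (X <= U)%VS, X <> U & forall x u, x \in L -> u \in X -> act x u \in X]) U'
  (And4 (subvv _) sU nU LU').
have [|v [vU vX Lv]] := engel brL nilL hom XU nXU LU LX.
  by move=> x u xL uU; have [i iU'] := nil x u xL uU; exists i; exact: (subvP U'X).
exists X; split=> //.
have XvU : (X + <[v]>)%VS = U.
  have [//|nXv] := classic ((X + <[v]>)%VS = U).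
  case/negP: vX; have /eqP -> : X == (X + <[v]>)%VS.
    rewrite eqEdim addvSl maxX //; split=> //.
    - exact: subv_trans U'X (addvSl _ _).
    - by rewrite subv_add XU -memvE.
    move=> x _ xL /memv_addP[u uX [_ /vlineP[c ->] ->]].
    rewrite linearD linearZ /=; apply: (subvP (addvSl _ _)).
    by apply: memvD; [exact: LX | apply: memvZ; exact: Lv].
  exact: (subvP (addvSr _ _) _ (memv_line v)).
move=> x u xL; rewrite -XvU => /memv_addP[w wX [_ /vlineP[c ->] ->]].
rewrite linearD linearZ /=; apply: memvD; first exact: LX.
by apply: memvZ; exact: Lv.
Qed.

End Engel.

Section NilpotentAlgebra.
Variables (K : fieldType) (W : vectType K).
Local Notation gl := (@gl_law K W).
Implicit Types (D : {vspace 'End(W)}).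

(** A stable [U] is mapped into a proper [X], which some derived term kills by induction on the
    dimension. For [f] and [g] in that term [f (g u) = 0], because [g u] lies in [X]; hence the next
    derived term kills [U]. *)
Lemma derived_nilpotent_maps D : subalgebra gl D ->
    (forall f, f \in D -> exists i, f ^+ i = 0) ->
  exists n, derived gl n D = 0%VS.
Proof.
move=> sD nilD; have lgl := @lie_gl K W.
have brD : forall x y, x \in D -> y \in D -> gl x y \in D.
  by apply/(lie_prod_subP lgl).
have adnil : forall f g, f \in D -> g \in D -> exists i, iter i (gl f) g = 0.
  move=> f g fD gD; have [i fi] := nilD _ fD; exists (i + i)%N.
  have -> : iter (i + i) (gl f) g = iter (i + i) (bracket_by f) g.
    by apply: eq_iter => h; rewrite bracket_byE.
  by rewrite -endX bracket_by_nilp ?zero_lfunE.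
pose act : 'Hom('End(W), 'End(W)) := \1%VF.
have actE x : act x = x by exact: id_lfunE.
suff H m (U : {vspace W}) : (\dim U <= m)%N ->
    (forall f u, f \in D -> u \in U -> f u \in U) ->
    exists n, forall f u, f \in derived gl n D -> u \in U -> f u = 0.
  have [f u _ _|n Dn] := H (\dim {:W}) fullv (leqnn _); first exact: memvf.
  exists n; apply/eqP; rewrite -subv0; apply/subvP => f fD.
  by rewrite memv0; apply/eqP/lfunP => u; rewrite zero_lfunE Dn ?memvf.
elim: m U => [|m IH] U le DU.
  exists 0%N => f u _; move: le; rewrite leqn0 dimv_eq0 => /eqP ->.
  by rewrite memv0 => /eqP ->; rewrite linear0.
have [U0|U0] := eqVneq U 0%VS.
  by exists 0%N => f u _; rewrite U0 memv0 => /eqP ->; rewrite linear0.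
have [||||||X [_ XU nXU DX]] := engel_proper lgl brD adnil (act := act) (U' := 0%VS) (U := U).
- by move=> x y _ _; rewrite !actE.
- exact: sub0v.
- by move/eqP; rewrite eq_sym (negPf U0).
- by move=> x u xD uU; rewrite actE DU.
- by move=> x u xD; rewrite memv0 => /eqP ->; rewrite linear0 mem0v.
- move=> x u xD uU; have [i xi] := nilD _ xD; exists i.
  by rewrite actE -endX xi zero_lfunE mem0v.
have [||n Dn] := IH X.
- rewrite -ltnS; apply: leq_trans le; rewrite ltnNge; apply/negP => ge.
  by apply: nXU; apply/eqP; rewrite eqEdim XU.
- by move=> f u fD uX; rewrite -(actE f) DX // (subvP XU).
exists n.+1; pose Z : {vspace 'End(W)} := vspace_of (fun f : 'End(W) => forall u, u \in U -> f u = 0).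
have ZP f : f \in Z <-> forall u, u \in U -> f u = 0.
  apply: (mem_vspace_of (P := fun f : 'End(W) => forall u, u \in U -> f u = 0)).
  split=> [u _|a g h g0 h0 u uU]; first exact: zero_lfunE.
  by rewrite add_lfunE scale_lfunE g0 // h0 // scaler0 addr0.
suff : (derived gl n.+1 D <= Z)%VS by move/subvP => H f u /H/ZP; apply.
apply/(lie_prod_subP lgl) => f g fD gD; apply/ZP => u uU.
have sDn := subvP (derived_sub lgl n sD).
have DnX h : h \in derived gl n D -> h u \in X by move/sDn=> hD; rewrite -(actE h) DX.
by rewrite gl_lawE add_lfunE opp_lfunE !endM (Dn f (g u)) ?(Dn g (f u)) ?subrr ?DnX.
Qed.

End NilpotentAlgebra.

(** * Cartan's criterion for a representation *)

Section CartanCriterion.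
Variables (K : fieldType) (charK : [pchar K] =i pred0).
Variables (V W : vectType K) (br : V -> V -> V) (lieV : lie_law br).
Implicit Types (A : {vspace V}) (rho : 'Hom(V, 'End(W))).

(** By [cartan_nilpotent] the algebra [[rho(A), rho(A)]] consists of nilpotent maps, so it is
    solvable. As [rho] may have a kernel, the conclusion is that a derived term of [A] acts
    trivially. *)
Lemma cartan_criterion A rho : subalgebra br A ->
    (forall x y, x \in A -> y \in A ->
       rho (br x y) = rho x * rho y - rho y * rho x) ->
    (forall x y, x \in A -> y \in A -> etrace (rho x * rho y) = 0) ->
  exists n, forall x, x \in derived br n A -> rho x = 0.
Proof.
move=> sA hom trA; have lgl := @lie_gl K W.
pose I := (rho @: A)%VS; pose D := lie_prod (@gl_law K W) I I.
have brA : forall x y, x \in A -> y \in A -> br x y \in A.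
  exact/(lie_prod_subP lieV).
have brI f g : f \in I -> g \in I -> f * g - g * f \in I.
  move=> /memv_imgP[x xA ->] /memv_imgP[y yA ->].
  by rewrite -hom // memv_img // brA.
have DI : (D <= I)%VS by apply/(lie_prod_subP lgl) => f g; exact: brI.
have [||n Dn] := @derived_nilpotent_maps K W D.
- exact: lie_prodS.
- move=> f fD; apply: (cartan_nilpotent charK brI _ fD).
  by move=> g h /memv_imgP[x xA ->] /memv_imgP[y yA ->]; exact: trA.
exists n.+1 => x xA; apply/eqP; rewrite -memv0 -Dn.
elim: n x xA {Dn} => [|n IH] x.
  rewrite /= memv_preim; apply: subvP x; apply/(lie_prod_subP lieV) => x y xA yA.
  rewrite -memv_preim hom //; apply: (mem_lie_prod lgl); exact: memv_img.
rewrite memv_preim; apply: subvP x; apply/(lie_prod_subP lieV) => x y xA yA.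
have sub := subvP (derived_sub lieV n.+1 sA).
rewrite -memv_preim hom ?sub //; apply: (mem_lie_prod lgl); exact: IH.
Qed.

End CartanCriterion.

(** * Semisimple Lie algebras and Whitehead's lemma *)

Lemma linear_combination (K : fieldType) (V W : vectType K) (f : V -> W)
    (I : Type) (r : seq I) (c : I -> K) (v : I -> V) : linear f ->
  f (\sum_(i <- r) c i *: v i) = \sum_(i <- r) c i *: f (v i).
Proof.
move=> lf; rewrite -(linfunE lf) linear_sum.
by apply: eq_bigr => i _; rewrite linearZ /= linfunE.
Qed.

(** * Bilinear forms and dual bases *)

Section DualBases.
Variables (K : fieldType) (V : vectType K) (B : V -> V -> K).
Hypothesis linB : forall y, scalar (B^~ y).
Hypothesis symB : forall x y, B x y = B y x.
Implicit Types (s a U : {vspace V}).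

Lemma formDl x y z : B (x + y) z = B x z + B y z.
Proof. by have := linB z 1 x y; rewrite scale1r /= mul1r. Qed.
Lemma form0l z : B 0 z = 0.
Proof. by apply: (addrI (B 0 z)); rewrite -formDl !addr0. Qed.
Lemma formZl c x z : B (c *: x) z = c * B x z.
Proof. by have := linB z c x 0; rewrite addr0 form0l addr0. Qed.
Lemma formDr x y z : B z (x + y) = B z x + B z y.
Proof. by rewrite !(symB z) formDl. Qed.
Lemma formBl x y z : B (x - y) z = B x z - B y z.
Proof. by rewrite formDl -scaleN1r formZl mulN1r. Qed.
Lemma form_suml (I : Type) (r : seq I) (c : I -> K) (v : I -> V) z :
  B (\sum_(i <- r) c i *: v i) z = \sum_(i <- r) c i * B (v i) z.
Proof.
elim: r => [|i r IH]; first by rewrite !big_nil form0l.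
by rewrite !big_cons formDl formZl IH.
Qed.
Lemma form_sumr (I : Type) (r : seq I) (c : I -> K) (v : I -> V) z :
  B z (\sum_(i <- r) c i *: v i) = \sum_(i <- r) c i * B z (v i).
Proof. by rewrite symB form_suml; apply: eq_bigr => i _; rewrite symB. Qed.

Definition form_orth s U : {vspace V} :=
  vspace_of (fun x => x \in s /\ forall y, y \in U -> B x y = 0).

Lemma mem_form_orth s U x :
  x \in form_orth s U <-> x \in s /\ forall y, y \in U -> B x y = 0.
Proof.
apply: (mem_vspace_of (P := fun x => x \in s /\ forall y, y \in U -> B x y = 0)).
split=> [|c u v [us u0] [vs v0]]; first by split=> [|y _]; rewrite ?mem0v ?form0l.
split=> [|y yU]; first by rewrite memvD ?memvZ.
by rewrite formDl formZl u0 // v0 // mulr0 addr0.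
Qed.

Lemma form_orth_neq0 s U : (\dim U < \dim s)%N -> form_orth s U <> 0%VS.
Proof.
move=> lt o0; pose T x : 'rV[K]_(\dim U) := \row_i B x (vbasis U)`_i.
have lT : linear T.
  by move=> c x y; apply/rowP => i; rewrite !mxE formDl formZl.
have := limg_ker_dim (linfun T) s.
have -> : (s :&: lker (linfun T))%VS = 0%VS.
  apply/eqP; rewrite -subv0 -o0; apply/subvP => x /memv_capP[xs].
  rewrite memv_ker linfunE // => /eqP/rowP Tx; apply/mem_form_orth; split=> // y yU.
  rewrite (coord_vbasis yU) form_sumr big1 // => i _.
  by have := Tx i; rewrite !mxE => ->; rewrite mulr0.
rewrite dimv0 add0n => E; have := dimvS (subvf (linfun T @: s)%VS).
by rewrite E dimvf /dim /= mul1n leqNgt lt.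
Qed.

(** The form may be degenerate on [s]. The dual bases are those of a complement [s'] of its radical
    [a], where the Gram matrix is invertible, and expansions hold modulo [a]. *)
Lemma dual_bases s : let a := form_orth s s in
  exists (r : nat) (e e' : 'I_r -> V),
  [/\ forall i, e i \in s /\ e' i \in s,
      forall i, B (e i) (e' i) = 1,
      forall u, u \in s -> u - \sum_i B u (e' i) *: e i \in a,
      forall u, u \in s -> u - \sum_i B u (e i) *: e' i \in a
    & r = 0%N -> (s <= a)%VS].
Proof.
move=> a; pose s' := (s :\: a)%VS; pose r := \dim s'.
have s's : (s' <= s)%VS := diffvSl s a.
pose e (i : 'I_r) := (vbasis s')`_i.
have es' i : e i \in s' by apply/vbasis_mem/mem_nth; rewrite size_tuple.
have es i : e i \in s := subvP s's _ (es' i).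
have radP v : v \in s -> (forall i, B v (e i) = 0) -> v \in a.
  move=> vs v0; apply/mem_form_orth; split=> // y ys.
  have sa : s = (s' + a)%VS.
    have sas : (a <= s)%VS by apply/subvP => x /mem_form_orth[].
    by rewrite /s' addv_diff; apply/esym/addv_idPl.
  move: ys; rewrite {1}sa => /memv_addP[z zs' [w wa ->]].
  rewrite formDr [B v w]symB; have [_ ->] := (mem_form_orth _ _ _).1 wa; rewrite ?addr0 //.
  by rewrite (coord_vbasis zs') form_sumr big1 // => i _; rewrite v0 mulr0.
pose G := \matrix_(i, j) B (e i) (e j).
have uG : G \in unitmx.
  rewrite -row_free_unit -kermx_eq0; apply/eqP/row_matrixP => i.
  rewrite row0; set u := row i _.
  have uG : u *m G = 0 by rewrite -row_mul mulmx_ker row0.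
  pose y := \sum_j u 0 j *: e j.
  have ys' : y \in s' by apply: memv_suml => j _; rewrite memvZ.
  have ya : y \in a.
    apply: radP => [|j]; first exact: (subvP s's).
    have := congr1 (fun M : 'rV_r => M 0 j) uG; rewrite !mxE => <-.
    by rewrite form_suml; apply: eq_bigr => k _; rewrite !mxE.
  have y0 : y = 0.
    by apply/eqP; rewrite -memv0 -(capv_diff s a) memv_cap ys' ya.
  apply/rowP => j; have /freeP/(_ (fun j => u 0 j)) := basis_free (vbasisP s').
  by move=> ->; rewrite ?mxE.
pose e' j := \sum_k invmx G k j *: e k.
have e's j : e' j \in s by apply: memv_suml => k _; rewrite memvZ.
have dual i j : B (e i) (e' j) = (i == j)%:R.
  rewrite form_sumr; transitivity ((G *m invmx G) i j); last by rewrite mulmxV ?mxE.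
  by rewrite mxE; apply: eq_bigr => k _; rewrite [G i k]mxE mulrC.
have ee' m : e m = \sum_j G j m *: e' j.
  transitivity (\sum_k (invmx G *m G) k m *: e k).
    rewrite mulVmx // (bigD1 m) //= mxE eqxx scale1r big1 ?addr0 // => k km.
    by rewrite mxE (negPf km) scale0r.
  under eq_bigr => k _ do rewrite mxE scaler_suml.
  rewrite exchange_big; apply: eq_bigr => j _; rewrite scaler_sumr.
  by apply: eq_bigr => k _; rewrite scalerA mulrC.
exists r, e, e'; split=> // [i|u us|u us|r0]; first by rewrite dual eqxx.
- have vs : u - \sum_i B u (e' i) *: e i \in s.
    by rewrite memvB // memv_suml // => i _; rewrite memvZ.
  apply: radP => // m; rewrite ee' form_sumr big1 // => j _.
  rewrite formBl form_suml (bigD1 j) //= dual eqxx mulr1 big1 ?addr0 ?subrr ?mulr0 //.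
  by move=> k kj; rewrite dual (negPf kj) mulr0.
- have vs : u - \sum_i B u (e i) *: e' i \in s.
    by rewrite memvB // memv_suml // => i _; rewrite memvZ.
  apply: radP => // m; rewrite formBl form_suml (bigD1 m) //= symB [B (e' m) _]symB.
  rewrite dual eqxx mulr1 big1 ?addr0 ?subrr // => k km.
  by rewrite [B (e' k) _]symB dual eq_sym (negPf km) mulr0.
have : s' = 0%VS by apply/eqP; rewrite -dimv_eq0; apply/eqP.
by move/eqP; rewrite diffv_eq0.
Qed.

End DualBases.

Definition tform (K : fieldType) (V W : vectType K) (rho : 'Hom(V, 'End(W))) x y :=
  etrace (rho x * rho y).

Lemma trace_form_scalar (K : fieldType) (V W : vectType K)
  (rho : 'Hom(V, 'End(W))) y : scalar ((tform rho)^~ y).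
Proof.
by move=> c u v; rewrite /tform linearP mulrDl endZl etraceD etraceZ.
Qed.

Lemma tformNl (K : fieldType) (V W : vectType K) (rho : 'Hom(V, 'End(W))) x y :
  tform rho (- x) y = - tform rho x y.
Proof. by rewrite /tform linearN mulNr etraceN. Qed.

Section Semisimple.
Variables (K : fieldType) (charK : [pchar K] =i pred0).
Variables (V : vectType K) (br : V -> V -> V) (lieV : lie_law br).
Variable s : {vspace V}.
Implicit Types (a b I U : {vspace V}) (W : vectType K).

(** The subalgebra [s] and its ideals are kept as subspaces of [V]; likewise a representation of [s]
    is a map defined on [V] that respects brackets on [s] ([hom_on]). *)
Definition ideal_of I := (I <= s)%VS /\ forall x y, x \in s -> y \in I -> br x y \in I.

Hypothesis sub_s : forall x y, x \in s -> y \in s -> br x y \in s.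
Hypothesis rad0 : forall I, ideal_of I -> solvable_space br I -> I = 0%VS.

Definition hom_on W (rho : 'Hom(V, 'End(W))) := forall x y, x \in s -> y \in s ->
  rho (br x y) = rho x * rho y - rho y * rho x.

Lemma hom_lad : hom_on (lad br).
Proof. by move=> x y _ _; rewrite !(lad_ad lieV) (adM lieV). Qed.

Lemma tform_sym W (rho : 'Hom(V, 'End(W))) x y : tform rho x y = tform rho y x.
Proof. exact: etraceC. Qed.

Lemma tform_inv W (rho : 'Hom(V, 'End(W))) x y z : hom_on rho ->
  x \in s -> y \in s -> z \in s ->
  tform rho (br x y) z = tform rho x (br y z).
Proof. by move=> hom xs ys zs; rewrite /tform !hom // etrace_bracket. Qed.

Lemma ideal_subalgebra a : ideal_of a -> subalgebra br a.
Proof.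
move=> [/subvP as_ a_id]; apply/(lie_prod_subP lieV) => x y xa ya.
by rewrite a_id ?as_.
Qed.

Lemma ideal_orth W (rho : 'Hom(V, 'End(W))) a : hom_on rho -> ideal_of a ->
  ideal_of (form_orth (tform rho) a a).
Proof.
move=> hom [/subvP as_ a_id].
have P x := mem_form_orth (trace_form_scalar rho) a a x.
split=> [|x y xs /P[ya y0]]; first by apply/subvP => x /P[xa _]; exact: as_.
apply/P; split=> [|z za]; first exact: a_id.
by rewrite (brC lieV) tformNl (tform_inv hom (as_ _ ya) xs (as_ _ za)) y0 ?a_id ?oppr0.
Qed.

(** The form is the trace of the adjoint action on all of [V]. On its radical, Cartan's criterion
    makes some derived term central, so this radical is a solvable ideal. *)
Lemma killing_orth0 a : ideal_of a -> form_orth (tform (lad br)) a a = 0%VS.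
Proof.
move=> ia; apply: rad0; first exact: (ideal_orth hom_lad).
set c := form_orth _ a a; have ic : ideal_of c := ideal_orth hom_lad ia.
have P x := mem_form_orth (trace_form_scalar (lad br)) a a x.
have [||n cn] := cartan_criterion charK lieV (ideal_subalgebra ic) (rho := lad br).
- by move=> x y xc yc; apply: hom_lad; apply: (subvP ic.1).
- by move=> x y /P[_ x0] /P[ya _]; exact: x0.
exists n.+1; apply/eqP; rewrite -subv0; apply/(lie_prod_subP lieV) => x y xc _.
by rewrite -(ladE lieV) cn // zero_lfunE mem0v.
Qed.

(** Let [b] be the orthogonal of [[a, a]] in [a]. Invariance makes [[a, b]] orthogonal to [a], hence
    zero by [killing_orth0]; so [b] is an abelian ideal, hence zero, and counting dimensions gives
    [[a, a] = a]. *)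
Lemma ideal_perfect a : ideal_of a -> lie_prod br a a = a.
Proof.
move=> ia; have [/subvP as_ a_id] := ia; have saa := ideal_subalgebra ia.
have sc := trace_form_scalar (lad br); pose T := tform (lad br).
pose b := form_orth T a (lie_prod br a a).
have P x : x \in b <-> _ := mem_form_orth sc a (lie_prod br a a) x.
have /subvP aa := saa.
have ab x y : x \in a -> y \in b -> br x y = 0.
  move=> xa /P[ya y0]; apply/eqP; rewrite -memv0 -(killing_orth0 ia).
  apply/(mem_form_orth sc); split=> [|z za]; first by rewrite a_id ?as_.
  rewrite (brC lieV) tformNl (tform_inv hom_lad (as_ _ ya) (as_ _ xa) (as_ _ za)).
  by rewrite y0 ?oppr0 //; apply: mem_lie_prod.
have b0 : b = 0%VS.
  apply: rad0; last first.
    exists 1%N; apply/eqP; rewrite -subv0; apply/(lie_prod_subP lieV) => x y /P[xa _] yb.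
    by rewrite ab ?mem0v.
  split=> [|x y xs /P[ya y0]]; first by apply/subvP => x /P[xa _]; exact: as_.
  apply/P; split=> [|z zaa]; first exact: a_id.
  rewrite (brC lieV) tformNl (tform_inv hom_lad (as_ _ ya) xs (as_ _ (aa _ zaa))).
  rewrite y0 ?oppr0 //; move: z zaa.
  suff : (lie_prod br a a <= linfun (br x) @^-1: lie_prod br a a)%VS.
    by move/subvP => H z /H; rewrite -memv_preim linfunE //; case: lieV.
  apply/(lie_prod_subP lieV) => u v ua va; rewrite -memv_preim linfunE; last by case: lieV.
  by rewrite (br_jacobi lieV) memvD //; apply: mem_lie_prod; rewrite ?a_id.
apply/eqP; rewrite eqEdim [(_ <= a)%VS]saa /= leqNgt; apply/negP => lt.
exact: (form_orth_neq0 sc (@tform_sym _ _) lt).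
Qed.

Lemma ideal_s : ideal_of s.
Proof. by split=> // *; exact: sub_s. Qed.

(** Cartan's criterion makes a derived term of [a] act trivially, and the perfect ideal [a] equals
    all its derived terms. *)
Lemma trace_orth_trivial W (rho : 'Hom(V, 'End(W))) a : hom_on rho ->
  ideal_of a -> (forall x y, x \in a -> y \in a -> tform rho x y = 0) ->
  forall x, x \in a -> rho x = 0.
Proof.
move=> hom ia tr0; have as_ := subvP ia.1.
have [|n an] := cartan_criterion charK lieV (ideal_subalgebra ia) (rho := rho) _ tr0.
  by move=> x y xa ya; apply: hom; exact: as_.
suff E : derived br n a = a by move: an; rewrite E.
by elim: n {an} => //= n ->; exact: ideal_perfect.
Qed.

Lemma cocycle_vanish W (d : 'Hom(V, W)) a : ideal_of a ->
  (forall x y, x \in a -> y \in a -> d (br x y) = 0) ->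
  forall x, x \in a -> d x = 0.
Proof.
move=> ia d0 x xa; apply/eqP; rewrite -memv_ker; move: x xa; apply/subvP.
rewrite -{1}(ideal_perfect ia); apply/(lie_prod_subP lieV) => x y xa ya.
by rewrite memv_ker d0.
Qed.

(** The tensor of the [e i] and [e' i] is [s]-invariant modulo the radical [a], because the matrices
    of [x] in the two dual bases are opposite transposes. Testing it on an arbitrary [beta] serves
    both for the Casimir operator, with [rho u * rho v], and for a cocycle, with [rho u (d v)]. *)
Lemma casimir_invariance W (rho : 'Hom(V, 'End(W))) (X : vectType K)
    (r : nat) (e e' : 'I_r -> V) (beta : V -> V -> X) a x :
    hom_on rho ->
    (forall i, e i \in s /\ e' i \in s) ->
    (forall u, u \in s -> u - \sum_i tform rho u (e' i) *: e i \in a) ->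
    (forall u, u \in s -> u - \sum_i tform rho u (e i) *: e' i \in a) ->
    (forall u, linear (beta u)) -> (forall v, linear (beta^~ v)) ->
    (forall u v, u \in s -> v \in a -> beta u v = 0) ->
    (forall u v, u \in a -> v \in s -> beta u v = 0) ->
    x \in s ->
  \sum_i (beta (br x (e i)) (e' i) + beta (e i) (br x (e' i))) = 0.
Proof.
move=> hom es d1 d2 lr ll b1 b2 xs.
have E1 u v : u \in s -> v \in s ->
    beta u v = \sum_i tform rho u (e' i) *: beta (e i) v.
  move=> us vs; rewrite -(linear_combination _ _ _ (ll v)).
  by apply/subr0_eq; rewrite -(b2 _ v (d1 u us) vs) -scaleN1r addrC -ll scaleN1r addrC.
have E2 u v : u \in s -> v \in s ->
    beta u v = \sum_i tform rho v (e i) *: beta u (e' i).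
  move=> us vs; rewrite -(linear_combination _ _ _ (lr u)).
  by apply/subr0_eq; rewrite -(b1 u _ us (d2 v vs)) -scaleN1r addrC -lr scaleN1r addrC.
have [es1 es2] : (forall i, e i \in s) /\ (forall i, e' i \in s).
  by split=> i; have [] := es i.
rewrite big_split /=.
rewrite [X in X + _](eq_bigr _ (fun i _ => E1 _ _ (sub_s xs (es1 i)) (es2 i))).
rewrite [X in _ + X](eq_bigr _ (fun i _ => E2 _ _ (es1 i) (sub_s xs (es2 i)))).
rewrite exchange_big -big_split big1 //= => i _.
rewrite -big_split big1 //= => j _; rewrite -scalerDl.
rewrite (brC lieV x (e j)) tformNl (tform_inv hom) //.
by rewrite tform_sym addNr scale0r.
Qed.

End Semisimple.

(* The spectral projector of C onto its generalised kernel, as a polynomial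
   in C. *)
Lemma fitting_projector (K : fieldType) (V : vectType K) (C : 'End(V)) :
  exists P Q : {poly K}, exists m,
    [/\ peval C P + C * peval C Q = 1, peval C P * peval C P = peval C P
      & peval C P * C ^+ m = 0].
Proof.
have [chi chi0 chiC] := peval_annih C.
have [m [q q0 E]] : exists m, exists2 q : {poly K}, ~~ root q 0 & chi = q * 'X^m.
  have [m [q]] := multiplicity_XsubC chi 0.
  by rewrite polyC0 subr0 => qr ->; exists m, q; rewrite ?(implyP qr).
have cp : coprimep ('X^(m.+1)) q by rewrite coprimep_expl // coprimep_sym -['X]subr0 -polyC0 coprimep_XsubC.
have [u [w uw]] := coprimep_bezout cp.
have E1 : peval C (w * q) + C * peval C (u * 'X^m) = 1.
  rewrite -(peval1 C) -uw addrC pevalD exprSr mulrA pevalMX; congr (_ + _).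
  by rewrite (comm_peval _ (erefl (C * C))).
have E0 : peval C (w * q) * C ^+ m = 0.
  rewrite -[C in C ^+ _]pevalX -pevalXn -pevalM; apply: peval_dvd chiC.
  by rewrite E -mulrA dvdp_mulIr.
exists (w * q), (u * 'X^m), m; split=> //.
have E2 : peval C (w * q) = peval C (w * q) * peval C (w * q) +
    peval C ((w * q) * (u * 'X^(m.+1))).
  by rewrite -pevalM -pevalD -mulrDr addrC uw mulr1.
rewrite [RHS]E2 [X in _ + X](_ : _ = 0) ?addr0 //; apply: peval_dvd chiC.
rewrite E exprSr; have -> : w * q * (u * ('X^m * 'X)) = w * u * 'X * (q * 'X^m) by ring.
exact: dvdp_mulIr.
Qed.

Section Whitehead.
Variables (K : fieldType) (charK : [pchar K] =i pred0).
Variables (V : vectType K) (br : V -> V -> V) (lieV : lie_law br).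
Variable s : {vspace V}.
Hypothesis sub_s : forall x y, x \in s -> y \in s -> br x y \in s.
Hypothesis rad0 : forall I, ideal_of br s I -> solvable_space br I -> I = 0%VS.
Variable W : vectType K.
Implicit Types (rho : 'Hom(V, 'End(W))) (d : 'Hom(V, W)) (E : 'End(W)).

(* Induction on the rank of E, an idempotent cutting out a submodule that
   contains the values of d. *)
Lemma whitehead_rec rho n E d : hom_on br s rho ->
    (\dim (limg E) <= n)%N -> E * E = E ->
    (forall x, x \in s -> rho x * E = E * rho x) ->
    (forall x, x \in s -> E (d x) = d x) ->
    (forall x y, x \in s -> y \in s -> d (br x y) = rho x (d y) - rho y (d x)) ->
  exists w, forall x, x \in s -> d x = rho x w.
Proof.
move=> hom; elim: n E d => [|n IH] E d le EE comm Ed coc.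
  exists 0 => x xs; rewrite linear0 -Ed //; apply/eqP.
  have := memv_img E (memvf (d x)).
  by move: le; rewrite leqn0 dimv_eq0 => /eqP ->; rewrite memv0.
have sc W' := @trace_form_scalar K V W'.
have is_ : ideal_of br s s := ideal_s sub_s.
pose rhoE : 'Hom(V, 'End(W)) := (lmul E \o rho)%VF.
have rE x : rhoE x = E * rho x by rewrite comp_lfunE lmulE.
have homE : hom_on br s rhoE.
  move=> x y xs ys; rewrite !rE hom // mulrBr; congr (_ - _).
    by rewrite mulrA -(mulrA E (rho x) E) comm // !mulrA EE.
  by rewrite mulrA -(mulrA E (rho y) E) comm // !mulrA EE.
have cocE x y : x \in s -> y \in s -> d (br x y) = rhoE x (d y) - rhoE y (d x).
  by move=> xs ys; rewrite !rE -!comm // !endM !Ed ?coc.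
pose a := form_orth (tform rhoE) s s.
have ia : ideal_of br s a by apply: ideal_orth.
have aP x := mem_form_orth (sc _ rhoE) s s x.
have as_ := subvP ia.1.
have ra x : x \in a -> rhoE x = 0.
  apply: (trace_orth_trivial charK lieV rad0 homE ia) => y z /aP[_ y0] /as_.
  exact: y0.
have da x : x \in a -> d x = 0.
  apply: (cocycle_vanish charK lieV rad0 ia) => y z ya za.
  by rewrite cocE ?as_ // !ra // !zero_lfunE subrr.
have [r [e [e' [es B1 d1 d2 r0]]]] := dual_bases (sc _ rhoE) (@tform_sym _ _ _ rhoE) s.
have [req0|rn0] := eqVneq r 0%N.
  by exists 0 => x xs; rewrite linear0 da // (subvP (r0 req0)).
have es1 i : e i \in s by case: (es i).
have es2 i : e' i \in s by case: (es i).
(* The Casimir operator: by duality its trace is [r], nonzero in characteristic 0, so it is not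
   nilpotent. *)
pose C := \sum_i rhoE (e i) * rhoE (e' i).
have trC : etrace C = r%:R.
  rewrite etrace_sum (eq_bigr (fun=> 1)) => [|i _]; last exact: B1.
  by rewrite sumr_const card_ord.
have Cx x : x \in s -> rhoE x * C = C * rhoE x.
  move=> xs; apply/subr0_eq.
  have := @casimir_invariance _ _ _ lieV s sub_s W rhoE 'End(W) r e e'
    (fun u v => rhoE u * rhoE v) a x homE es d1 d2 _ _ _ _ xs.
  move=> H; rewrite -[RHS]H.
  - rewrite /C mulr_sumr mulr_suml -sumrB; apply: eq_bigr => i _.
    rewrite !homE // mulrBl mulrBr addrA !mulrA; congr (_ - _).
    by rewrite subrK.
  - by move=> u c v w; rewrite linearP mulrDr endZr.
  - by move=> v c u w; rewrite linearP mulrDl endZl.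
  - by move=> u v _ va; rewrite (ra v) // mulr0.
  - by move=> u v ua _; rewrite (ra u) // mul0r.
have EC : E * C = C.
  by rewrite /C mulr_sumr; apply: eq_bigr => i _; rewrite !rE !mulrA EE.
have CE : C * E = C.
  rewrite /C mulr_suml; apply: eq_bigr => i _.
  by rewrite !rE -!mulrA comm // !mulrA -[_ * E * E]mulrA EE.
have Crho x : x \in s -> rho x * C = C * rho x.
  by move=> xs; rewrite -{1}EC mulrA comm // -rE Cx // rE mulrA CE.
(* The Casimir tensor applied to the cocycle: [C (d x) = rhoE x v], so wherever [C] is invertible,
   [C^-1 v] is the vector sought. *)
pose v := \sum_i rhoE (e i) (d (e' i)).
have Cd x : x \in s -> C (d x) = rhoE x v.
  move=> xs; apply/esym/subr0_eq.
  have := @casimir_invariance _ _ _ lieV s sub_s W rhoE W r e e'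
    (fun u v => rhoE u (d v)) a x homE es d1 d2 _ _ _ _ xs.
  move=> H; rewrite -[RHS]H.
  - rewrite /C /v linear_sum sum_lfunE -sumrB; apply: eq_bigr => i _.
    rewrite homE // cocE // linearB /= add_lfunE opp_lfunE !endM addrA.
    by rewrite subrK.
  - by move=> u c w w'; rewrite !linearP.
  - by move=> w c u w'; rewrite linearP add_lfunE scale_lfunE.
  - by move=> u w _ wa; rewrite (da w) // linear0.
  - by move=> u w ua _; rewrite (ra u) // zero_lfunE.
have [P [Q [m [PQ PP PC]]]] := fitting_projector C.
pose E0 := peval C P; pose h := peval C Q.
have E0rho x : x \in s -> rho x * E0 = E0 * rho x.
  by move=> xs; rewrite /E0 (comm_peval _ (esym (Crho x xs))).
have hrho x : x \in s -> rho x * h = h * rho x.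
  by move=> xs; rewrite /h (comm_peval _ (esym (Crho x xs))).
have EE0 : E0 * E = E * E0 by apply: comm_peval; rewrite CE EC.
have hE : h * E = E * h by apply: comm_peval; rewrite CE EC.
have Ch : C * h = h * C by apply/esym/comm_peval.
(* [E0] projects onto the generalised kernel of [C]. If [E * E0] had the rank of [E], then [C] would
   be nilpotent, against its trace. *)
have [|||||w wP] := IH (E * E0) (E0 \o d)%VF.
- rewrite -ltnS; apply: leq_trans le; rewrite ltn_neqAle.
  have sub : (limg (E * E0) <= limg E)%VS.
    by rewrite -EE0; apply/subvP => _ /memv_imgP[u _ ->]; rewrite EE0 endM memv_img ?memvf.
  rewrite dimvS // andbT; apply/negP => /eqP dimE.
  have eqE : limg (E * E0) = limg E by apply/eqP; rewrite eqEdim sub dimE leqnn.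
  have E0E : E0 * E = E.
    apply/lfunP => u; have : E u \in limg (E * E0) by rewrite eqE memv_img ?memvf.
    case/memv_imgP => u' _ Eu; rewrite endM Eu -!endM; congr (_ u').
    by rewrite mulrA EE0 -mulrA PP.
  have Cm : C ^+ m.+1 = 0.
    rewrite exprSr -{2}EC mulrA -E0E mulrA -[X in X * E * C](comm_peval P).
      by rewrite PC !mul0r.
    by rewrite -exprS exprSr.
  have := etrace_nilpotent Cm; rewrite trC => /eqP.
  by move/(pcharf0P K): (charK) => ->; rewrite (negPf rn0).
- by rewrite mulrA -[E * E0 * E]mulrA EE0 mulrA EE -mulrA PP.
- by move=> x xs; rewrite mulrA comm // -mulrA E0rho // mulrA.
- by move=> x xs; rewrite comp_lfunE -endM -mulrA PP -EE0 endM Ed.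
- move=> x y xs ys; rewrite !comp_lfunE coc // linearB /= -!endM.
  by rewrite E0rho // E0rho.
(* The part of [d] cut out by [E0] comes from the induction; on the complement, [h] inverts [C]. *)
exists (w + E (h v)) => x xs; rewrite linearD /= -wP // comp_lfunE.
rewrite -{1}[d x]end1 -PQ add_lfunE; congr (_ + _).
rewrite Ch endM Cd // rE -!endM; congr (_ v).
by rewrite -(comm x xs) !mulrA -(hrho x xs) -!mulrA hE.
Qed.

Lemma whitehead rho d : hom_on br s rho ->
    (forall x y, x \in s -> y \in s -> d (br x y) = rho x (d y) - rho y (d x)) ->
  exists w, forall x, x \in s -> d x = rho x w.
Proof.
move=> hom; apply: (whitehead_rec (E := 1)) (leqnn _) _ _ _ => //.
- exact: mulr1.
- by move=> x _; rewrite mulr1 mul1r.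
- by move=> x _; rewrite end1.
Qed.

End Whitehead.

(** * Derivations *)

Section AdJordan.
Variables (K : fieldType) (charK : [pchar K] =i pred0).
Variables (V : vectType K) (br : V -> V -> V) (lieV : lie_law br).
Implicit Types (d t g : 'End(V)).

Lemma derivation_bracket d x : is_derivation br d ->
  d * ad br x - ad br x * d = ad br (d x).
Proof.
move=> dd; apply/lfunP => y; rewrite add_lfunE opp_lfunE !endM !adE // dd.
by rewrite addrK.
Qed.

Lemma bracket_derivation d : (forall x, d * ad br x - ad br x * d = ad br (d x)) ->
  is_derivation br d.
Proof.
move=> H x y; have := congr1 (fun f : 'End(V) => f y) (H x).
by rewrite /= add_lfunE opp_lfunE !endM !adE // => <-; rewrite subrK.
Qed.

Lemma derivation_ad x : is_derivation br (ad br x).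
Proof.
by apply: bracket_derivation => y; rewrite -(adM lieV) adE.
Qed.

Lemma derivation_gl d d' : is_derivation br d -> is_derivation br d' ->
  is_derivation br (d * d' - d' * d).
Proof.
move=> dd dd'; apply: bracket_derivation => x.
have D e y : is_derivation br e -> gl_law e (ad br y) = ad br (e y).
  exact: derivation_bracket.
have := br_jacobi (@lie_gl K V) d d' (ad br x); rewrite (D d') // (D d) // (D d x) // (D d') // => J.
apply: (addIr (ad br (d' (d x)))); transitivity (ad br (d (d' x))).
  exact: esym J.
rewrite -!(lad_ad lieV) -linearD.
by rewrite add_lfunE opp_lfunE !endM subrK.
Qed.

(* The semisimple part of ad x, as a polynomial without constant term in
   ad x; the same polynomial computes its commutator action on End(V). *)
Lemma ad_jordan_poly x t : jordan_semisimple_part (ad br x) t ->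
  exists S : {poly K}, t = peval (ad br x) (S * 'X) /\
    bracket_by t = peval (bracket_by (ad br x)) (S * 'X).
Proof.
case=> n [E tn st [m nm]]; have {}tn : t * n = n * t := tn.
have nm0 : n ^+ m = 0 by apply/lfunP => v; rewrite endX nm zero_lfunE.
have sst := semisimple_ssep charK st.
have [p sp pt] := sst; have [q sq qt] := ssep_bracket_by charK sst.
have [u [su pu qu]] := separable_lcm sp sq.
(* Putting the factor ['X] into the modulus forces ['X %| S], so the polynomial has no constant
   term; the exponent [m + m] suits both [n] and its commutator map. *)
have [w [sw uw Xw]] : exists w : {poly K}, [/\ separable_poly w, u %| w & 'X %| w].
  apply: separable_lcm su _.
  by have := separable_prod_XsubC [:: 0 : K]; rewrite big_seq1 polyC0 subr0.
have [S [wS wmS]] := newton_poly (m + m) sw.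
have /dvdpP[S' ES] : 'X %| S.
  by rewrite -(subrK 'X S) dvdp_add // (dvdp_trans Xw).
exists S'; rewrite -ES; split.
  apply: (jordan_polyE charK E tn (m := m + m)) (sw) _ wS wmS.
    by rewrite exprD nm0 mul0r.
  by apply: peval_dvd pt; apply: dvdp_trans uw.
apply: (jordan_polyE charK (n := bracket_by n) (m := m + m)) (sw) _ wS wmS.
- by rewrite E bracket_byD.
- exact: bracket_by_comm.
- exact: bracket_by_nilp.
by apply: peval_dvd qt; apply: dvdp_trans uw.
Qed.

(** Everything comes from [t] and [[t, .]] being one polynomial without constant term in [ad x] and
    [[ad x, .]]: the latter sends [ad y] to [ad [x, y]], which makes [t] a derivation, and sends
    every derivation to an inner one. *)
Lemma ad_semisimple_facts x t : jordan_semisimple_part (ad br x) t ->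
  [/\ ssep t, is_derivation br t,
      forall v i, iter i (br x) v = 0 -> t v = 0,
      forall U : {vspace V}, (forall u, u \in U -> br x u \in U) ->
        forall u, u \in U -> t u \in U
    & (forall g, ad br x * g = g * ad br x -> t * g = g * t) /\
      forall d, is_derivation br d -> exists w, t * d - d * t = ad br w].
Proof.
move=> jt; have [S [tS DtS]] := ad_jordan_poly jt.
have [n [_ _ st _]] := jt; have sst := semisimple_ssep charK st.
set f := ad br x in tS DtS *.
split=> //.
- apply: bracket_derivation => y; rewrite -bracket_byE DtS -(lad_ad lieV y) tS.
  have H v : lad br (f v) = bracket_by f (lad br v).
    by rewrite !(lad_ad lieV) bracket_byE -(adM lieV) adE.
  by rewrite -(peval_intertwine _ H) (lad_ad lieV).
- move=> v i xv; apply: (@ssep_nilp _ _ t v i) => //.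
  rewrite -endX tS -pevalXn exprMn pevalM pevalXn pevalXn pevalX endM [(f ^+ i) v]endX.
  by rewrite (eq_iter (adE lieV x)) xv linear0.
- move=> U xU; rewrite tS; apply: peval_stable => u uU.
  by rewrite adE ?xU.
- split=> [g fg|d dd]; first by rewrite tS; exact: comm_peval.
  suff /(mem_ad_space lieV)[w _ E] : bracket_by t d \in ad_space br fullv.
    by exists w; rewrite -E bracket_byE.
  rewrite DtS pevalMX endM; apply: peval_stable => [g /(mem_ad_space lieV)[y _ ->]|].
    by apply/(mem_ad_space lieV); exists (br x y); rewrite ?memvf // bracket_byE -(adM lieV).
  rewrite bracket_byE -opprB derivation_bracket // memvN.
  by apply/(mem_ad_space lieV); exists (d x); rewrite ?memvf.
Qed.

(** Modulo [U'] the semisimple part [t] vanishes on [U], so [ad x] acts there as its nilpotent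
    part. *)
Lemma nilpotent_mod x t (U U' : {vspace V}) : jordan_semisimple_part (ad br x) t ->
    (forall u, u \in U -> br x u \in U) -> (forall u, u \in U -> t u \in U') ->
    (forall u, u \in U' -> br x u \in U') -> (U' <= U)%VS ->
  forall u, u \in U -> exists i, iter i (br x) u \in U'.
Proof.
case=> n [E tn _ [m nm]] xU tU xU' /subvP U'U u uU; exists m.
have nE v : n v = br x v - t v by rewrite -(adE lieV) E add_lfunE addrC addKr.
have nU i : iter i n u \in U.
  by elim: i => //= i IH; rewrite nE memvB ?xU // U'U ?tU.
suff H i : iter i (br x) u - iter i n u \in U'.
  by have := H m; rewrite nm subr0.
elim: i => [|i IH] /=; first by rewrite subrr mem0v.
rewrite nE opprB addrCA addrC -(brBr lieV) memvD ?tU ?xU' //.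
Qed.

End AdJordan.

(** * Stability of the radical under derivations *)

Section Radical.
Variables (K : fieldType) (charK : [pchar K] =i pred0).
Variables (V : vectType K) (br : V -> V -> V) (lieV : lie_law br).
Variables (d : 'End(V)) (dd : is_derivation br d).
Implicit Types (r I U : {vspace V}).

Lemma leibniz n x y : iter n d (br x y) =
  \sum_(i < n.+1) br (iter i d x) (iter (n - i) d y) *+ 'C(n, i).
Proof.
elim: n => [|n IH]; first by rewrite big_ord1 /= mulr1n.
rewrite iterS IH linear_sum /=.
under eq_bigr => i _ do rewrite linearMn /= dd mulrnDl.
rewrite big_split /= [RHS]big_ord_recl bin0 subn0 /=.
under [in RHS]eq_bigr => i _ do rewrite binS mulrnDr.
rewrite big_split /= [X in _ = _ + (X + _)]big_ord_recr /= bin_small // mulr0n addr0.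
rewrite [X in _ + X = _]big_ord_recl bin0 subn0 /= addrCA [X in _ + X]addrC.
congr (_ + (_ + _)); apply: eq_bigr => i _; rewrite /bump /= ?add1n subSS //.
by rewrite -(subnSK (ltn_ord i)) iterS.
Qed.

(** [J = r + d(r)] is an ideal, so it suffices that it be solvable. Writing [r_k] and [J_k] for
    derived terms and [N = 2^k], one shows that [J_k] lies in [r + d^N(r_k)]. In the Leibniz
    expansion of [d^(2N) [x', y']] with [x', y'] in [r_k], all terms but the middle one lie in [r],
    and the middle binomial coefficient is invertible in characteristic 0. *)
Lemma derivation_radical r : is_radical br r -> forall x, x \in r -> d x \in r.
Proof.
move=> [[idr [K0 rK]] maxr].
have rl x y : y \in r -> br x y \in r.
  by move=> yr; apply: (lie_prod_subP lieV _ _ _ idr) => //; exact: memvf.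
have rr x y : x \in r -> br x y \in r.
  by move=> xr; rewrite (brC lieV) memvN rl.
have char0 : forall n, (n%:R == 0 :> K) = (n == 0%N) by exact/(pcharf0P K).
pose dn n : 'End(V) := d ^+ n.
have subr : subalgebra br r.
  by apply/(lie_prod_subP lieV) => x y _; exact: rl.
have dsub k x : x \in derived br k r -> x \in r by exact/subvP/(derived_sub lieV).
(* Of two indices whose sum is below [2 ^ k.+1], one is below [2 ^ k]. *)
have low k : forall i x, (i < 2 ^ k)%N -> x \in derived br k r -> iter i d x \in r.
  elim: k => [|k IH] i x.
    by rewrite expn0 ltnS leqn0 => /eqP ->.
  move=> lt xk; rewrite -endX memv_preim; move: x xk; apply/subvP.
  apply/(lie_prod_subP lieV) => x y xk yk; rewrite -memv_preim endX leibniz.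
  apply: memv_suml => j _; rewrite -scaler_nat memvZ //.
  have [lj|gj] := ltnP j (2 ^ k); first by rewrite rr ?IH.
  by rewrite rl ?IH // ltn_subLR ?(leq_trans lt) ?expnS ?mul2n -?addnn ?leq_add2r // -ltnS.
pose J := (r + d @: r)%VS.
have JP x : x \in J <-> exists2 u, u \in r & exists2 v, v \in r & x = u + d v.
  split=> [/memv_addP[u ur [_ /memv_imgP[v vr ->] ->]]|[u ur [v vr ->]]].
    by exists u => //; exists v.
  by rewrite memv_add ?memv_img.
have derJ k : (derived br k J <= r + dn (2 ^ k)%N @: derived br k r)%VS.
  elim: k => [|k IH]; first by rewrite /dn expn0 expr1.
  apply/(lie_prod_subP lieV) => x y /(subvP IH)/memv_addP[u ur [_ /memv_imgP[x' x'k ->] ->]].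
  move=> /(subvP IH)/memv_addP[v vr [_ /memv_imgP[y' y'k ->] ->]].
  rewrite (brDl lieV) memvD //; first exact: (subvP (addvSl _ _)) (rr _ _ ur).
  rewrite (brDr lieV) memvD //; first exact: (subvP (addvSl _ _)) (rl _ _ vr).
  pose N := (2 ^ k)%N; rewrite !endX -/N.
  have EN : (2 ^ k.+1)%N = (N + N)%N by rewrite expnS mul2n addnn.
  have C0 : 'C(N + N, N)%:R != 0 :> K.
    by rewrite char0 -lt0n bin_gt0 leq_addr.
  have H : iter (N + N) d (br x' y') - br (iter N d x') (iter N d y') *+ 'C(N + N, N) \in r.
    have lN : (N < (N + N).+1)%N by rewrite ltnS leq_addr.
    rewrite leibniz (bigD1 (Ordinal lN)) //= addnK addrC addrK.
    apply: memv_suml => j jN; rewrite -scaler_nat memvZ //.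
    have [lj|gj] := ltnP j N; first by apply: rr; exact: low lj x'k.
    apply: rl; apply: low y'k; rewrite ltn_subLR; last by rewrite -ltnS ltn_ord.
    rewrite ltn_add2r ltn_neqAle gj andbT.
    by apply: contra_neq jN => E; apply: val_inj.
  rewrite -[br _ _](scalerK C0) scaler_nat memvZ //; move: H.
  set A := iter _ _ _; set w := _ *+ _ => H.
  rewrite (_ : w = A - (A - w)); last by rewrite opprB addrC subrK.
  rewrite memvB ?(subvP (addvSl _ _) _ H) //; apply: (subvP (addvSr _ _)).
  by rewrite /A -endX -EN memv_img //; exact: mem_lie_prod.
have solJ : solvable_space br J.
  exists (K0 + K0)%N; apply/eqP; rewrite -subv0 -/(derived br _ J) derivedD -rK.
  apply: (derivedS lieV); apply: subv_trans (derJ K0) _.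
  by rewrite subv_add subvv /derived rK limg0 sub0v.
have idJ : ideal br J.
  apply/(lie_prod_subP lieV) => x y _ /JP[u ur [v vr ->]].
  rewrite (brDr lieV); apply/JP.
  exists (br x u - br (d x) v); first by rewrite memvB ?rl.
  by exists (br x v); rewrite ?rl // dd addrA subrK.
move=> x xr; apply: (subvP (maxr J (conj idJ solJ))); apply/JP.
by exists 0; rewrite ?mem0v //; exists x; rewrite ?add0r.
Qed.

End Radical.

(** * The Gamma-triple *)

Section GammaStructure.
Variables (K : fieldType) (charK : [pchar K] =i pred0).
Variables (V : vectType K) (br : V -> V -> V) (lieV : lie_law br).
Variable Gamma : {vspace 'End(V)}.
Hypothesis semisimple_Gamma : semisimple_action Gamma.
Variables (s k m : {vspace V}) (triple : is_Gamma_triple br Gamma s k m).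
Hypothesis mu_inj : injective (mu br k m).
Implicit Types (d g t : 'End(V)) (x y z v w : V).

Let r := (m + k)%VS.

Lemma triple_radical : is_radical br r.
Proof. by case: triple => [[r' [R _ E _]]] _ _ _ _; rewrite /r -E. Qed.
Lemma triple_levi : is_levi br r s.
Proof. by case: triple => [[r' [_ L E _]]] _ _ _ _; rewrite /r -E. Qed.
Lemma triple_direct_mk : (m :&: k = 0)%VS.
Proof. by case: triple => [[r' [_ _ _ /directv_addP]]]. Qed.
Lemma triple_full : (s + k + m)%VS = fullv.
Proof. by case: triple => _ _ _ []. Qed.
Lemma s_cap_r : (s :&: r = 0)%VS.
Proof. by case: triple_levi => _ _ /directv_addP. Qed.

Lemma br_ss x y : x \in s -> y \in s -> br x y \in s.
Proof. by case: triple_levi => /(lie_prod_subP lieV) H _ _; exact: H. Qed.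
Lemma br_kk x y : x \in k -> y \in k -> br x y \in k.
Proof. by case: triple => _ [/(lie_prod_subP lieV) H _ _] _ _ _; exact: H. Qed.
Lemma br_sk x y : x \in s -> y \in k -> br x y = 0.
Proof.
case: triple => _ [_ _ sk0] _ _ _ xs yk; apply/eqP; rewrite -memv0 -sk0.
exact: mem_lie_prod.
Qed.
Lemma br_ks x y : x \in k -> y \in s -> br x y = 0.
Proof. by move=> xk ys; rewrite (brC lieV) br_sk ?oppr0. Qed.
Lemma lie_prod_skm : lie_prod br (s + k) m = m.
Proof. by case: triple. Qed.
Lemma br_sm x y : x \in s -> y \in m -> br x y \in m.
Proof.
move=> xs ym; rewrite -lie_prod_skm; apply: mem_lie_prod => //.
exact: (subvP (addvSl _ _)).
Qed.
Lemma br_km x y : x \in k -> y \in m -> br x y \in m.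
Proof.
move=> xk ym; rewrite -lie_prod_skm; apply: mem_lie_prod => //.
exact: (subvP (addvSr _ _)).
Qed.
Lemma br_r x y : y \in r -> br x y \in r.
Proof.
case: triple_radical => [[/(lie_prod_subP lieV) H _] _] yr.
by apply: H; rewrite ?memvf.
Qed.
Lemma br_rl x y : x \in r -> br x y \in r.
Proof. by move=> xr; rewrite (brC lieV) memvN br_r. Qed.
Lemma m_sub_r x : x \in m -> x \in r.
Proof. exact/subvP/addvSl. Qed.

Lemma adD x y : ad br (x + y) = ad br x + ad br y.
Proof. by have := linear_ad lieV 1 x y; rewrite !scale1r. Qed.

Lemma decomp v : exists x y z, [/\ x \in s, y \in k, z \in m & v = x + y + z].
Proof.
have : v \in (s + k + m)%VS by rewrite triple_full memvf.
case/memv_addP => _ /memv_addP[x xs [y yk ->]] [z zm ->].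
by exists x, y, z.
Qed.

Lemma decomp0 x y z : x \in s -> y \in k -> z \in m -> x + y + z = 0 ->
  [/\ x = 0, y = 0 & z = 0].
Proof.
move=> xs yk zm E.
have x0 : x = 0.
  apply/eqP; rewrite -memv0 -s_cap_r memv_cap xs /=.
  move/eqP: E; rewrite -addrA addr_eq0 => /eqP ->; rewrite memvN addrC.
  exact: memv_add.
move: E; rewrite x0 add0r => /eqP; rewrite addr_eq0 => /eqP E.
have y0 : y = 0.
  by apply/eqP; rewrite -memv0 -triple_direct_mk memv_cap {1}E memvN zm.
by split=> //; move: E; rewrite y0 => /esym/eqP; rewrite oppr_eq0 => /eqP.
Qed.

(** [I + r] is a solvable ideal of the whole algebra, hence contained in [r], and [s] meets [r]
    trivially. *)
Lemma levi_rad0 I : ideal_of br s I -> solvable_space br I -> I = 0%VS.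
Proof.
move=> [Is idI] [n nI]; apply/eqP; rewrite -subv0 -s_cap_r subv_cap Is /=.
have [_ sr _] := triple_levi; have [[_ [n' nr]] maxr] := triple_radical.
pose J := (I + r)%VS; suff solJ : solvable_space br J.
  apply: subv_trans (addvSl I r) (maxr J (conj _ solJ)).
  apply/(lie_prod_subP lieV) => x y; rewrite -sr => /memv_addP[a as_ [b br' ->]].
  move=> /memv_addP[c cI [d dr ->]]; rewrite (brDr lieV) !(brDl lieV) -addrA memv_add ?idI //.
  by apply: memvD; [exact: br_rl | apply: memvD; exact: br_r].
have H i : (derived br i J <= derived br i I + r)%VS.
  elim: i => [|i IH] //=; apply/(lie_prod_subP lieV) => x y.
  move=> /(subvP IH)/memv_addP[a aI [b br' ->]] /(subvP IH)/memv_addP[c cI [d dr ->]].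
  rewrite (brDr lieV) !(brDl lieV) -addrA memv_add //; first exact: mem_lie_prod.
  by apply: memvD; [exact: br_rl | apply: memvD; exact: br_r].
exists (n' + n)%N; apply/eqP; rewrite -subv0 -nr -/(derived br _ J) derivedD.
apply: (derivedS lieV); apply: subv_trans (H n) _.
by rewrite /derived nI add0v.
Qed.

Lemma T_exists : exists T : {vspace 'End(V)},
  [/\ forall f, f \in T <-> ad_semisimple_parts br k f
    & Gamma = (ad_space br s + T)%VS].
Proof. by case: triple => _ _ _ _ [T [H1 H2 _]]; exists T. Qed.

Lemma GammaP g : g \in Gamma -> exists y t x,
  [/\ y \in s, x \in k, jordan_semisimple_part (ad br x) t & g = ad br y + t].
Proof.
have [T [TP ->]] := T_exists.
case/memv_addP => _ /(mem_ad_space lieV)[y ys ->] [t /TP[x xk xt] ->].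
by exists y, t, x.
Qed.

Lemma ad_Gamma y : y \in s -> ad br y \in Gamma.
Proof.
have [T [_ ->]] := T_exists => ys; apply: (subvP (addvSl _ _)).
by apply/(mem_ad_space lieV); exists y.
Qed.

Lemma T_Gamma x t : x \in k -> jordan_semisimple_part (ad br x) t -> t \in Gamma.
Proof.
have [T [TP ->]] := T_exists => xk xt; apply: (subvP (addvSr _ _)).
by apply/TP; exists x.
Qed.

Lemma Gamma_ind (P : 'End(V) -> Prop) :
  (forall f g, P f -> P g -> P (f + g)) -> (forall y, y \in s -> P (ad br y)) ->
  (forall x t, x \in k -> jordan_semisimple_part (ad br x) t -> P t) ->
  forall g, g \in Gamma -> P g.
Proof.
move=> PD Ps Pt g /GammaP[y [t [x [ys xk xt ->]]]].
by apply: PD; [exact: Ps | exact: Pt xt].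
Qed.

Lemma k_nilp x y : x \in k -> y \in k -> exists i, iter i (br x) y = 0.
Proof.
move=> xk yk; case: triple => _ [_ [n nk] _] _ _ _; exists n; apply/eqP.
rewrite -memv0 -nk; elim: n {nk} => //= n IH; exact: mem_lie_prod.
Qed.

Let facts x t (xt : jordan_semisimple_part (ad br x) t) :=
  ad_semisimple_facts charK lieV xt.

Lemma Gamma_derivation g : g \in Gamma -> is_derivation br g.
Proof.
move: g; apply: (Gamma_ind (P := is_derivation br)) => [f h df dh x y|y _|x t _ xt].
- by rewrite !add_lfunE df dh (brDl lieV) (brDr lieV) addrACA.
- exact: derivation_ad.
- by case: (facts xt).
Qed.

(** [s] commutes with [k], and each [ad y] with [y] in [k] is nilpotent on [k], so its semisimple
    part vanishes there. *)
Lemma Gamma_k g x : g \in Gamma -> x \in k -> g x = 0.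
Proof.
move=> + xk; move: g; apply: (Gamma_ind (P := fun g => g x = 0)) => [f h f0 h0|y ys|y t yk yt].
- by rewrite add_lfunE f0 h0 addr0.
- by rewrite adE // br_sk.
- have [i yx] := k_nilp yk xk; have [_ _ H _ _] := facts yt; exact: H yx.
Qed.

Lemma Gamma_s g x : g \in Gamma -> x \in s -> g x \in s.
Proof.
move=> + xs; move: g; apply: (Gamma_ind (P := fun g => g x \in s)) => [f h f0 h0|y ys|y t yk yt].
- by rewrite add_lfunE memvD.
- by rewrite adE // br_ss.
- have [_ _ H _ _] := facts yt; rewrite (H x 1%N) ?mem0v //=; exact: br_ks.
Qed.

Lemma Gamma_m g z : g \in Gamma -> z \in m -> g z \in m.
Proof.
move=> + zm; move: g; apply: (Gamma_ind (P := fun g => g z \in m)) => [f h f0 h0|y ys|y t yk yt].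
- by rewrite add_lfunE memvD.
- by rewrite adE // br_sm.
- by have [_ _ _ H _] := facts yt; apply: H zm => u; exact: br_km.
Qed.

Lemma Gamma_ad_k g x : g \in Gamma -> x \in k -> g * ad br x = ad br x * g.
Proof.
move=> gG xk; apply/subr0_eq.
rewrite (derivation_bracket lieV) ?Gamma_k //; last exact: Gamma_derivation.
by rewrite -(lad_ad lieV) linear0.
Qed.

Definition Gamma_span : {vspace V} :=
  <<[seq g z | g : 'End(V) <- vbasis Gamma, z <- vbasis m]>>%VS.

Lemma mem_Gamma_span g z : g \in Gamma -> z \in m -> g z \in Gamma_span.
Proof.
move=> gG zm; rewrite (coord_vbasis gG) (coord_vbasis zm) sum_lfunE.
apply: memv_suml => i _; rewrite scale_lfunE memvZ // linear_sum.
apply: memv_suml => j _; rewrite linearZ memvZ //; apply: memv_span.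
by apply/allpairsP; exists ((vbasis Gamma)`_i, (vbasis m)`_j);
  rewrite !mem_nth ?size_tuple.
Qed.

Lemma Gamma_span_sub (X : {vspace V}) :
  (forall g z, g \in Gamma -> z \in m -> g z \in X) -> (Gamma_span <= X)%VS.
Proof.
move=> H; apply/span_subvP => _ /allpairsP[[g z] /= [gG zm ->]].
by apply: H; exact: vbasis_mem.
Qed.

(** Otherwise [k] acts nilpotently on the nonzero quotient of [m] by [Gamma_span], the semisimple
    parts being zero on it. Engel's theorem puts [[k, m]] into a proper [X] that also contains
    [[s, m]], against [[s + k, m] = m]. *)
Lemma Gamma_span_m : Gamma_span = m.
Proof.
have sub : (Gamma_span <= m)%VS by apply: Gamma_span_sub => g z; exact: Gamma_m.
have [//|ne] := classic (Gamma_span = m).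
have kstab x u : x \in k -> u \in Gamma_span -> br x u \in Gamma_span.
  move=> xk uG; have : ad br x u \in Gamma_span.
    rewrite memv_preim; move: u uG; apply/subvP; apply: Gamma_span_sub => g z gG zm.
    rewrite -memv_preim -endM -Gamma_ad_k // endM mem_Gamma_span // adE //.
    exact: br_km.
  by rewrite adE.
have [||||X [GX Xm nXm kX]] := @engel_proper K V br lieV k br_kk k_nilp V (lad br)
    Gamma_span m _ sub ne.
- by move=> x y _ _; rewrite !(lad_ad lieV) (adM lieV).
- by move=> x u; rewrite ladE //; exact: br_km.
- by move=> x u; rewrite ladE //; exact: kstab.
- move=> x u xk um; have [t xt] := jordan_exists charK (ad br x).
  have [i ii] := nilpotent_mod lieV xt (fun u => br_km xk)
    (fun u um => mem_Gamma_span (T_Gamma xk xt) um) (fun u => kstab x u xk) sub um.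
  by exists i; rewrite (eq_iter (ladE lieV x)).
case: nXm; apply/eqP; rewrite eqEsubv Xm -{1}lie_prod_skm.
apply/(lie_prod_subP lieV) => _ z /memv_addP[y ys [x xk ->]] zm.
rewrite (brDl lieV) memvD //.
  by apply: (subvP GX); rewrite -(adE lieV) mem_Gamma_span ?ad_Gamma.
by rewrite -(ladE lieV) kX.
Qed.

(** [Gamma] respects s + k + m, so each component of [v] is fixed. The component in [s] spans an
    abelian ideal of [s], hence is zero. A [Gamma]-stable complement of the fixed space contains all
    values of [Gamma], hence [m], so the component in [m] is zero too. *)
Lemma Gamma_fixed v : (forall g, g \in Gamma -> g v = 0) -> v \in k.
Proof.
have [x [y [z [xs yk zm ->]]]] := decomp v => fix_v.
have gxz g : g \in Gamma -> g x = 0 /\ g z = 0.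
  move=> gG; have := fix_v g gG; rewrite !linearD /= (Gamma_k gG yk).
  by case/(decomp0 (Gamma_s gG xs) (mem0v k) (Gamma_m gG zm)).
have x0 : x = 0.
  have xs0 y' : y' \in s -> br y' x = 0.
    by move=> ys; have [] := gxz _ (ad_Gamma ys); rewrite adE.
  have : <[x]>%VS = 0%VS.
    apply: levi_rad0.
      split=> [|u _ us /vlineP[c ->]]; first by rewrite -memvE.
      by rewrite (brZr lieV) xs0 // scaler0 mem0v.
    exists 1%N; apply/eqP; rewrite -subv0; apply/(lie_prod_subP lieV).
    by move=> _ _ /vlineP[c ->] /vlineP[c' ->]; rewrite (brZl lieV) (brZr lieV)
      (brxx lieV) !scaler0 mem0v.
  by move=> l0; apply/eqP; rewrite -memv0 -l0 memv_line.
pose F : {vspace V} := vspace_of (fun v => forall g, g \in Gamma -> g v = 0).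
have FP u : u \in F <-> forall g, g \in Gamma -> g u = 0.
  apply: (mem_vspace_of (P := fun v => forall g, g \in Gamma -> g v = 0)).
  split=> [g _|c u1 u2 f1 f2 g gG]; first exact: linear0.
  by rewrite linearP /= f1 // f2 // scaler0 addr0.
have [|C stC [FC /directv_addP capC]] := semisimple_Gamma (U := F).
  move=> g gG; apply/subvP => _ /memv_imgP[u /FP uF ->].
  by rewrite uF ?mem0v.
have mC : (m <= C)%VS.
  rewrite -Gamma_span_m; apply: Gamma_span_sub => g u gG um.
  have : u \in (F + C)%VS by rewrite FC memvf.
  case/memv_addP => u1 /FP u1F [u2 u2C ->].
  by rewrite linearD /= u1F // add0r (subvP (stC _ gG)) ?memv_img.
have z0 : z = 0.
  apply/eqP; rewrite -memv0 -capC memv_cap (subvP mC) // andbT.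
  by apply/FP => g /gxz[].
by rewrite x0 z0 add0r addr0.
Qed.

(** A central vector is killed by [ad s] and by all the semisimple parts, hence lies in [k], where
    injectivity of [mu] applies. *)
Lemma center0 v : (forall w, br v w = 0) -> v = 0.
Proof.
move=> v0; have vk : v \in k.
  apply: Gamma_fixed; apply: (Gamma_ind (P := fun g => g v = 0)) => [f h f0 h0|y _|x t _ xt].
  - by rewrite add_lfunE f0 h0 addr0.
  - by rewrite adE // (brC lieV) v0 oppr0.
  - by have [_ _ H _ _] := facts xt; apply: (H v 1%N); rewrite /= (brC lieV) v0 oppr0.
have km : (lie_prod br k m <= m)%VS by apply/(lie_prod_subP lieV) => x y; exact: br_km.
rewrite -(vsprojK vk); have -> : vsproj k v = 0; last by rewrite linear0.
apply: mu_inj; rewrite linear0; apply/lfunP => z; apply: val_inj.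
by rewrite /= zero_lfunE (muE lieV) // vsprojK // v0.
Qed.

Lemma ad_inj x y : ad br x = ad br y -> x = y.
Proof.
move=> E; apply/subr0_eq/center0 => w.
by rewrite (brBl lieV) -!(adE lieV) E subrr.
Qed.

Section Centralizer.
Variables (d : 'End(V)) (dd : is_derivation br d).
Hypothesis dG : forall g, g \in Gamma -> d * g = g * d.

Lemma centralizer_s x : x \in s -> d x = 0.
Proof.
move=> xs; apply: ad_inj; rewrite -(derivation_bracket lieV) // dG ?ad_Gamma //.
by rewrite subrr -(lad_ad lieV) linear0.
Qed.

Lemma centralizer_k x : x \in k -> d x \in k.
Proof.
move=> xk; apply: Gamma_fixed => g gG.
by rewrite -endM -dG // endM (Gamma_k gG xk) linear0.
Qed.

(** On [m = Gamma m] one has [d (g z) = g (d z)]; as [d z] stays in the radical m + k and [g] kills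
    [k], the value is in [m]. *)
Lemma centralizer_m z : z \in m -> d z \in m.
Proof.
move=> zm; rewrite memv_preim; move: z zm; apply/subvP.
rewrite -{1}Gamma_span_m; apply: Gamma_span_sub => g z gG zm.
rewrite -memv_preim -endM dG // endM.
have /memv_addP[a am [b bk ->]] := derivation_radical charK lieV dd triple_radical (m_sub_r zm).
by rewrite linearD /= (Gamma_k gG bk) addr0 Gamma_m.
Qed.

End Centralizer.

Lemma ad_k_centralizes x g : x \in k -> g \in Gamma -> ad br x * g = g * ad br x.
Proof. by move=> xk gG; rewrite Gamma_ad_k. Qed.

(* Whitehead's lemma reduces to derivations killing s; on these each
   t in T is removed by the Fitting decomposition of [t, .], whose image
   consists of inner derivations. *)
Lemma derivation_split d : is_derivation br d ->
  exists w, is_derivation br (d - ad br w) /\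
    forall g, g \in Gamma -> (d - ad br w) * g = g * (d - ad br w).
Proof.
move=> dd.
have derB d1 w : is_derivation br d1 -> is_derivation br (d1 - ad br w).
  move=> d1d x y; rewrite !add_lfunE !opp_lfunE !d1d (derivation_ad lieV w).
  by rewrite (brBl lieV) (brBr lieV) opprD addrACA.
(* On [s] a derivation is a cocycle for the adjoint action on [V]. *)
have [w0 w0P] : exists w, forall x, x \in s -> d x = lad br x w.
  apply: (whitehead charK lieV br_ss levi_rad0); first exact: hom_lad.
  by move=> x y _ _; rewrite !(ladE lieV) dd addrC (brC lieV (d x)).
have [T [TP GE]] := T_exists.
pose good (l : seq 'End(V)) := exists w, forall g,
  (exists2 y, y \in s & g = ad br y) \/ g \in l ->
  (d - ad br w) * g = g * (d - ad br w).
have good0 : good [::].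
  exists (- w0) => g [[y ys ->]|//]; apply/subr0_eq.
  rewrite (derivation_bracket lieV) //; last exact: derB.
  rewrite add_lfunE opp_lfunE w0P // (ladE lieV) adE // (brNl lieV) opprK.
  by rewrite (brC lieV w0) subrr -(lad_ad lieV) linear0.
have goodT l : {subset l <= T} -> good l.
  elim: l => [//|t l IH] lT.
  have lT' : {subset l <= T} by move=> g gl; apply: lT; rewrite inE gl orbT.
  have [w wP] := IH lT'.
  have tT : t \in T by rewrite lT ?mem_head.
  have [x xk xt] := (TP t).1 tT.
  have [st td _ _ [tcomm tinner]] := facts xt.
  have tG := T_Gamma xk xt.
  pose cond g := (exists2 y, y \in s & g = ad br y) \/ g \in l.
  have tc g : cond g -> t * g = g * t.
    case=> [[y ys ->]|gl]; apply: tcomm.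
      apply/subr0_eq; rewrite -(adM lieV) br_ks // -(lad_ad lieV); exact: linear0.
    have [y yk yt] := (TP g).1 (lT' g gl).
    by rewrite ad_k_centralizes //; exact: T_Gamma yt.
  (* [X] records the commutations already achieved; it is stable under [[t, .]] because [t] commutes
     with [ad s] and with the elements of [l]. *)
  pose X := vspace_of (fun e : 'End(V) => is_derivation br e /\
    forall g, cond g -> e * g = g * e).
  have XP e : e \in X <-> is_derivation br e /\ forall g, cond g -> e * g = g * e.
    apply: (mem_vspace_of (P := fun e : 'End(V) => _ /\ _)).
    have [D0 DD] := submod_derivation lieV; split.
      by split=> // g _; rewrite mul0r mulr0.
    move=> a e' f [de ce] [df cf]; split=> [|g cg]; first exact: DD.
    by rewrite mulrDl mulrDr endZl endZr ce // cf.
  have D2 e : bracket_by t (bracket_by t e) = 0 -> bracket_by t e = 0.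
    by move=> h; exact: ssep_ker2 (ssep_bracket_by charK st) h.
  have DX e : e \in X -> bracket_by t e \in X.
    move=> /XP[de ce]; apply/XP; rewrite bracket_byE; split.
      exact: derivation_gl.
    move=> g cg; rewrite mulrBl mulrBr; congr (_ - _).
      by rewrite -mulrA (ce g cg) mulrA (tc g cg) mulrA.
    by rewrite -mulrA (tc g cg) [RHS]mulrA -(ce g cg) mulrA.
  have eX : d - ad br w \in X by apply/XP; split=> [|g]; [exact: derB | exact: wP].
  have [e0 [e1 [/XP[_ e0c] /XP[de1 _] te0 E]]] := fitting D2 DX eX.
  have [w' w'E] := tinner _ de1.
  (* The Fitting correction [[t, e1]] is the inner derivation [ad w'], so [w] is shifted by [w']. *)
  exists (w + w') => g cg.
  have -> : d - ad br (w + w') = e0.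
    by rewrite adD opprD addrA E bracket_byE w'E addrK.
  case: cg => [yg|]; first by apply: e0c; left.
  rewrite inE => /predU1P[->|gl]; last by apply: e0c; right.
  by apply/esym/subr0_eq; rewrite -bracket_byE.
have [w wP] := goodT (vbasis T) (fun g => @vbasis_mem _ _ g T).
exists w; split; first exact: derB.
move=> g; rewrite GE => /memv_addP[_ /(mem_ad_space lieV)[y ys ->] [t tT ->]].
rewrite mulrDr [RHS]mulrDl wP; last by left; exists y.
congr (_ + _); rewrite (coord_vbasis tT) mulr_sumr mulr_suml; apply: eq_bigr => i _.
by rewrite endZl endZr wP //; right; rewrite mem_nth ?size_tuple.
Qed.

End GammaStructure.

(** * The isomorphisms *)

Lemma subr_rearrange (Z : zmodType) (a b c e f g : Z) :
  a + (b + c) - (e + (f + g)) - (c - g) = a - f + (b - e).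
Proof.
apply/eqP; rewrite subr_eq !opprD !addrA; apply/eqP.
by rewrite [LHS](ACl (1 * 5 * 2 * 4 * 3 * 6)).
Qed.

Section Identification.
Variables (K : fieldType) (charK : [pchar K] =i pred0).
Variables (V : vectType K) (br : V -> V -> V) (lieV : lie_law br).
Variable Gamma : {vspace 'End(V)}.
Hypothesis semisimple_Gamma : semisimple_action Gamma.
Variables (s k m : {vspace V}) (triple : is_Gamma_triple br Gamma s k m).
Hypothesis mu_inj : injective (mu br k m).
Variables (n : {vspace V}) (n_gen : is_generated_subalgebra br m n).
Implicit Types (d g : 'End(V)) (b : 'End(subvs_of m)).

Local Notation mu := (mu br k m).
Local Notation muk := (limg mu).
Local Notation B := (Der_restr br Gamma n m).
Local Notation N := (normalizer_in B muk).
Local Notation DG := (Der_centralizer br Gamma).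
Local Notation pk := (daddv_pi k (s + m)).
Local Notation pm := (daddv_pi m (s + k)).

Let cent_s := centralizer_s charK lieV semisimple_Gamma triple mu_inj.
Let cent_k := centralizer_k charK lieV semisimple_Gamma triple.
Let cent_m := centralizer_m charK lieV triple.
Let m_k := br_km lieV triple.

Lemma k_m_sub : (lie_prod br k m <= m)%VS.
Proof. apply/(lie_prod_subP lieV) => x z; exact: m_k. Qed.

Lemma muEv x (z : subvs_of m) : x \in k -> vsval (mu (vsproj k x) z) = br x (vsval z).
Proof. by move=> xk; rewrite (muE lieV) ?vsprojK // k_m_sub. Qed.

Lemma mukP b : b \in muk <-> exists2 x, x \in k & b = mu (vsproj k x).
Proof.
split=> [/memv_imgP[x _ ->]|[x _ ->]]; last by rewrite memv_img ?memvf.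
by exists (vsval x); rewrite ?subvsP // vsvalK.
Qed.

Lemma cap_k_sm : (k :&: (s + m) = 0)%VS.
Proof.
apply/eqP; rewrite -subv0; apply/subvP => v /memv_capP[vk /memv_addP[x xs [z zm E]]].
have vk' : - v \in k by rewrite memvN.
have [|_ /eqP v0 _] := decomp0 triple xs vk' zm; first by rewrite addrAC -E subrr.
by rewrite memv0 -oppr_eq0.
Qed.

Lemma cap_m_sk : (m :&: (s + k) = 0)%VS.
Proof.
apply/eqP; rewrite -subv0; apply/subvP => v /memv_capP[vm /memv_addP[x xs [y yk E]]].
have vm' : - v \in m by rewrite memvN.
have [|_ _ /eqP v0] := decomp0 triple xs yk vm'; first by rewrite -E subrr.
by rewrite memv0 -oppr_eq0.
Qed.

Lemma daddv_pi0 (U U' : {vspace V}) u : (U :&: U' = 0)%VS -> u \in U' ->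
  daddv_pi U U' u = 0.
Proof.
move=> cap uU'; have := daddv_pi_add cap (subvP (addvSr U U') u uU').
rewrite [X in _ + X]daddv_pi_id //; last by rewrite capvC.
by rewrite -{3}[u]add0r => /addIr.
Qed.

Lemma pk_s x : x \in s -> pk x = 0.
Proof. by move=> xs; apply: daddv_pi0 cap_k_sm _; exact: (subvP (addvSl _ _)). Qed.
Lemma pk_k x : x \in k -> pk x = x.
Proof. exact: daddv_pi_id cap_k_sm. Qed.
Lemma pk_m x : x \in m -> pk x = 0.
Proof. by move=> xm; apply: daddv_pi0 cap_k_sm _; exact: (subvP (addvSr _ _)). Qed.
Lemma pm_s x : x \in s -> pm x = 0.
Proof. by move=> xs; apply: daddv_pi0 cap_m_sk _; exact: (subvP (addvSl _ _)). Qed.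
Lemma pm_k x : x \in k -> pm x = 0.
Proof. by move=> xk; apply: daddv_pi0 cap_m_sk _; exact: (subvP (addvSr _ _)). Qed.
Lemma pm_m x : x \in m -> pm x = x.
Proof. exact: daddv_pi_id cap_m_sk. Qed.

Lemma radical_split v : v \in (m + k)%VS -> v = pk v + pm v.
Proof.
case/memv_addP => z zm [x xk ->]; rewrite !linearD /= pk_m // pk_k // pm_m // pm_k //.
by rewrite add0r addr0 addrC.
Qed.

Lemma n_sub : subalgebra br n. Proof. by case: n_gen => [[]]. Qed.
Lemma m_n : (m <= n)%VS. Proof. by case: n_gen => [[]]. Qed.
Lemma br_nn x y : x \in n -> y \in n -> br x y \in n.
Proof. by have /(lie_prod_subP lieV) H := n_sub; exact: H. Qed.

(** The elements of [n] that [d] sends into [n] form a subalgebra containing [m], hence all of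
    [n]. *)
Lemma derivation_stable_n d : is_derivation br d ->
  (forall z, z \in m -> d z \in m) -> (d @: n <= n)%VS.
Proof.
move=> dd dm; have mn := subvP m_n.
have : (n <= n :&: d @^-1: n)%VS.
  case: n_gen => _; apply; split; last first.
    by apply/subvP => z zm; rewrite memv_cap -memv_preim (mn _ zm) (mn _ (dm _ zm)).
  apply/(lie_prod_subP lieV) => x y /memv_capP[xn +] /memv_capP[yn].
  rewrite -!memv_preim memv_cap -memv_preim dd => dx dy.
  by rewrite br_nn ?memvD ?br_nn.
rewrite subv_cap => /andP[_ /subvP H]; apply/subvP => _ /memv_imgP[v vn ->].
by rewrite memv_preim H.
Qed.

Lemma Gamma_n g : g \in Gamma -> (g @: n <= n)%VS.
Proof.
move=> gG; apply: derivation_stable_n; first exact: (Gamma_derivation charK lieV triple gG).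
by move=> z; exact: (Gamma_m charK lieV triple gG).
Qed.

Lemma DGP d : d \in DG <-> is_derivation br d /\ forall g, g \in Gamma -> d * g = g * d.
Proof. exact: mem_Der_centralizer. Qed.

Lemma DG_m d z : d \in DG -> z \in m -> d z \in m.
Proof. by move=> /DGP[dd dG]; exact: cent_m. Qed.

Lemma img_m d : (forall z, z \in m -> d z \in m) -> (d @: m <= m)%VS.
Proof. by move=> dm; apply/subvP => _ /memv_imgP[z zm ->]; exact: dm. Qed.

Lemma restr_mE d (z : subvs_of m) : d \in DG -> vsval (restr m d z) = d (vsval z).
Proof. by move=> dD; apply/restrE/img_m => z'; exact: DG_m. Qed.

Lemma restr_normalizer d : d \in DG -> restr m d \in N.
Proof.
move=> dD; have [dd dG] := (DGP d).1 dD.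
have dn : (d @: n <= n)%VS by apply: derivation_stable_n => // z; exact: DG_m.
apply/mem_normalizer_in; split.
  apply/(@mem_Der_restr K V br Gamma n m _ lieV n_sub); exists (restr n d); split.
  - move=> x y; apply: val_inj; rewrite linearD /= (restrE _ dn).
    have inn u v : br (vsval (u : subvs_of n)) (vsval (v : subvs_of n)) \in n.
      by rewrite br_nn ?subvsP.
    by rewrite /sub_law !vsprojK ?inn // dd !(restrE _ dn).
  - move=> g gG; have gn := Gamma_n gG.
    suff : restr n d * restr n g = restr n g * restr n d by [].
    apply/lfunP => x; apply: val_inj; rewrite !endM /=.
    rewrite (restrE _ dn) (restrE _ gn) (restrE _ gn) (restrE _ dn).
    by rewrite -!endM dG.
  - move=> z; rewrite restr_mE // (restrE _ dn) vsprojK //.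
    by apply: (subvP m_n); exact: subvsP.
move=> _ /mukP[x xk ->]; apply/mukP; exists (d x); first exact: cent_k.
apply/lfunP => z; apply: val_inj; rewrite gl_lawE add_lfunE opp_lfunE !endM linearB /=.
rewrite restr_mE // !muEv // ?restr_mE //; last exact: cent_k.
by rewrite dd addrK.
Qed.

Lemma restr_inj d : d \in DG -> (forall z, z \in m -> d z = 0) -> d = 0.
Proof.
move=> dD d0; have [dd dG] := (DGP d).1 dD.
apply/lfunP => v; rewrite zero_lfunE; have [x [y [z [xs yk zm ->]]]] := decomp triple v.
rewrite !linearD /= (cent_s dd dG xs) (d0 z zm) add0r addr0.
have dyk : d y \in k by exact: cent_k.
rewrite -(vsprojK dyk); have -> : vsproj k (d y) = 0; last by rewrite linear0.
apply: mu_inj; rewrite linear0; apply/lfunP => z'; apply: val_inj.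
rewrite /= zero_lfunE linear0 muEv //; have /eqP := dd y (vsval z').
by rewrite (d0 _ (m_k yk (subvsP z'))) (d0 _ (subvsP z')) (br0r lieV) addr0 eq_sym => /eqP.
Qed.

(** The delicate case of the Leibniz rule is that of two elements of [m], whose bracket may have a
    component in [k]: the derivation [D] of [n] inducing [b] has to agree with the extension [d] on
    the part of [k] inside [n]. *)
Lemma restr_surj b : b \in N -> exists2 d, d \in DG & restr m d = b.
Proof.
move=> /mem_normalizer_in[/(@mem_Der_restr K V br Gamma n m _ lieV n_sub)[D [DD DGam Db]] bN].
have mn := subvP m_n.
(* Normalising [muk] means that [bracket_by b] preserves the image of [mu], where [mu^-1] is a
   genuine inverse. *)
pose al : 'End(subvs_of k) := (mu^-1 \o bracket_by b \o mu)%VF.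
have alE x : mu (al x) = gl_law b (mu x).
  rewrite !comp_lfunE bracket_byE limg_lfunVK //; apply: bN.
  by rewrite memv_img ?memvf.
have [d dE] : exists d : 'End(V), forall v,
    d v = vsval (al (vsproj k (pk v))) + vsval (b (vsproj m (pm v))).
  pose ik : 'Hom(subvs_of k, V) := linfun vsval.
  pose im : 'Hom(subvs_of m, V) := linfun vsval.
  pose qk : 'Hom(V, subvs_of k) := linfun (vsproj k).
  pose qm : 'Hom(V, subvs_of m) := linfun (vsproj m).
  exists ((ik \o (al \o (qk \o pk)))%VF + (im \o (b \o (qm \o pm)))%VF) => v.
  by rewrite add_lfunE !comp_lfunE !lfunE.
have ds x : x \in s -> d x = 0.
  by move=> xs; rewrite dE pk_s // pm_s // !linear0 addr0.
have dk x : x \in k -> d x = vsval (al (vsproj k x)).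
  by move=> xk; rewrite dE pk_k // pm_k // !linear0 addr0.
have dm z : z \in m -> d z = vsval (b (vsproj m z)).
  by move=> zm; rewrite dE pk_m // pm_m // !linear0 add0r.
have dkk x : x \in k -> d x \in k by move=> /dk ->; exact: subvsP.
have dmm z : z \in m -> d z \in m by move=> /dm ->; exact: subvsP.
have dkm x z : x \in k -> z \in m -> d (br x z) = br (d x) z + br x (d z).
  move=> xk zm; pose x' := vsproj k x; pose z' := vsproj m z.
  have E1 : mu x' z' = vsproj m (br x z).
    by apply: val_inj; rewrite /= muEv // !vsprojK // m_k.
  have := congr1 (fun f : 'End(subvs_of m) => vsval (f z')) (alE x').
  rewrite /= gl_lawE add_lfunE opp_lfunE !endM E1 linearB /=.
  rewrite !(muE lieV _ _ k_m_sub) -dk // -dm ?m_k // -(dm z) // !vsprojK // => ->.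
  by rewrite subrK.
have Dm z : z \in m -> vsval (D (vsproj n z)) = d z.
  by move=> zm; rewrite dm // Db vsprojK.
have DE x y : x \in n -> y \in n -> vsval (D (vsproj n (br x y))) =
    br (vsval (D (vsproj n x))) y + br x (vsval (D (vsproj n y))).
  move=> xn yn; have := DD (vsproj n x) (vsproj n y).
  rewrite {1}/sub_law !vsprojK // => ->; rewrite linearD /= /sub_law.
  by rewrite !vsprojK ?br_nn ?subvsP.
have Dg g x : g \in Gamma -> x \in n -> vsval (D (vsproj n (g x))) = g (vsval (D (vsproj n x))).
  move=> gG xn; have gn := Gamma_n gG; have : D * restr n g = restr n g * D := DGam g gG.
  move/(congr1 (fun f : 'End(subvs_of n) => vsval (f (vsproj n x)))).
  rewrite /= !endM (restrE _ gn) => <-; congr (vsval (D _)).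
  by apply: val_inj; rewrite /= (restrE _ gn) !vsprojK // (subvP gn) ?memv_img.
(* As [D] commutes with [Gamma], it sends [x] to a fixed vector, thus into [k]. The Leibniz rules of
   [D] and [d] for [[x, z]] give both images the same action on [m], and [mu] is injective. *)
have Dk x : x \in k -> x \in n -> vsval (D (vsproj n x)) = d x.
  move=> xk xn; set u := vsval _.
  have uk : u \in k.
    apply: (Gamma_fixed charK lieV semisimple_Gamma triple) => g gG.
    by rewrite -Dg // (Gamma_k charK lieV triple gG xk) !linear0.
  rewrite -(vsprojK uk) -(vsprojK (dkk x xk)); congr vsval; apply: mu_inj.
  apply/lfunP => z; apply: val_inj; rewrite /= !muEv ?dkk //.
  have zm := subvsP z; have := DE x _ xn (mn _ zm).
  by rewrite (Dm _ (m_k xk zm)) (Dm _ zm) (dkm _ _ xk zm) => /addIr ->.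
have dmm' z z' : z \in m -> z' \in m -> d (br z z') = br (d z) z' + br z (d z').
  move=> zm z'm; have [zn z'n] := (mn _ zm, mn _ z'm).
  rewrite -(Dm _ zm) -(Dm _ z'm) -DE //; have wn := br_nn zn z'n.
  (* The bracket lies in the radical; both of its components are in [n], where [D] and [d] agree on
     them. *)
  have /radical_split : br z z' \in (m + k)%VS by apply: (br_r lieV triple); exact: m_sub_r.
  move: wn; set w := br z z' => wn wE.
  have pkn : pk w \in n.
    have -> : pk w = w - pm w by rewrite {2}wE addrK.
    by rewrite memvB // mn ?memv_pi.
  rewrite wE !linearD /= Dk ?memv_pi // Dm ?memv_pi //.
have dd : is_derivation br d.
  (* The Leibniz rule is biadditive and symmetric in its arguments, which leaves six pairs of
     summands. *)
  pose Q u v := d (br u v) = br (d u) v + br u (d v).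
  have Qsym u v : Q u v -> Q v u.
    rewrite /Q => Quv; rewrite (brC lieV v u) linearN /= Quv opprD.
    by rewrite (brC lieV (d u)) (brC lieV u) !opprK addrC.
  have QD u u' v : Q u v -> Q u' v -> Q (u + u') v.
    rewrite /Q => Q1 Q2; rewrite (brDl lieV) !linearD /= Q1 Q2 !(brDl lieV).
    by rewrite addrACA.
  have QD' u v v' : Q u v -> Q u v' -> Q u (v + v').
    by move=> /Qsym Q1 /Qsym Q2; apply/Qsym/QD.
  have Qss x y : x \in s -> y \in s -> Q x y.
    move=> xs ys; rewrite /Q !ds ?(br_ss lieV triple) //.
    by rewrite (br0l lieV) (br0r lieV) addr0.
  have Qsk x y : x \in s -> y \in k -> Q x y.
    move=> xs yk; rewrite /Q (br_sk lieV triple xs yk) linear0 ds //.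
    by rewrite (br0l lieV) (br_sk lieV triple xs (dkk y yk)) addr0.
  have Qsm x z : x \in s -> z \in m -> Q x z.
    move=> xs zm; rewrite /Q (ds x xs) (br0l lieV) add0r -!(adE lieV).
    have aG := ad_Gamma lieV triple xs.
    rewrite -(Dm z) // -Dg ?mn // Dm //; exact: (Gamma_m charK lieV triple).
  (* Both sides lie in [k], so they are compared through their action on [m], where [dkm] and the
     Jacobi identity apply. *)
  have Qkk x y : x \in k -> y \in k -> Q x y.
    move=> xk yk; have xyk := br_kk lieV triple xk yk.
    have e1 := br_kk lieV triple (dkk x xk) yk.
    have e2 := br_kk lieV triple xk (dkk y yk).
    have e3 : br (d x) y + br x (d y) \in k by rewrite memvD.
    rewrite /Q -(vsprojK (dkk _ xyk)) -(vsprojK e3); congr vsval; apply: mu_inj.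
    apply/lfunP => z; apply: val_inj; rewrite /= !muEv ?dkk //.
    have zm := subvsP z; set z' := vsval z in zm *.
    have J a c : br (br a c) z' = br a (br c z') - br c (br a z').
      by rewrite (br_jacobi lieV a c) addrK.
    have H := dkm _ _ xyk zm.
    have -> : br (d (br x y)) z' = d (br (br x y) z') - br (br x y) (d z').
      by rewrite H addrK.
    rewrite (brDl lieV) !J linearB /= !dkm ?m_k // !(brDr lieV).
    have -> : br (br x y) (d z') = br x (br y (d z')) - br y (br x (d z')).
      by rewrite (br_jacobi lieV x y) addrK.
    exact: subr_rearrange.
  have Qkm x z : x \in k -> z \in m -> Q x z by exact: dkm.
  have Qmm z z' : z \in m -> z' \in m -> Q z z' by exact: dmm'.
  move=> u v; have [x [y [z [xs yk zm ->]]]] := decomp triple u.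
  have [x' [y' [z' [xs' yk' zm' ->]]]] := decomp triple v.
  rewrite -/(Q _ _); apply: (QD); first apply: (QD); apply: (QD'); try apply: (QD').
  - exact: Qss.
  - exact: Qsk.
  - exact: Qsm.
  - exact/Qsym/Qsk.
  - exact: Qkk.
  - exact: Qkm.
  - exact/Qsym/Qsm.
  - exact/Qsym/Qkm.
  - exact: Qmm.
exists d.
  apply/DGP; split=> // g gG; apply/lfunP => v; rewrite !endM.
  have [x [y [z [xs yk zm ->]]]] := decomp triple v; rewrite !linearD /=.
  rewrite (ds _ (Gamma_s charK lieV triple gG xs)) (ds x xs).
  rewrite (Gamma_k charK lieV triple gG yk) (Gamma_k charK lieV triple gG (dkk y yk)).
  by rewrite -(Dm z zm) -Dg ?mn // Dm ?linear0 // (Gamma_m charK lieV triple gG zm).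
apply/lfunP => z; apply: val_inj; rewrite /= restrE; last exact: img_m.
by rewrite dm ?subvsP // vsvalK.
Qed.

Definition theta : 'Hom(subvs_of DG, subvs_of N) :=
  linfun (fun d : subvs_of DG => vsproj N (restr m (vsval d))).

Lemma thetaE (d : subvs_of DG) (z : subvs_of m) : vsval (vsval (theta d) z) = vsval d (vsval z).
Proof.
have mE (e : subvs_of DG) w : vsval (restr m (vsval e) w) = vsval e (vsval w).
  by rewrite restr_mE ?subvsP.
have rN (e : subvs_of DG) : restr m (vsval e) \in N by apply: restr_normalizer; exact: subvsP.
have rP a (e f : subvs_of DG) : restr m (vsval (a *: e + f)) =
    a *: restr m (vsval e) + restr m (vsval f).
  apply/lfunP => w; rewrite add_lfunE scale_lfunE; apply: val_inj.
  rewrite linearP /= !mE restr_mE ?add_lfunE ?scale_lfunE //.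
  by rewrite memvD ?memvZ ?subvsP.
by rewrite /theta linfunE ?vsprojK // => a e f; rewrite rP linearP.
Qed.

Lemma theta_inj : injective theta.
Proof.
move=> d e E; apply/subr0_eq; apply: val_inj; rewrite linear0; apply: restr_inj.
  exact: subvsP.
move=> z zm; rewrite linearB /= add_lfunE opp_lfunE -(vsprojK zm) -!thetaE E.
exact: subrr.
Qed.

Lemma theta_surj (b : subvs_of N) : exists d : subvs_of DG, theta d = b.
Proof.
have [d dD db] := restr_surj (subvsP b); exists (vsproj DG d).
apply: val_inj; apply/lfunP => z; apply: val_inj.
by rewrite /= thetaE vsprojK // -db restr_mE.
Qed.

Lemma theta_bij : bijective theta.
Proof.
exists (theta^-1)%VF; first by apply: lker0_lfunK; apply/lker0P; exact: theta_inj.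
by move=> b; apply: limg_lfunVK; have [d <-] := theta_surj b; rewrite memv_img ?memvf.
Qed.

Lemma DG_gl d e : d \in DG -> e \in DG -> gl_law d e \in DG.
Proof.
move=> /DGP[dd dG] /DGP[de eG]; apply/DGP; split; first exact: derivation_gl.
move=> g gG; rewrite gl_lawE mulrBl mulrBr; congr (_ - _).
  by rewrite -mulrA (eG g gG) [RHS]mulrA -(dG g gG) mulrA.
by rewrite -mulrA (dG g gG) [RHS]mulrA -(eG g gG) mulrA.
Qed.

Lemma restr_gl d e : d \in DG -> e \in DG ->
  restr m (gl_law d e) = gl_law (restr m d) (restr m e).
Proof.
move=> dD eD; apply/lfunP => z; apply: val_inj.
rewrite /= restr_mE ?DG_gl // !gl_lawE !add_lfunE !opp_lfunE !endM linearB /=.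
by rewrite !restr_mE.
Qed.

Lemma theta_val (d : subvs_of DG) : vsval (theta d) = restr m (vsval d).
Proof.
by apply/lfunP => z; apply: val_inj; rewrite /= thetaE restr_mE ?subvsP.
Qed.

Lemma N_gl b c : b \in N -> c \in N -> gl_law b c \in N.
Proof.
move=> /restr_surj[d dD <-] /restr_surj[e eD <-]; rewrite -restr_gl //.
by apply: restr_normalizer; exact: DG_gl.
Qed.

Lemma theta_iso : lie_isomorphism (@sub_law _ _ (@gl_law K V) _)
  (@sub_law _ _ (@gl_law K (subvs_of m)) _) theta.
Proof.
split; first exact: theta_bij.
move=> d e; apply: val_inj; rewrite /= theta_val /sub_law !vsprojK ?DG_gl ?N_gl ?subvsP //.
by rewrite restr_gl ?subvsP // !theta_val.
Qed.

Lemma ad_k_DG x : x \in k -> ad br x \in DG.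
Proof.
move=> xk; apply/DGP; split; first exact: derivation_ad.
by move=> g gG; exact: (ad_k_centralizes charK lieV triple xk gG).
Qed.

Lemma restr_ad_k x : x \in k -> restr m (ad br x) = mu (vsproj k x).
Proof.
move=> xk; apply/lfunP => z; apply: val_inj.
by rewrite /= restr_mE ?ad_k_DG // muEv // adE.
Qed.

(** For [g] in [Gamma], [ad (g x) = [g, ad x] = 0] and the center is trivial, so [x] is fixed by
    [Gamma]. *)
Lemma ad_DG_k x : ad br x \in DG -> x \in k.
Proof.
move=> /DGP[_ xG]; apply: (Gamma_fixed charK lieV semisimple_Gamma triple) => g gG.
apply: (ad_inj charK lieV semisimple_Gamma triple mu_inj).
rewrite -(derivation_bracket lieV); last exact: (Gamma_derivation charK lieV triple gG).
by rewrite xG // subrr -(lad_ad lieV) linear0.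
Qed.

Lemma muk_N : (muk <= N)%VS.
Proof.
by apply/subvP => _ /mukP[x xk ->]; rewrite -restr_ad_k // restr_normalizer ?ad_k_DG.
Qed.

Lemma split_Der d : is_derivation br d ->
  exists x y z e, [/\ x \in s, y \in k, z \in m, e \in DG & d = ad br x + (ad br y + e) + ad br z].
Proof.
move=> dd.
have [w [ed eG]] := derivation_split charK lieV triple dd.
have [x [y [z [xs yk zm E]]]] := decomp triple w.
exists x, y, z, (d - ad br w); split=> //; first exact/DGP.
rewrite -{1}[d](subrK (ad br w)) {2}E !(adD lieV); move: (d - _) => e.
by rewrite addrC [_ + (_ + e)]addrA [RHS]addrAC.
Qed.

(** The center is already trivial, and an inner derivation commuting with [Gamma] comes from [k].
    Completeness thus says that Der(g)^Gamma reduces to ad k, which restriction to [m] turns into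
    [muk = N]. *)
Lemma complete_iff : is_complete br <-> muk = N.
Proof.
split=> [[_ inner]|NE].
  apply/eqP; rewrite eqEsubv muk_N; apply/subvP => b /restr_surj[d dD <-].
  have [x dx] := inner d ((DGP d).1 dD).1; have xk : x \in k by apply: ad_DG_k; rewrite -dx.
  by rewrite dx restr_ad_k // memv_img ?memvf.
split=> [x x0|d dd].
  by apply: (center0 charK lieV semisimple_Gamma triple mu_inj).
have [w [ed eG]] := derivation_split charK lieV triple dd.
have eD : d - ad br w \in DG by exact/DGP.
have := restr_normalizer eD; rewrite -NE => /mukP[x xk E].
exists (x + w); rewrite (adD lieV) -[LHS](subrK (ad br w)); congr (_ + _).
apply/subr0_eq; apply: restr_inj; first by rewrite memvB ?ad_k_DG.
move=> z zm; rewrite add_lfunE opp_lfunE -(vsprojK zm) -!restr_mE ?ad_k_DG //.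
by rewrite E restr_ad_k // subrr.
Qed.

(** * The law transported from the algebra of derivations *)

Let W : vectType K := (subvs_of s * subvs_of N * subvs_of m)%type.
Let S := (subvs_of s * subvs_of N * subvs_of m)%type.

(** Inner derivations by elements of [k] are covered by the middle term, as the preimages under
    [theta] of [muk]. *)
Definition recompose_end (c : W) : 'End(V) :=
  ad br (vsval c.1.1) + vsval ((theta^-1)%VF c.1.2) + ad br (vsval c.2).

Lemma recompose_Der c : recompose_end c \in Der br.
Proof.
have ad_Der x : ad br x \in Der br by apply/(mem_Der lieV); exact: derivation_ad.
rewrite !memvD //; apply/(mem_Der lieV).
by have /DGP[] := subvsP ((theta^-1)%VF c.1.2).
Qed.

Definition recompose : 'Hom(W, subvs_of (Der br)) :=
  linfun (fun c : W => vsproj (Der br) (recompose_end c)).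

Lemma recompose_end_linear : linear recompose_end.
Proof.
move=> a u v; rewrite /recompose_end.
have -> : vsval (a *: u + v).1.1 = a *: vsval u.1.1 + vsval v.1.1 by [].
have -> : vsval (a *: u + v).2 = a *: vsval u.2 + vsval v.2 by [].
have -> : (theta^-1)%VF (a *: u + v).1.2 =
  a *: (theta^-1)%VF u.1.2 + (theta^-1)%VF v.1.2 by exact: linearP.
have -> : vsval (a *: (theta^-1)%VF u.1.2 + (theta^-1)%VF v.1.2) =
  a *: vsval ((theta^-1)%VF u.1.2) + vsval ((theta^-1)%VF v.1.2) by [].
rewrite !(linear_ad lieV) !scalerDr; exact: (AC ((2*2)*2) ((1*3*5)*(2*4*6))).
Qed.

Lemma recomposeE c : vsval (recompose c) = recompose_end c.
Proof.
rewrite /recompose linfunE ?vsprojK ?recompose_Der // => a u v.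
by rewrite recompose_end_linear linearP.
Qed.

Lemma thetaVK (b : subvs_of N) : theta ((theta^-1)%VF b) = b.
Proof. by apply: limg_lfunVK; have [d <-] := theta_surj b; rewrite memv_img ?memvf. Qed.

Lemma thetaV_m (b : subvs_of N) (z : subvs_of m) :
  vsval ((theta^-1)%VF b) (vsval z) = vsval (vsval b z).
Proof. by rewrite -thetaE thetaVK. Qed.

Lemma thetaV_eq (b : subvs_of N) d : d \in DG -> restr m d = vsval b ->
  vsval ((theta^-1)%VF b) = d.
Proof.
move=> dD db; rewrite -(vsprojK dD); congr vsval; apply: theta_inj.
by apply: val_inj; rewrite /= thetaVK theta_val vsprojK.
Qed.

(** If [ad x + e + ad z = 0] with [e] in [DG], then [ad (x + z)] commutes with [Gamma], so [x + z]
    lies in [k], and the decomposition of the algebra forces [x = z = 0]. *)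
Lemma recompose_inj : injective recompose.
Proof.
move=> c c' E; apply/subr0_eq; have : recompose (c - c') = 0.
  by rewrite linearB /= E subrr.
case: (c - c') => [[x b] z] /(congr1 vsval); rewrite recomposeE /recompose_end /= => E0.
set e := vsval ((theta^-1)%VF b) in E0; have eD : e \in DG by exact: subvsP.
have [de eG] := (DGP e).1 eD.
have xs := subvsP x; have zm := subvsP z.
have Exz : ad br (vsval x + vsval z) = - e.
  apply/eqP; rewrite (adD lieV) -addr_eq0 addrAC; exact/eqP.
have xzk : vsval x + vsval z \in k by apply: ad_DG_k; rewrite Exz memvN.
have xzk' : - (vsval x + vsval z) \in k by rewrite memvN.
have [|x0 _ z0] := decomp0 triple xs xzk' zm.
  by rewrite addrAC subrr.
have e0 : e = 0.
  by apply/eqP; rewrite -oppr_eq0 -Exz x0 z0 addr0 -(lad_ad lieV) linear0.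
have b0 : b = 0 by rewrite -(thetaVK b) (_ : (theta^-1)%VF b = 0) ?linear0 //; apply: val_inj.
have -> : x = 0 by apply: val_inj.
have -> : z = 0 by apply: val_inj.
by rewrite b0.
Qed.

Lemma recompose_surj (d : subvs_of (Der br)) : exists c, recompose c = d.
Proof.
have /(mem_Der lieV) dd := subvsP d.
have [x [y [z [e [xs yk zm eD E]]]]] := split_Der dd.
have yeD : ad br y + e \in DG by rewrite memvD ?ad_k_DG.
exists (vsproj s x, vsproj N (restr m (ad br y + e)), vsproj m z).
apply: val_inj; rewrite /= recomposeE /recompose_end /= !vsprojK // E.
by rewrite (thetaV_eq yeD) // vsprojK // restr_normalizer.
Qed.

Local Notation Der_law := (@sub_law _ _ (@gl_law K V) (Der br)).

Lemma Der_sub : subalgebra (@gl_law K V) (Der br).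
Proof.
apply/(lie_prod_subP (@lie_gl K V)) => d e /(mem_Der lieV) dd /(mem_Der lieV) de.
by apply/(mem_Der lieV); exact: derivation_gl.
Qed.

Definition decompose : 'Hom(subvs_of (Der br), W) := (recompose^-1)%VF.

Lemma recomposeK : cancel recompose decompose.
Proof. by apply: lker0_lfunK; apply/lker0P; exact: recompose_inj. Qed.
Lemma decomposeK : cancel decompose recompose.
Proof.
by move=> d; apply: limg_lfunVK; have [c <-] := recompose_surj d; rewrite memv_img ?memvf.
Qed.

Definition transported_law (u v : S) : S :=
  decompose (Der_law (recompose u) (recompose v)).

Lemma transported_law_lie : lie_law transported_law.
Proof.
have [Dr Dl Da Dj] := lie_law_sub (@lie_gl K V) Der_sub.
split=> [u a v w|w a u v|u|u v w]; rewrite /transported_law.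
- by rewrite linearP Dr linearP.
- by rewrite linearP Dl linearP.
- by rewrite Da linear0.
- apply: (can_inj recomposeK); rewrite !linearD !linear0 /= !decomposeK.
  exact: Dj.
Qed.

Lemma transported_lawE u v c : recompose_end c =
    gl_law (recompose_end u) (recompose_end v) ->
  transported_law u v = c.
Proof.
move=> E; apply: (can_inj recomposeK); rewrite decomposeK; apply: val_inj.
rewrite /= recomposeE E /sub_law !recomposeE vsprojK //.
apply: (lie_prod_subP (@lie_gl K V) _ _ _ Der_sub); exact: recompose_Der.
Qed.

Lemma transported_law_Phi : is_Phi br k transported_law.
Proof.
have lT := transported_law_lie.
have ad0 : ad br 0 = 0 by rewrite -(lad_ad lieV) linear0.
have th0 : vsval ((theta^-1)%VF 0) = 0 by rewrite linear0.
have vs0 : vsval (0 : subvs_of s) = 0 by rewrite linear0.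
have vm0 : vsval (0 : subvs_of m) = 0 by rewrite linear0.
have rE (x : subvs_of s) (b : subvs_of N) (z : subvs_of m) :
    recompose_end (x, b, z) = ad br (vsval x) + vsval ((theta^-1)%VF b) + ad br (vsval z).
  by [].
have adad x y : gl_law (ad br x) (ad br y) = ad br (br x y) by rewrite (adM lieV).
have glDr := brDr (@lie_gl K V).
have eDG (b : subvs_of N) : vsval ((theta^-1)%VF b) \in DG by exact: subvsP.
split.
- by split=> [u|u v]; [case: lT => l _ _ _; exact: l | exact: (brC lT)].
- move=> x1 x2 y2 z2.
  have xs1 := subvsP x1; have xs2 := subvsP x2; have zm2 := subvsP z2.
  have e1 : br (vsval x1) (vsval x2) \in s by exact: (br_ss lieV triple).
  have e2 : br (vsval x1) (vsval z2) \in m by exact: (br_sm lieV triple).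
  rewrite (@transported_lawE _ _ (vsproj s (br (vsval x1) (vsval x2)), 0,
    vsproj m (br (vsval x1) (vsval z2)))).
    by rewrite /components /= !vsprojK.
  rewrite !rE !vsprojK // th0 vm0 ad0 !addr0 !glDr !adad; congr (_ + _).
  (* [ad x1] belongs to [Gamma], so it commutes with the derivation given by [y2] and no mixed term
     remains. *)
  have [d2 G2] := (DGP _).1 (eDG y2).
  rewrite -[LHS]addr0; congr (_ + _).
  by rewrite gl_lawE G2 ?subrr //; exact: (ad_Gamma lieV triple xs1).
- move=> y1 y2 z2; have zm2 := subvsP z2.
  rewrite (@transported_lawE _ _ (0, vsproj N (gl_law (vsval y1) (vsval y2)),
     vsval y1 z2)).
    by rewrite /components /= vsprojK // N_gl ?subvsP.
  rewrite !rE vs0 vm0 ad0 !addr0 !add0r !glDr.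
  have [d1 G1] := (DGP _).1 (eDG y1).
  congr (_ + _).
    apply: thetaV_eq; first exact: DG_gl.
    by rewrite restr_gl // -!theta_val !thetaVK vsprojK // N_gl ?subvsP.
  by rewrite gl_lawE (derivation_bracket lieV) // thetaV_m.
- move=> z1 z2; have zm1 := subvsP z1; have zm2 := subvsP z2.
  set w := br (vsval z1) (vsval z2).
  (* In the radical, [w] has no component in [s]; its component in [k] becomes an element of [muk],
     hence of [N]. *)
  have wr : w \in (m + k)%VS by apply: (br_r lieV triple); exact: m_sub_r.
  have pkk := memv_pi k (s + m) w; have pmm := memv_pi m (s + k) w.
  rewrite (@transported_lawE _ _ (0, vsproj N (mu (vsproj k (pk w))), vsproj m (pm w))).
    by rewrite /components /= !vsprojK // (subvP muk_N) // memv_img ?memvf.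
  rewrite !rE vs0 th0 ad0 !addr0 !add0r adad -/w [in RHS](radical_split wr) (adD lieV).
  rewrite vsprojK //; congr (_ + _); apply: thetaV_eq; first exact: ad_k_DG.
  by rewrite restr_ad_k // vsprojK // (subvP muk_N) // memv_img ?memvf.
Qed.

End Identification.

Theorem theorem2
  (K : fieldType) (charK : [pchar K] =i pred0)
  (V : vectType K) (br : V -> V -> V) (lieV : lie_law br)
  (e Gamma : {vspace 'End(V)})
  (e_hull : is_algebraic_hull (ad_space br fullv) e)
  (Gamma_mcr : is_mcr e Gamma)
  (s k m : {vspace V}) (triple : is_Gamma_triple br Gamma s k m)
  (n : {vspace V}) (n_gen : is_generated_subalgebra br m n)
  (mu_inj : injective (mu br k m)) :
  let muk := limg (mu br k m) in
  let B := Der_restr br Gamma n m in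
  let N := normalizer_in B muk in
  [/\ exists Theta : 'Hom(subvs_of (Der_centralizer br Gamma), subvs_of N),
        (forall delta z,
           vsval (vsval (Theta delta) z) = vsval delta (vsval z)) /\
        lie_isomorphism (@sub_law _ _ (@gl_law K V) _)
          (@sub_law _ _ (@gl_law K (subvs_of m)) _) Theta,
      exists Phi : subvs_of s * subvs_of N * subvs_of m ->
                   subvs_of s * subvs_of N * subvs_of m ->
                   subvs_of s * subvs_of N * subvs_of m,
        [/\ is_Phi br k Phi, lie_law Phi
          & exists F, lie_isomorphism
                        (@sub_law _ _ (@gl_law K V) (Der br)) Phi F]
    & is_complete br <-> muk = N].
Proof.
have [[[_ ssG] _] _] := Gamma_mcr.
split.
- exists (theta br Gamma k m n).
  split; last exact: (theta_iso charK lieV ssG triple mu_inj n_gen).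
  by move=> d z; exact: (thetaE charK lieV ssG triple n_gen).
- exists (@transported_law K V br Gamma s k m n).
  split.
  + exact: (transported_law_Phi charK lieV ssG triple mu_inj n_gen).
  + exact: (transported_law_lie charK lieV ssG triple mu_inj n_gen).
  (* This is the direction in which the transported law is multiplicative by construction. *)
  exists (decompose br Gamma s k m n); split; last first.
    by move=> d d'; rewrite /transported_law
      !(decomposeK charK lieV ssG triple mu_inj n_gen).
  exists (recompose br Gamma s k m n).
    exact: (decomposeK charK lieV ssG triple mu_inj n_gen).
  exact: (recomposeK charK lieV ssG triple mu_inj n_gen).
exact: (complete_iff charK lieV ssG triple mu_inj n_gen).
Qed.
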